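(* Let $\mathcal K=\mathcal R\mathcal J$ be the operator on the tangent bundle of the Ablowitz--Ladik phase space $\mathcal C$ defined in the context. Then the bracket $\{F,G\}_{\mathcal K}=\langle\nabla F,\mathcal K\nabla G\rangle$ defines an almost Poisson structure on $\mathcal C$.
   Context: An almost Poisson structure is a bilinear bracket on functionals that is skew-symmetric and satisfies the Leibniz identity $\{FG,H\}=F\{G,H\}+G\{F,H\}$ (the Jacobi identity is not required). Phase space. $\mathcal C$ is the space of sequences $(q_k,r_k)^T_{k\in\mathbb Z}$ in $\mathbb C^2$ with $|q_k|,|r_k|\to0$ as $k\to\pm\infty$; potentials are assumed to vanish rapidly (so that all sums below converge) and $1-r_kq_k\ne0$. On the tangent space at $(q,r)^T$ one has the (non-Hermitian) bilinear form $$\langle(a,b)^T,(c,d)^T\rangle=-\sum_{k\in\mathbb Z}(a_kd_k+b_kc_k)(1-q_kr_k)^{-1},$$ and $^*$ denotes the adjoint with respect to it. The functionals considered are smooth functionals over $\mathcal C$ that become real-valued under the identification $r_k=-\overline{q}_k$. The functional gradient of $F$ is $\nabla_kF=-(1-q_kr_k)\,(\delta F/\delta r_k,\ \delta F/\delta q_k)^T$. Let $\mathcal J$ act as $\mathrm{diag}(-i,i)$ at each site and let $\sigma_3=\mathrm{diag}(1,-1)$. Operators. For $w=(u_k,v_k)^T_{k\in\mathbb Z}$ put $s_j=\dfrac{q_ju_j-r_jv_j}{1-r_jq_j}$ and $$(Lw)_k=\begin{pmatrix} u_{k-1}-(1-r_kq_k)r_{k-1}\sum_{j\ge k}s_j-r_k\sum_{j\ge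 k}(q_ju_{j-1}-r_jv_{j+1})\\ v_{k+1}-(1-r_kq_k)q_{k+1}\sum_{j\ge k+1}s_j-q_k\sum_{j\ge k+1}(q_ju_{j-1}-r_jv_{j+1})\end{pmatrix},$$ $$(L^{-1}w)_k=\begin{pmatrix} u_{k+1}+(1-r_kq_k)r_{k+1}\sum_{j\ge k+1}s_j+r_k\sum_{j\ge k+1}(q_ju_{j+1}-r_jv_{j-1})\\ v_{k-1}+(1-r_kq_k)q_{k-1}\sum_{j\ge k}s_j+q_k\sum_{j\ge k}(q_ju_{j+1}-r_jv_{j-1})\end{pmatrix}.$$ Set $\mathcal L_+=L+L^{-1}$ and $\mathcal L_-=\sigma_3\mathcal L_+^*\sigma_3^{-1}$; explicitly, with $t_j=q_j(u_{j+1}-u_{j-1})+r_j(v_{j+1}-v_{j-1})$, $$(\mathcal L_-w)_k=\begin{pmatrix} u_{k+1}+u_{k-1}-(1-r_kq_k)\left[r_{k+1}\sum_{j\le k}s_j-r_{k-1}\sum_{j\le k-1}s_j\right]-r_k\sum_{j\le k}t_j-r_kq_ku_{k-1}+r_k^2v_{k+1}\\ v_{k+1}+v_{k-1}+(1-r_kq_k)\left[q_{k+1}\sum_{j\le k}s_j-q_{k-1}\sum_{j\le k-1}s_j\right]-q_k\sum_{j\le k}t_j+q_k^2u_{k+1}-q_kr_kv_{k-1}\end{pmatrix}.$$ Finally $$\mathcal R=\begin{pmatrix}0&1\\-1&0\end{pmatrix}(\mathcal L_++\mathcal L_-)\begin{pmatrix}0&-1\\1&0\end{pmatrix},\qquad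 \mathcal K=\mathcal R\mathcal J.$$ *)

(* Defs.v *)
From Stdlib Require Import Reals ZArith.
From Coquelicot Require Import Coquelicot.

Open Scope R_scope.

(** ** Sums of complex terms over integers *)

Definition Csum (a : nat -> C) : C :=
  (Series (fun n => fst (a n)), Series (fun n => snd (a n))).

Definition sum_ge (k : Z) (f : Z -> C) : C :=
  Csum (fun n => f (k + Z.of_nat n)%Z).

Definition sum_le (k : Z) (f : Z -> C) : C :=
  Csum (fun n => f (k - Z.of_nat n)%Z).

Definition sumZ (f : Z -> C) : C := (sum_ge 0 f + sum_le (-1) f)%C.

(** [Csum] is total; absolute convergence, which makes all the sums above
    genuine, is recorded separately. *)
Definition abs_summable (f : Z -> C) : Prop :=
  ex_series (fun n => Cmod (f (Z.of_nat n))) /\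
  ex_series (fun n => Cmod (f (- Z.of_nat n)%Z)).

(** ** Phase space and tangent vectors *)

(** Both points (q_k, r_k) and tangent vectors (u_k, v_k). *)
Definition bisequence := Z -> C * C.

Definition weight (N : nat) (k : Z) : R := (1 + Rabs (IZR k)) ^ N.

(** Rapid decrease: faster than every power of 1/(1+|k|). *)
Definition rapid (f : Z -> C) : Prop :=
  forall N : nat, exists M : R, forall k : Z, weight N k * Cmod (f k) <= M.

Definition tangent (w : bisequence) : Prop :=
  rapid (fun k => fst (w k)) /\ rapid (fun k => snd (w k)).

Definition phase (p : bisequence) : Prop :=
  tangent p /\ forall k, (1 - snd (p k) * fst (p k))%C <> 0%C.

Definition reduced (p : bisequence) : Prop :=
  forall k, snd (p k) = (- Cconj (fst (p k)))%C.

Definition pairing_term (p w w' : bisequence) (k : Z) : C :=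
  ((fst (w k) * snd (w' k) + snd (w k) * fst (w' k))
     / (1 - fst (p k) * snd (p k)))%C.

Definition pairing (p w w' : bisequence) : C :=
  (- sumZ (pairing_term p w w'))%C.

(** ** Smooth functionals

    Smoothness on the Fréchet manifold [phase] is taken in the sense of
    convenient calculus (which on Fréchet spaces is the usual notion of C^oo):
    a map is smooth when it sends smooth finite-dimensional families of points
    to smooth families. *)

(** The normed space R^(n+1). *)
Fixpoint Rn (n : nat) : NormedModule R_AbsRing :=
  match n with
  | O => R_NormedModule
  | S m => prod_NormedModule R_AbsRing R_NormedModule (Rn m)
  end.

(** Maps from R^(n+1) to the space of families [f : I -> V] on which all the
    seminorms  sup_i w N i * |f i|  are finite.  Directional derivatives are
    taken index by index; as they are required to be continuous for all the
    seminorms, this agrees with differentiability for the seminorms. *)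
Section Smooth.
Context {I : Type} {V : NormedModule R_AbsRing} (w : nat -> I -> R) {n : nat}.

Definition continuous_family_at (f : Rn n -> I -> V) (x : Rn n) : Prop :=
  forall N : nat,
    (exists M : R, forall i, w N i * norm (f x i) <= M) /\
    (forall eps : posreal,
       locally x (fun y => forall i, w N i * norm (minus (f y i) (f x i)) <= eps)).

Definition directional_derivative
    (f : Rn n -> I -> V) (x v : Rn n) (l : I -> V) : Prop :=
  forall i, is_derive (fun t : R => f (plus x (scal t v)) i) 0 (l i).

Fixpoint Ck_family (m : nat) (U : Rn n -> Prop) (f : Rn n -> I -> V) : Prop :=
  (forall x, U x -> continuous_family_at f x) /\
  match m with
  | O => True
  | S m' => forall v, exists f' : Rn n -> I -> V,
      (forall x, U x -> directional_derivative f x v (f' x)) /\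
      Ck_family m' U f'
  end.

Definition smooth_family (U : Rn n -> Prop) (f : Rn n -> I -> V) : Prop :=
  forall m, Ck_family m U f.

End Smooth.

Definition C2_NormedModule : NormedModule R_AbsRing :=
  prod_NormedModule R_AbsRing C_R_NormedModule C_R_NormedModule.

Definition smooth_bisequence {n : nat} (U : Rn n -> Prop)
    (c : Rn n -> bisequence) : Prop :=
  smooth_family (V := C2_NormedModule) weight U c.

Definition smooth_scalar {n : nat} (U : Rn n -> Prop) (g : Rn n -> C) : Prop :=
  smooth_family (I := unit) (V := C_R_NormedModule)
    (fun _ _ => 1) U (fun x _ => g x).

(** A smooth family of points of the phase space. *)
Definition plot {n : nat} (U : Rn n -> Prop) (c : Rn n -> bisequence) : Prop :=
  open U /\ smooth_bisequence U c /\ forall x, U x -> phase (c x).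

Definition shift_q (p : bisequence) (k : Z) (z : C) : bisequence :=
  fun j => if Z.eq_dec j k then ((fst (p j) + z)%C, snd (p j)) else p j.

Definition shift_r (p : bisequence) (k : Z) (z : C) : bisequence :=
  fun j => if Z.eq_dec j k then (fst (p j), (snd (p j) + z)%C) else p j.

Definition functional_derivative (F : bisequence -> C) (p : bisequence)
  : bisequence :=
  fun k => (C_derive (fun z => F (shift_q p k z)) 0%C,
            C_derive (fun z => F (shift_r p k z)) 0%C).

Definition first_variation (F : bisequence -> C) (p h : bisequence) : C :=
  sumZ (fun k => (fst (functional_derivative F p k) * fst (h k)
                  + snd (functional_derivative F p k) * snd (h k))%C).

(** Only the values of [F] on [phase] matter.  The variables q and r are
    independent, so the first variation is complex linear in (dq, dr); the
    functional derivatives represent it and form a smooth field of rapidly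
    decreasing bisequences, so that the gradient is a smooth vector field. *)
Record functional (F : bisequence -> C) : Prop := {
  functional_smooth :
    forall (n : nat) (U : Rn n -> Prop) (c : Rn n -> bisequence),
      plot U c -> smooth_scalar U (fun x => F (c x));
  functional_variation :
    forall (n : nat) (U : Rn n -> Prop) (c : Rn n -> bisequence)
           (x v : Rn n) (h : bisequence),
      plot U c -> U x ->
      directional_derivative (V := C2_NormedModule) c x v h ->
      is_derive (K := R_AbsRing) (V := C_R_NormedModule)
        (fun t : R => F (c (plus x (scal t v)))) 0 (first_variation F (c x) h);
  functional_derivative_smooth :
    forall (n : nat) (U : Rn n -> Prop) (c : Rn n -> bisequence),
      plot U c -> smooth_bisequence U (fun x => functional_derivative F (c x));
  functional_real :
    forall p, phase p -> reduced p -> Im (F p) = 0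
}.

Definition gradient (F : bisequence -> C) (p : bisequence) : bisequence :=
  fun k =>
    let d := functional_derivative F p k in
    let c := (- (1 - fst (p k) * snd (p k)))%C in
    ((c * snd d)%C, (c * fst d)%C).

(** ** The operators *)

Section Operators.
Variables (p w : bisequence).
Let q k := fst (p k).
Let r k := snd (p k).
Let u k := fst (w k).
Let v k := snd (w k).
Local Open Scope C_scope.

Definition s_term (j : Z) : C := (q j * u j - r j * v j) / (1 - r j * q j).

Definition a_term (j : Z) : C := q j * u (j - 1)%Z - r j * v (j + 1)%Z.

Definition b_term (j : Z) : C := q j * u (j + 1)%Z - r j * v (j - 1)%Z.

Definition t_term (j : Z) : C :=
  q j * (u (j + 1)%Z - u (j - 1)%Z) + r j * (v (j + 1)%Z - v (j - 1)%Z).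

Definition L : bisequence := fun k =>
  ( u (k - 1)%Z
    - (1 - r k * q k) * r (k - 1)%Z * sum_ge k s_term
    - r k * sum_ge k a_term,
    v (k + 1)%Z
    - (1 - r k * q k) * q (k + 1)%Z * sum_ge (k + 1) s_term
    - q k * sum_ge (k + 1) a_term ).

Definition Linv : bisequence := fun k =>
  ( u (k + 1)%Z
    + (1 - r k * q k) * r (k + 1)%Z * sum_ge (k + 1) s_term
    + r k * sum_ge (k + 1) b_term,
    v (k - 1)%Z
    + (1 - r k * q k) * q (k - 1)%Z * sum_ge k s_term
    + q k * sum_ge k b_term ).

Definition Lplus : bisequence := fun k =>
  (fst (L k) + fst (Linv k), snd (L k) + snd (Linv k)).

Definition Lminus : bisequence := fun k =>
  ( u (k + 1)%Z + u (k - 1)%Z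
    - (1 - r k * q k) * (r (k + 1)%Z * sum_le k s_term
                         - r (k - 1)%Z * sum_le (k - 1) s_term)
    - r k * sum_le k t_term
    - r k * q k * u (k - 1)%Z + r k * r k * v (k + 1)%Z,
    v (k + 1)%Z + v (k - 1)%Z
    + (1 - r k * q k) * (q (k + 1)%Z * sum_le k s_term
                         - q (k - 1)%Z * sum_le (k - 1) s_term)
    - q k * sum_le k t_term
    + q k * q k * u (k + 1)%Z - q k * r k * v (k - 1)%Z ).

End Operators.

Definition J (w : bisequence) : bisequence :=
  fun k => ((- Ci * fst (w k))%C, (Ci * snd (w k))%C).

Definition sigma3 (w : bisequence) : bisequence :=
  fun k => (fst (w k), (- snd (w k))%C).

(** The matrix with rows (0, 1) and (-1, 0), and its inverse. *)
Definition rot (w : bisequence) : bisequence :=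
  fun k => (snd (w k), (- fst (w k))%C).

Definition rot_inv (w : bisequence) : bisequence :=
  fun k => ((- snd (w k))%C, fst (w k)).

Definition Rop (p w : bisequence) : bisequence :=
  rot (fun k =>
         ((fst (Lplus p (rot_inv w) k) + fst (Lminus p (rot_inv w) k))%C,
          (snd (Lplus p (rot_inv w) k) + snd (Lminus p (rot_inv w) k))%C)).

Definition Kop (p w : bisequence) : bisequence := Rop p (J w).

Definition bracket_K (F G : bisequence -> C) (p : bisequence) : C :=
  pairing p (gradient F p) (Kop p (gradient G p)).

(** Every sum entering [Kop] converges, [Kop] acts on tangent vectors, and the
    closed formula [Lminus] is sigma3 Lplus^* sigma3^(-1), the adjoint being
    taken for [pairing]. *)
Record Kop_well_defined (p : bisequence) : Prop := {
  Kop_sums : forall w, tangent w ->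
    abs_summable (s_term p w) /\ abs_summable (a_term p w) /\
    abs_summable (b_term p w) /\ abs_summable (t_term p w);
  Kop_tangent : forall w, tangent w -> tangent (Kop p w);
  Lminus_adjoint : forall w w', tangent w -> tangent w' ->
    pairing p (Lplus p w) w' = pairing p w (sigma3 (Lminus p (sigma3 w')))
}.

(** ** Almost Poisson structures

    [dom] is the phase space and [Fun] the class of functionals on it.
    The functionals are real on the real reduction, so scalars are real. *)
Record almost_poisson {X : Type} (dom : X -> Prop) (Fun : (X -> C) -> Prop)
    (br : (X -> C) -> (X -> C) -> X -> C) : Prop := {
  br_closed : forall F G, Fun F -> Fun G -> Fun (br F G);
  br_linear_l : forall (a b : R) F G H x, Fun F -> Fun G -> Fun H -> dom x ->
    br (fun y => RtoC a * F y + RtoC b * G y)%C H x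
    = (RtoC a * br F H x + RtoC b * br G H x)%C;
  br_linear_r : forall (a b : R) F G H x, Fun F -> Fun G -> Fun H -> dom x ->
    br F (fun y => RtoC a * G y + RtoC b * H y)%C x
    = (RtoC a * br F G x + RtoC b * br F H x)%C;
  br_skew : forall F G x, Fun F -> Fun G -> dom x ->
    br F G x = (- br G F x)%C;
  br_leibniz : forall F G H x, Fun F -> Fun G -> Fun H -> dom x ->
    br (fun y => F y * G y)%C H x = (F x * br G H x + G x * br F H x)%C
}.

(* Main.v *)
Require Import Defs.
From Stdlib Require Import Reals ZArith Lra Lia FunctionalExtensionality.
From Coquelicot Require Import Coquelicot.
Require Import Defs.

(** Skew-symmetry is algebra. The operator [Lplus + Lminus] is equal to its
    adjoint conjugated by [sigma3], because [Lminus] is the conjugate of the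
    adjoint of [Lplus]; conjugation by [rot] and composition with [J] turn this
    symmetry into [K^* = - K] ([Kop_skew]). That the closed formula for [Lminus]
    gives this conjugate is [Lplus_adjoint]: site by site, the two pairings
    differ by the increment of an explicit sequence that vanishes at both ends.
    The Leibniz rule and linearity come from the same rules for functional
    derivatives.

    The substance is that the bracket of two functionals is again a functional,
    that is: smooth along plots, with a first variation represented by a smooth
    field of rapidly decreasing sequences. The first variation of the bracket
    contains the derivatives of the functional derivatives of F and G along the
    direction of variation [h]; they have to be rewritten as pairings with [h].
    No formula for the result is computed. Instead, consider the fields of
    sequences, depending on the point of the phase space, whose derivative has a
    transpose: paired with any smooth field of test sequences, the derivative
    along [h] is the pairing of [h] with some smooth field ([transposable]).
    This class contains q and r, and, by the symmetry of second derivatives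
    ([hessian_symmetric]), the components of functional derivatives. It is closed
    under sums, products, shifts, inverses of sequences bounded below, and the
    formation of tails, which summation by parts transposes into the opposite
    tails ([sumZ_tail_transpose]). The decay of the values and of the test
    sequences has to be balanced, and three kinds of fields are enough: local
    fields, coefficients and densities. Following the formula of the operator
    through these closure properties shows that the summand of the bracket is a
    density ([local_Kop], [density_pairing]), and the sum of a density that is
    real on the reduction is a functional ([density_functional]). The same
    closure properties, applied to constant fields, show that the operator acts
    on tangent vectors and that all its sums converge.

    Smoothness of families of sequences is handled through one principle:
    derivatives taken index by index, when continuous for the seminorms, are
    derivatives for the seminorms ([uniform_derivative]), so that bounded
    bilinear maps preserve smooth families and obey the product rule. *)

(** * Series over the integers *)

Lemma weight_ge_1 (N : nat) (k : Z) : 1 <= weight N k.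
Proof.
  unfold weight; apply pow_R1_Rle; generalize (Rabs_pos (IZR k)); lra.
Qed.

Lemma weight_plus (N M : nat) (k : Z) : weight (N + M) k = weight N k * weight M k.
Proof. apply pow_add. Qed.

Lemma Cmod_le_parts (z : C) : Cmod z <= Rabs (fst z) + Rabs (snd z).
Proof.
  replace z with (RtoC (fst z) + (0, snd z))%C at 1
    by (destruct z; unfold RtoC, Cplus; simpl; f_equal; ring).
  eapply Rle_trans; [apply Cmod_triangle|].
  rewrite Cmod_R; apply Rplus_le_compat_l.
  unfold Cmod; simpl.
  replace (0 * (0 * 1) + snd z * (snd z * 1)) with ((snd z)²) by (unfold Rsqr; ring).
  rewrite sqrt_Rsqr_abs; apply Rle_refl.
Qed.

Lemma parts_le_Cmod (z : C) : Rabs (fst z) <= Cmod z /\ Rabs (snd z) <= Cmod z.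
Proof.
  generalize (Rmax_Cmod z); intros H.
  split; (eapply Rle_trans; [|exact H]); [apply Rmax_l|apply Rmax_r].
Qed.

Lemma sum_n_step (a : nat -> R) (m : nat) : sum_n a (S m) = sum_n a m + a (S m).
Proof. exact (sum_Sn a m). Qed.

(** Increments of [j / (1 + |j|)], a bounded increasing sequence, dominate
    [1 / (1 + |j|)^2], so that a window of these terms has a sum bounded
    independently of its position. *)
Definition squash (j : Z) : R := IZR j / (1 + Rabs (IZR j)).

Lemma squash_bound (j : Z) : Rabs (squash j) <= 1.
Proof.
  unfold squash; generalize (Rabs_pos (IZR j)); intros H.
  unfold Rdiv; rewrite Rabs_mult, Rabs_inv, (Rabs_pos_eq (1 + _)) by lra.
  apply Rmult_le_reg_r with (1 + Rabs (IZR j)); [lra|].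
  rewrite Rmult_assoc, Rinv_l; lra.
Qed.

Lemma inverse_square_le_increment (j : Z) :
  / weight 2 j <= 2 * (squash (j + 1) - squash j).
Proof.
  unfold squash, weight; rewrite plus_IZR; set (x := IZR j).
  destruct (Z_lt_le_dec j 0) as [Hj|Hj].
  - assert (Hx : x + 1 <= 0) by (unfold x; rewrite <- plus_IZR; apply IZR_le; lia).
    rewrite (Rabs_left1 (x + 1)), (Rabs_left1 x) by lra.
    set (y := - x); replace x with (- y) by (unfold y; ring).
    assert (Hy : 1 <= y) by (unfold y; lra).
    replace (2 * _) with (2 / (y * (1 + y))) by (field; lra).
    replace (/ _) with (1 / ((1 + y) * (1 + y))) by (field; lra).
    replace (1 + - - y) with (1 + y) by ring.
    apply Rmult_le_reg_r with (y * ((1 + y) * (1 + y))); [nra|].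
    field_simplify; nra.
  - assert (Hx : 0 <= x) by (apply IZR_le; lia).
    rewrite (Rabs_pos_eq (x + 1)), (Rabs_pos_eq x) by lra.
    replace (2 * _) with (2 / ((1 + x) * (2 + x))) by (field; lra).
    apply Rmult_le_reg_r with ((2 + x) * ((1 + x) * (1 + x))); [nra|].
    field_simplify; nra.
Qed.

Lemma tail_summable (k : Z) (a : nat -> R) (M : R) :
  (forall n, 0 <= a n) ->
  (forall n, weight 2 (k + Z.of_nat n) * a n <= M) ->
  ex_series a /\ Series a <= 4 * M.
Proof.
  intros Ha HM.
  assert (HM0 : 0 <= M).
  { eapply Rle_trans; [|apply (HM O)]. apply Rmult_le_pos; [|apply Ha].
    generalize (weight_ge_1 2 (k + Z.of_nat 0)); lra. }
  assert (Hpart : forall m, sum_n a m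
            <= 2 * M * (squash (k + Z.of_nat (S m)) - squash k)).
  { assert (Hterm : forall n, a n <= 2 * M * (squash (k + Z.of_nat (S n))
                                              - squash (k + Z.of_nat n))).
    { intros n; generalize (weight_ge_1 2 (k + Z.of_nat n)); intros Hw.
      apply Rle_trans with (M * / weight 2 (k + Z.of_nat n)).
      - apply Rmult_le_reg_l with (weight 2 (k + Z.of_nat n)); [lra|].
        rewrite (Rmult_comm M), <- Rmult_assoc, Rinv_r by lra.
        generalize (HM n); lra.
      - replace (2 * M * _) with
          (M * (2 * (squash (k + Z.of_nat (S n)) - squash (k + Z.of_nat n)))) by ring.
        apply Rmult_le_compat_l; [exact HM0|].
        replace (k + Z.of_nat (S n))%Z with (k + Z.of_nat n + 1)%Z by lia.
        apply inverse_square_le_increment. }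
    induction m as [|m IH].
    - rewrite sum_O; generalize (Hterm O).
      replace (k + Z.of_nat 0)%Z with k by lia; exact (fun h => h).
    - rewrite sum_n_step; generalize (Hterm (S m)); lra. }
  assert (Hbound : forall m, sum_n a m <= 4 * M).
  { intros m; generalize (Hpart m).
    generalize (squash_bound (k + Z.of_nat (S m))) (squash_bound k).
    intros H1 H2 H; apply Rabs_le_between in H1; apply Rabs_le_between in H2.
    eapply Rle_trans; [exact H|].
    replace (4 * M) with (2 * M * 2) by ring.
    apply Rmult_le_compat_l; lra. }
  assert (Hex : ex_finite_lim_seq (sum_n a)).
  { apply ex_finite_lim_seq_incr with (4 * M); [|exact Hbound].
    intros n; rewrite sum_n_step; generalize (Ha (S n)); lra. }
  assert (Hs : ex_series a) by (destruct Hex as [l Hl]; exists l; exact Hl).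
  split; [exact Hs|].
  assert (H : is_lim_seq (sum_n a) (Series a)) by (apply Series_correct, Hs).
  exact (is_lim_seq_le _ _ (Series a) (4 * M) Hbound H (is_lim_seq_const _)).
Qed.

(** ** Absolutely convergent complex series *)

Definition abs_conv (a : nat -> C) : Prop := ex_series (fun n => Cmod (a n)).

Lemma abs_conv_parts (a : nat -> C) : abs_conv a ->
  ex_series (fun n => Rabs (fst (a n))) /\ ex_series (fun n => Rabs (snd (a n))).
Proof.
  intros H; split; (eapply (ex_series_le (V := R_CompleteNormedModule));
    [|exact H]); intros n; unfold norm; simpl; unfold abs; simpl;
    rewrite Rabs_Rabsolu; apply parts_le_Cmod.
Qed.

Lemma abs_conv_ex (a : nat -> C) : abs_conv a ->
  ex_series (fun n => fst (a n)) /\ ex_series (fun n => snd (a n)).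
Proof.
  intros H; destruct (abs_conv_parts a H); split; apply ex_series_Rabs; assumption.
Qed.

Lemma Csum_bound (a : nat -> C) : abs_conv a ->
  Cmod (Csum a) <= 2 * Series (fun n => Cmod (a n)).
Proof.
  intros H; destruct (abs_conv_parts a H) as [H1 H2].
  eapply Rle_trans; [apply Cmod_le_parts|]; simpl.
  assert (K1 : Rabs (Series (fun n => fst (a n))) <= Series (fun n => Cmod (a n))).
  { eapply Rle_trans; [apply Series_Rabs, H1|].
    apply Series_le; [|exact H]; intros n; split; [apply Rabs_pos|apply parts_le_Cmod]. }
  assert (K2 : Rabs (Series (fun n => snd (a n))) <= Series (fun n => Cmod (a n))).
  { eapply Rle_trans; [apply Series_Rabs, H2|].
    apply Series_le; [|exact H]; intros n; split; [apply Rabs_pos|apply parts_le_Cmod]. }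
  lra.
Qed.

Lemma Csum_ext (a b : nat -> C) : (forall n, a n = b n) -> Csum a = Csum b.
Proof.
  intros H; unfold Csum; f_equal; apply Series_ext; intros n; rewrite H; reflexivity.
Qed.

Lemma Csum_plus (a b : nat -> C) : abs_conv a -> abs_conv b ->
  Csum (fun n => a n + b n)%C = (Csum a + Csum b)%C.
Proof.
  intros Ha Hb; destruct (abs_conv_ex a Ha), (abs_conv_ex b Hb).
  unfold Csum, Cplus; simpl; f_equal; apply Series_plus; assumption.
Qed.

Lemma Csum_scal (c : C) (a : nat -> C) : abs_conv a ->
  Csum (fun n => c * a n)%C = (c * Csum a)%C.
Proof.
  intros Ha; destruct (abs_conv_ex a Ha) as [H1 H2].
  unfold Csum, Cmult; simpl.
  rewrite <- !Series_scal_l.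
  f_equal; [rewrite <- Series_minus | rewrite <- Series_plus]; try reflexivity;
    apply (ex_series_scal_l (V := R_NormedModule)); assumption.
Qed.

Lemma Csum_step (a : nat -> C) : abs_conv a ->
  Csum a = (a O + Csum (fun n => a (S n)))%C.
Proof.
  intros Ha; destruct (abs_conv_ex a Ha) as [H1 H2].
  unfold Csum, Cplus; simpl; f_equal; apply Series_incr_1; assumption.
Qed.

Lemma Csum_conj (a : nat -> C) : Csum (fun n => Cconj (a n)) = Cconj (Csum a).
Proof.
  unfold Csum, Cconj; simpl; f_equal; apply Series_opp.
Qed.

Lemma Csum_telescoping (T : nat -> C) :
  (exists M, forall n, (1 + INR n) * Cmod (T n) <= M) ->
  Csum (fun n => T n - T (S n))%C = T O.
Proof.
  intros [M HM].
  assert (Hlim : forall p : C -> R, (forall z, Rabs (p z) <= Cmod z) ->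
            (forall a b, p (a - b)%C = p a - p b) ->
            is_series (fun n => p (T n - T (S n))%C) (p (T O))).
  { intros p Hp Hm.
    assert (Hz : is_lim_seq (fun n => p (T (S n))) 0).
    { apply is_lim_seq_abs_0.
      apply is_lim_seq_le_le with (u := fun _ => 0) (w := fun n => M * / INR (S n)).
      - intros n; split; [apply Rabs_pos|].
        eapply Rle_trans; [apply Hp|].
        assert (0 < INR (S n)) by (apply lt_0_INR; lia).
        apply Rmult_le_reg_l with (INR (S n)); [assumption|].
        replace (INR (S n) * (M * / INR (S n))) with M by (field; lra).
        eapply Rle_trans; [|apply (HM (S n))].
        apply Rmult_le_compat_r; [apply Cmod_ge_0|lra].
      - apply is_lim_seq_const.
      - replace (Finite 0) with (Rbar_mult M 0) by (simpl; f_equal; ring).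
        apply is_lim_seq_scal_l.
        apply (is_lim_seq_incr_1 (fun n => / INR n)).
        replace (Finite 0) with (Rbar_inv p_infty) by reflexivity.
        apply is_lim_seq_inv; [apply is_lim_seq_INR|discriminate]. }
    assert (Hs : is_lim_seq (sum_n (fun n => p (T n - T (S n))%C)) (p (T O) - 0)).
    { apply is_lim_seq_ext with (fun n => p (T O) - p (T (S n))).
      - induction n as [|n IH].
        + rewrite sum_O; rewrite Hm; reflexivity.
        + rewrite sum_n_step, <- IH, Hm; ring.
      - apply is_lim_seq_minus'; [apply is_lim_seq_const|exact Hz]. }
    rewrite Rminus_0_r in Hs; exact Hs. }
  unfold Csum.
  rewrite (is_series_unique _ _ (Hlim fst (fun z => proj1 (parts_le_Cmod z)) (fun a b => eq_refl))).
  rewrite (is_series_unique _ _ (Hlim snd (fun z => proj2 (parts_le_Cmod z)) (fun a b => eq_refl))).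
  destruct (T O); reflexivity.
Qed.

Lemma weight_opp (N : nat) (k : Z) : weight N (- k) = weight N k.
Proof. unfold weight; rewrite opp_IZR, Rabs_Ropp; reflexivity. Qed.

Lemma weight_add (N : nat) (j k : Z) : weight N (j + k) <= weight N j * weight N k.
Proof.
  unfold weight; rewrite <- Rpow_mult_distr; apply pow_incr; rewrite plus_IZR.
  generalize (Rabs_pos (IZR j)) (Rabs_pos (IZR k)) (Rabs_pos (IZR j + IZR k))
    (Rabs_triang (IZR j) (IZR k)); nra.
Qed.

(** ** Bilateral sums *)

Definition decay (N : nat) (f : Z -> C) (M : R) : Prop :=
  forall k, weight N k * Cmod (f k) <= M.

Lemma sum_le_opp (k : Z) (f : Z -> C) :
  sum_le k f = sum_ge (- k) (fun j => f (- j)%Z).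
Proof. apply Csum_ext; intros n; f_equal; lia. Qed.

Lemma decay_opp (N : nat) (f : Z -> C) (M : R) :
  decay N f M -> decay N (fun j => f (- j)%Z) M.
Proof. intros H k; rewrite <- weight_opp; apply H. Qed.

Lemma sum_ge_conv (f : Z -> C) (M : R) (k : Z) : decay 2 f M ->
  abs_conv (fun n => f (k + Z.of_nat n)%Z) /\ Cmod (sum_ge k f) <= 8 * M.
Proof.
  intros H.
  destruct (tail_summable k (fun n => Cmod (f (k + Z.of_nat n)%Z)) M) as [H1 H2].
  - intros n; apply Cmod_ge_0.
  - intros n; apply H.
  - split; [exact H1|].
    eapply Rle_trans; [apply Csum_bound, H1|lra].
Qed.

Lemma sum_le_conv (f : Z -> C) (M : R) (k : Z) : decay 2 f M ->
  abs_conv (fun n => f (k - Z.of_nat n)%Z) /\ Cmod (sum_le k f) <= 8 * M.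
Proof.
  intros H; destruct (sum_ge_conv _ M (- k) (decay_opp _ _ _ H)) as [H1 H2].
  rewrite sum_le_opp; split; [|exact H2].
  eapply ex_series_ext; [|exact H1]; intros n; simpl; do 2 f_equal; lia.
Qed.

(** One of the three powers of the weight is at least its value at the start of
    the tail; the other two are spent on the convergence. *)
Lemma sum_ge_decay (f : Z -> C) (M : R) (k : Z) : decay 3 f M -> (0 <= k)%Z ->
  weight 1 k * Cmod (sum_ge k f) <= 8 * M.
Proof.
  intros H Hk; generalize (weight_ge_1 1 k); intros Hw.
  destruct (tail_summable k (fun n => Cmod (f (k + Z.of_nat n)%Z)) (M / weight 1 k))
    as [H1 H2].
  - intros n; apply Cmod_ge_0.
  - intros n; apply Rmult_le_reg_l with (weight 1 k); [lra|].
    replace (weight 1 k * (M / weight 1 k)) with M by (field; lra).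
    eapply Rle_trans; [|apply (H (k + Z.of_nat n)%Z)].
    rewrite (weight_plus 1 2), <- Rmult_assoc.
    apply Rmult_le_compat_r; [apply Cmod_ge_0|].
    apply Rmult_le_compat_r; [generalize (weight_ge_1 2 (k + Z.of_nat n)); lra|].
    unfold weight; rewrite !pow_1, plus_IZR.
    assert (0 <= IZR k) by (apply IZR_le; lia).
    assert (0 <= IZR (Z.of_nat n)) by (apply IZR_le; lia).
    rewrite !Rabs_pos_eq; lra.
  - apply Rle_trans with (weight 1 k * (2 * (4 * (M / weight 1 k)))).
    + apply Rmult_le_compat_l; [lra|].
      eapply Rle_trans; [apply Csum_bound, H1|].
      apply Rmult_le_compat_l; [lra|exact H2].
    + apply Req_le; field; lra.
Qed.

Lemma rapid_conv (f : Z -> C) (k : Z) : rapid f ->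
  abs_conv (fun n => f (k + Z.of_nat n)%Z) /\ abs_conv (fun n => f (k - Z.of_nat n)%Z).
Proof.
  intros H; destruct (H 2%nat) as [M HM].
  split; [apply (sum_ge_conv f M k HM)|apply (sum_le_conv f M k HM)].
Qed.

Lemma rapid_abs_summable (f : Z -> C) : rapid f -> abs_summable f.
Proof.
  intros H; destruct (rapid_conv f 0 H) as [H1 H2].
  split; [apply (ex_series_ext _ _ (fun n => eq_refl) H1)
         |apply (ex_series_ext _ _ (fun n => eq_refl) H2)].
Qed.

Lemma sum_ge_ext (k : Z) (f g : Z -> C) : (forall j, f j = g j) -> sum_ge k f = sum_ge k g.
Proof. intros H; apply Csum_ext; intros n; apply H. Qed.

Lemma sum_le_ext (k : Z) (f g : Z -> C) : (forall j, f j = g j) -> sum_le k f = sum_le k g.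
Proof. intros H; apply Csum_ext; intros n; apply H. Qed.

Lemma sumZ_ext (f g : Z -> C) : (forall j, f j = g j) -> sumZ f = sumZ g.
Proof. intros H; unfold sumZ; f_equal; [apply sum_ge_ext|apply sum_le_ext]; exact H. Qed.

Lemma sum_ge_plus (k : Z) (f g : Z -> C) : rapid f -> rapid g ->
  sum_ge k (fun j => f j + g j)%C = (sum_ge k f + sum_ge k g)%C.
Proof.
  intros Hf Hg; apply (Csum_plus (fun n => f (k + Z.of_nat n)%Z)
    (fun n => g (k + Z.of_nat n)%Z)); apply rapid_conv; assumption.
Qed.

Lemma sum_le_plus (k : Z) (f g : Z -> C) : rapid f -> rapid g ->
  sum_le k (fun j => f j + g j)%C = (sum_le k f + sum_le k g)%C.
Proof.
  intros Hf Hg; apply (Csum_plus (fun n => f (k - Z.of_nat n)%Z)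
    (fun n => g (k - Z.of_nat n)%Z)); apply rapid_conv; assumption.
Qed.

Lemma sumZ_plus (f g : Z -> C) : rapid f -> rapid g ->
  sumZ (fun j => f j + g j)%C = (sumZ f + sumZ g)%C.
Proof.
  intros Hf Hg; unfold sumZ; rewrite sum_ge_plus, sum_le_plus by assumption; ring.
Qed.

Lemma sum_ge_scal (k : Z) (c : C) (f : Z -> C) : rapid f ->
  sum_ge k (fun j => c * f j)%C = (c * sum_ge k f)%C.
Proof. intros Hf; apply (Csum_scal c (fun n => f (k + Z.of_nat n)%Z)), rapid_conv, Hf. Qed.

Lemma sum_le_scal (k : Z) (c : C) (f : Z -> C) : rapid f ->
  sum_le k (fun j => c * f j)%C = (c * sum_le k f)%C.
Proof. intros Hf; apply (Csum_scal c (fun n => f (k - Z.of_nat n)%Z)), rapid_conv, Hf. Qed.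

Lemma sumZ_scal (c : C) (f : Z -> C) : rapid f ->
  sumZ (fun j => c * f j)%C = (c * sumZ f)%C.
Proof.
  intros Hf; unfold sumZ; rewrite sum_ge_scal, sum_le_scal by assumption; ring.
Qed.

Lemma sum_ge_step (k : Z) (f : Z -> C) : rapid f ->
  sum_ge k f = (f k + sum_ge (k + 1) f)%C.
Proof.
  intros Hf; unfold sum_ge at 1; rewrite Csum_step by (apply rapid_conv, Hf).
  f_equal; [f_equal; lia|].
  apply Csum_ext; intros n; f_equal; lia.
Qed.

Lemma sum_le_step (k : Z) (f : Z -> C) : rapid f ->
  sum_le k f = (f k + sum_le (k - 1) f)%C.
Proof.
  intros Hf; unfold sum_le at 1; rewrite Csum_step by (apply rapid_conv, Hf).
  f_equal; [f_equal; lia|].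
  apply Csum_ext; intros n; f_equal; lia.
Qed.

(** The single mechanism behind shift invariance, summation by parts and the
    adjoint of the recursion operator; it makes exchanges of double sums
    unnecessary. *)
Lemma sumZ_telescoping (T : Z -> C) : (exists M, decay 1 T M) ->
  sumZ (fun k => T k - T (k - 1)%Z)%C = 0%C.
Proof.
  intros [M HM]; unfold sumZ.
  assert (Hw : forall (n : nat) (k : Z), INR n <= Rabs (IZR k) ->
            (1 + INR n) * Cmod (T k) <= M).
  { intros n k Hk; eapply Rle_trans; [|apply (HM k)].
    apply Rmult_le_compat_r; [apply Cmod_ge_0|].
    unfold weight; rewrite pow_1; lra. }
  replace (sum_ge 0 _) with (- T (- 1)%Z)%C.
  replace (sum_le (-1) _) with (T (- 1)%Z)%C; [ring|].
  - unfold sum_le.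
    rewrite <- (Csum_telescoping (fun n => T (- 1 - Z.of_nat n)%Z)) at 1.
    + apply Csum_ext; intros n.
      replace (-1 - Z.of_nat (S n))%Z with (-1 - Z.of_nat n - 1)%Z by lia; reflexivity.
    + exists M; intros n; apply Hw.
      rewrite INR_IZR_INZ, Rabs_left1; [|apply IZR_le; lia].
      rewrite <- opp_IZR; apply IZR_le; lia.
  - unfold sum_ge.
    replace (- T (-1)%Z)%C with ((fun n => - T (Z.of_nat n - 1)%Z)%C O) by reflexivity.
    rewrite <- (Csum_telescoping (fun n => - T (Z.of_nat n - 1)%Z)%C).
    + apply Csum_ext; intros n.
      replace (Z.of_nat (S n) - 1)%Z with (0 + Z.of_nat n)%Z by lia.
      replace (Z.of_nat n - 1)%Z with (0 + Z.of_nat n - 1)%Z by lia.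
      ring.
    + exists (2 * M + Cmod (T (-1)%Z)); intros n; rewrite Cmod_opp.
      destruct n as [|n].
      * generalize (HM 0%Z); change (Z.of_nat 0 - 1)%Z with (-1)%Z.
        unfold weight; rewrite Rabs_R0; simpl INR.
        generalize (Cmod_ge_0 (T 0%Z)); lra.
      * replace (Z.of_nat (S n) - 1)%Z with (Z.of_nat n) by lia.
        assert (H := Hw n (Z.of_nat n)); rewrite <- INR_IZR_INZ, Rabs_pos_eq in H
          by apply pos_INR.
        specialize (H (Rle_refl _)); rewrite S_INR.
        generalize (Cmod_ge_0 (T (Z.of_nat n))) (Cmod_ge_0 (T (-1)%Z)) (pos_INR n).
        intros; nra.
Qed.

(** ** Rapidly decreasing and bounded families *)

(** For the weights [weight] this is [rapid]. *)
Definition tame {I : Type} (w : nat -> I -> R) (f : I -> C) : Prop :=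
  forall N, exists M, forall i, w N i * Cmod (f i) <= M.

Lemma tame_ext {I : Type} (w : nat -> I -> R) (f g : I -> C) :
  (forall i, f i = g i) -> tame w f -> tame w g.
Proof. intros H Hf N; destruct (Hf N) as [M HM]; exists M; intros i; rewrite <- H; apply HM. Qed.

Lemma tame_plus {I : Type} (w : nat -> I -> R) (f g : I -> C) :
  (forall N i, 1 <= w N i) ->
  tame w f -> tame w g -> tame w (fun i => f i + g i)%C.
Proof.
  intros Hw Hf Hg N; destruct (Hf N) as [M HM], (Hg N) as [M' HM'].
  exists (M + M'); intros i; generalize (HM i) (HM' i) (Cmod_triangle (f i) (g i)) (Hw N i).
  intros; nra.
Qed.

Lemma tame_scal {I : Type} (w : nat -> I -> R) (c : C) (f : I -> C) :
  tame w f -> tame w (fun i => c * f i)%C.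
Proof.
  intros Hf N; destruct (Hf N) as [M HM]; exists (Cmod c * M); intros i.
  rewrite Cmod_mult; generalize (HM i) (Cmod_ge_0 c); nra.
Qed.

(** All the seminorms are the sup norm; with [unit] as index type, a family is a
    single number. *)
Definition flat {I : Type} : nat -> I -> R := fun _ _ => 1.

Lemma rapid_plus (f g : Z -> C) : rapid f -> rapid g -> rapid (fun k => f k + g k)%C.
Proof. apply (tame_plus weight), weight_ge_1. Qed.

Lemma rapid_scal (c : C) (f : Z -> C) : rapid f -> rapid (fun k => c * f k)%C.
Proof. apply (tame_scal weight). Qed.

Lemma rapid_ext (f g : Z -> C) : (forall k, f k = g k) -> rapid f -> rapid g.
Proof. apply (tame_ext weight). Qed.

Lemma rapid_opp (f : Z -> C) : rapid f -> rapid (fun k => - f k)%C.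
Proof.
  intros H; apply (rapid_ext (fun k => RtoC (-1) * f k)%C); [intros; ring|apply rapid_scal, H].
Qed.

Lemma rapid_minus (f g : Z -> C) : rapid f -> rapid g -> rapid (fun k => f k - g k)%C.
Proof. intros Hf Hg; apply (rapid_plus f (fun k => - g k)%C Hf), rapid_opp, Hg. Qed.

Lemma rapid_mult_flat (f g : Z -> C) : rapid f -> tame flat g ->
  rapid (fun k => f k * g k)%C.
Proof.
  intros Hf Hg N; destruct (Hf N) as [M HM], (Hg O) as [M' HM'].
  exists (M * M'); intros k; rewrite Cmod_mult, <- Rmult_assoc.
  unfold flat in HM'; generalize (HM' k); rewrite Rmult_1_l; intros H.
  apply Rmult_le_compat; [|apply Cmod_ge_0|apply HM|exact H].
  apply Rmult_le_pos; [generalize (weight_ge_1 N k); lra|apply Cmod_ge_0].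
Qed.

Lemma flat_mult_rapid (f g : Z -> C) : tame flat f -> rapid g ->
  rapid (fun k => f k * g k)%C.
Proof.
  intros Hf Hg; apply (rapid_ext (fun k => g k * f k)%C); [intros; ring|].
  apply rapid_mult_flat; assumption.
Qed.

Lemma rapid_flat (f : Z -> C) : rapid f -> tame flat f.
Proof.
  intros Hf N; destruct (Hf O) as [M HM]; exists M; intros k; apply (HM k).
Qed.

Lemma rapid_mult (f g : Z -> C) : rapid f -> rapid g -> rapid (fun k => f k * g k)%C.
Proof. intros Hf Hg; apply rapid_mult_flat; [exact Hf|apply rapid_flat, Hg]. Qed.

Lemma rapid_shift (m : Z) (f : Z -> C) : rapid f -> rapid (fun k => f (k + m)%Z).
Proof.
  intros Hf N; destruct (Hf N) as [M HM]; exists (weight N m * M); intros k.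
  apply Rle_trans with (weight N m * (weight N (k + m) * Cmod (f (k + m)%Z))).
  - rewrite <- Rmult_assoc; apply Rmult_le_compat_r; [apply Cmod_ge_0|].
    replace k with (k + m + - m)%Z at 1 by lia.
    eapply Rle_trans; [apply weight_add|]; rewrite weight_opp; lra.
  - apply Rmult_le_compat_l; [generalize (weight_ge_1 N m); lra|apply HM].
Qed.

Lemma sum_ge_flat (f : Z -> C) : rapid f -> tame flat (fun k => sum_ge k f).
Proof.
  intros Hf N; destruct (Hf 2%nat) as [M HM]; exists (8 * M); intros k.
  unfold flat; rewrite Rmult_1_l; apply (sum_ge_conv f M k HM).
Qed.

Lemma sum_le_flat (f : Z -> C) : rapid f -> tame flat (fun k => sum_le k f).
Proof.
  intros Hf N; destruct (Hf 2%nat) as [M HM]; exists (8 * M); intros k.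
  unfold flat; rewrite Rmult_1_l; apply (sum_le_conv f M k HM).
Qed.

Lemma sumZ_shift_1 (f : Z -> C) : rapid f -> sumZ (fun k => f (k + 1)%Z) = sumZ f.
Proof.
  intros Hf.
  assert (H : sumZ (fun k => f (k + 1)%Z - f (k - 1 + 1)%Z)%C = 0%C).
  { apply (sumZ_telescoping (fun k => f (k + 1)%Z)).
    apply (rapid_shift 1 f Hf). }
  rewrite <- (Cplus_0_l (sumZ f)), <- H.
  rewrite <- sumZ_plus; [| |exact Hf].
  - apply sumZ_ext; intros k; replace (k - 1 + 1)%Z with k by lia; ring.
  - apply rapid_minus; [apply (rapid_shift 1), Hf|].
    apply (rapid_ext f); [intros k; f_equal; lia|exact Hf].
Qed.

Lemma sumZ_shift (m : Z) (f : Z -> C) : rapid f -> sumZ (fun k => f (k + m)%Z) = sumZ f.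
Proof.
  intros Hf.
  assert (Hnat : forall (n : nat) g, rapid g -> sumZ (fun k => g (k + Z.of_nat n)%Z) = sumZ g).
  { induction n as [|n IH]; intros g Hg.
    - apply sumZ_ext; intros k; f_equal; lia.
    - rewrite <- (IH g Hg), <- (sumZ_shift_1 (fun k => g (k + Z.of_nat n)%Z)).
      + apply sumZ_ext; intros k; f_equal; lia.
      + apply rapid_shift, Hg. }
  destruct (Z_le_gt_dec 0 m) as [Hm|Hm].
  - rewrite <- (Hnat (Z.to_nat m) f Hf); apply sumZ_ext; intros k; f_equal; lia.
  - rewrite <- (Hnat (Z.to_nat (- m)) (fun k => f (k + m)%Z)) by (apply rapid_shift, Hf).
    apply sumZ_ext; intros k; f_equal; lia.
Qed.

Lemma tails_decay (f g : Z -> C) : rapid f -> rapid g ->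
  exists M, decay 1 (fun k => sum_le k f * sum_ge (k + 1) g)%C M.
Proof.
  intros Hf Hg; destruct (Hf 3%nat) as [A HA], (Hg 3%nat) as [B HB].
  destruct (Hf 2%nat) as [A' HA'], (Hg 2%nat) as [B' HB'].
  exists (8 * A' * (2 * (8 * B)) + 8 * A * (8 * B')); intros k; rewrite Cmod_mult.
  destruct (sum_le_conv f A' k HA') as [_ H1].
  destruct (sum_ge_conv g B' (k + 1) HB') as [_ H2].
  generalize (Cmod_ge_0 (sum_le k f)) (Cmod_ge_0 (sum_ge (k + 1) g))
    (weight_ge_1 1 k); intros P1 P2 Pw.
  assert (HA0 : 0 <= A).
  { eapply Rle_trans; [|apply (HA 0%Z)]; apply Rmult_le_pos;
      [generalize (weight_ge_1 3 0); lra|apply Cmod_ge_0]. }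
  assert (HB0 : 0 <= B).
  { eapply Rle_trans; [|apply (HB 0%Z)]; apply Rmult_le_pos;
      [generalize (weight_ge_1 3 0); lra|apply Cmod_ge_0]. }
  assert (HA0' : 0 <= 8 * A') by lra.
  assert (HB0' : 0 <= 8 * B') by lra.
  destruct (Z_lt_le_dec k 0) as [Hk|Hk].
  - assert (H3 : weight 1 k * Cmod (sum_le k f) <= 8 * A).
    { rewrite sum_le_opp, <- weight_opp; apply sum_ge_decay; [|lia].
      exact (decay_opp 3 f A HA). }
    apply Rle_trans with (8 * A * (8 * B')).
    + rewrite <- Rmult_assoc; apply Rmult_le_compat; try assumption.
      apply Rmult_le_pos; lra.
    + assert (0 <= 8 * A' * (2 * (8 * B))) by (apply Rmult_le_pos; lra); lra.
  - assert (H3 : weight 1 (k + 1) * Cmod (sum_ge (k + 1) g) <= 8 * B)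
      by (apply sum_ge_decay; [exact HB|lia]).
    assert (H4 : weight 1 k <= 2 * weight 1 (k + 1)).
    { replace k with (k + 1 + -1)%Z at 1 by lia.
      eapply Rle_trans; [apply weight_add|].
      replace (weight 1 (-1)) with 2; [lra|].
      unfold weight; rewrite pow_1, Rabs_left; lra. }
    apply Rle_trans with (8 * A' * (2 * (8 * B))).
    + replace (weight 1 k * _) with
        (Cmod (sum_le k f) * (weight 1 k * Cmod (sum_ge (k + 1) g))) by ring.
      apply Rmult_le_compat; try assumption; [apply Rmult_le_pos; lra|].
      apply Rle_trans with (2 * weight 1 (k + 1) * Cmod (sum_ge (k + 1) g)).
      * apply Rmult_le_compat_r; assumption.
      * lra.
    + assert (0 <= 8 * A * (8 * B')) by (apply Rmult_le_pos; lra); lra.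
Qed.

Lemma sumZ_eq_telescoping (f g T : Z -> C) : rapid f -> rapid g ->
  (exists M, decay 1 T M) -> (forall k, f k = g k + (T k - T (k - 1)%Z))%C ->
  sumZ f = sumZ g.
Proof.
  intros Hf Hg HT H.
  assert (H0 : sumZ (fun k => f k - g k)%C = 0%C).
  { rewrite <- (sumZ_telescoping T HT); apply sumZ_ext; intros k; rewrite H; ring. }
  rewrite <- (Cplus_0_l (sumZ g)), <- H0, <- sumZ_plus; [|apply rapid_minus|]; try assumption.
  apply sumZ_ext; intros k; ring.
Qed.

(** Summation by parts: the two summands differ by the increment of the product
    of the left tail of [x] and the right tail of [y], which vanishes at both
    ends because one of its factors does. *)
Lemma sumZ_tail_transpose (x y : Z -> C) : rapid x -> rapid y ->
  sumZ (fun k => x k * sum_ge k y)%C = sumZ (fun k => sum_le k x * y k)%C.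
Proof.
  intros Hx Hy.
  apply sumZ_eq_telescoping with (fun k => sum_le k x * sum_ge (k + 1) y)%C.
  - apply rapid_mult_flat; [exact Hx|apply sum_ge_flat, Hy].
  - apply flat_mult_rapid; [apply sum_le_flat, Hx|exact Hy].
  - apply tails_decay; assumption.
  - intros k; rewrite (sum_le_step k x Hx), (sum_ge_step k y Hy).
    replace (k - 1 + 1)%Z with k by lia; rewrite (sum_ge_step k y Hy); ring.
Qed.

Lemma sumZ_zero : sumZ (fun _ => 0%C) = 0%C.
Proof.
  transitivity (sumZ (fun k => (fun _ : Z => 0%C) k - (fun _ : Z => 0%C) (k - 1)%Z)%C).
  - apply sumZ_ext; intros k; ring.
  - apply sumZ_telescoping; exists 0; intros k; rewrite Cmod_0; lra.
Qed.

Lemma rapid_single (k : Z) (z : C) : rapid (fun j => if Z.eq_dec j k then z else 0%C).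
Proof.
  intros N; exists (weight N k * Cmod z); intros j.
  destruct (Z.eq_dec j k) as [->|]; [lra|].
  rewrite Cmod_0, Rmult_0_r; apply Rmult_le_pos; [|apply Cmod_ge_0].
  generalize (weight_ge_1 N k); lra.
Qed.

Lemma sumZ_single (k : Z) (z : C) :
  sumZ (fun j => if Z.eq_dec j k then z else 0%C) = z.
Proof.
  rewrite <- (sumZ_shift k) by apply rapid_single.
  assert (Hc : rapid (fun j => if Z.eq_dec j 0 then z else 0%C)) by apply rapid_single.
  transitivity (sumZ (fun j => if Z.eq_dec j 0 then z else 0%C)).
  { apply sumZ_ext; intros j; destruct (Z.eq_dec (j + k) k), (Z.eq_dec j 0); trivial; lia. }
  unfold sumZ; rewrite sum_ge_step by exact Hc.
  assert (H : Csum (fun _ => 0%C) = 0%C).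
  { transitivity (Csum (fun n => (fun _ : nat => 0%C) n - (fun _ : nat => 0%C) (S n))%C).
    - apply Csum_ext; intros n; ring.
    - apply (Csum_telescoping (fun _ => 0%C)); exists 0; intros n; rewrite Cmod_0; lra. }
  assert (H1 : sum_ge (0 + 1) (fun j => if Z.eq_dec j 0 then z else 0%C) = 0%C).
  { rewrite <- H; apply Csum_ext; intros n; destruct (Z.eq_dec (0 + 1 + Z.of_nat n) 0);
      trivial; lia. }
  assert (H2 : sum_le (-1) (fun j => if Z.eq_dec j 0 then z else 0%C) = 0%C).
  { rewrite <- H; apply Csum_ext; intros n; destruct (Z.eq_dec (-1 - Z.of_nat n) 0);
      trivial; lia. }
  rewrite H1, H2; simpl; ring.
Qed.

(** * Smooth families *)

Notation is_derive_C := (is_derive (K := R_AbsRing) (V := C_R_NormedModule)).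
Notation bisequence_derivative := (directional_derivative (V := C2_NormedModule)).

(** ** Norms and derivatives by components *)

Lemma prod_norm_between (U V : NormedModule R_AbsRing)
    (x : prod_NormedModule R_AbsRing U V) :
  norm (fst x) <= norm x /\ norm (snd x) <= norm x /\
  norm x <= norm (fst x) + norm (snd x).
Proof.
  unfold norm at 2 4 5; simpl; unfold prod_norm; simpl.
  generalize (norm_ge_0 (fst x)) (norm_ge_0 (snd x)).
  set (a := norm (fst x)); set (b := norm (snd x)); intros Ha Hb.
  rewrite !Rmult_1_r; repeat split.
  - rewrite <- (sqrt_square a Ha) at 1; apply sqrt_le_1; nra.
  - rewrite <- (sqrt_square b Hb) at 1; apply sqrt_le_1; nra.
  - rewrite <- (sqrt_square (a + b)) by lra; apply sqrt_le_1; nra.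
Qed.

Lemma norm_Cmod (z : C) : norm (V := C_R_NormedModule) z = Cmod z.
Proof.
  unfold norm; simpl; unfold prod_norm, Cmod, norm; simpl; unfold abs; simpl.
  f_equal; rewrite !Rmult_1_r, <- !Rabs_mult, !Rabs_pos_eq by nra; ring.
Qed.

Lemma scal_RtoC (t : R) (z : C) : scal (V := C_R_NormedModule) t z = (RtoC t * z)%C.
Proof.
  destruct z as [a b]; unfold scal; simpl; unfold prod_scal, scal; simpl.
  unfold mult, Cmult, RtoC; simpl; f_equal; ring.
Qed.

Lemma is_derive_eps {V : NormedModule R_AbsRing} (g : R -> V) (s : R) (l : V) :
  is_derive g s l <->
  forall eps : posreal, locally s (fun t =>
    norm (minus (minus (g t) (g s)) (scal (t - s) l)) <= eps * Rabs (t - s)).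
Proof.
  split.
  - intros [_ H] eps.
    exact (H s (fun P HP => HP) eps).
  - intros H; split; [apply is_linear_scal_l|].
    intros x Hx eps.
    rewrite <- (is_filter_lim_locally_unique _ _ Hx).
    exact (H eps).
Qed.

Lemma is_derive_pair {V W : NormedModule R_AbsRing}
    (g : R -> prod_NormedModule R_AbsRing V W) (s : R)
    (l : prod_NormedModule R_AbsRing V W) :
  is_derive g s l <->
  is_derive (fun t => fst (g t)) s (fst l) /\ is_derive (fun t => snd (g t)) s (snd l).
Proof.
  rewrite !is_derive_eps; split.
  - intros H; split; intros eps; generalize (H eps); apply filter_imp; intros t Ht;
      (eapply Rle_trans; [|exact Ht]).
    + apply (proj1 (prod_norm_between V W (minus (minus (g t) (g s)) (scal (t - s) l)))).
    + apply (proj1 (proj2 (prod_norm_between V W (minus (minus (g t) (g s)) (scal (t - s) l))))).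
  - intros [H1 H2] eps.
    generalize (filter_and _ _ (H1 (pos_div_2 eps)) (H2 (pos_div_2 eps))).
    apply filter_imp; intros t [A B].
    eapply Rle_trans; [apply prod_norm_between|].
    simpl in A, B |- *.
    replace (eps * Rabs (t - s)) with (eps / 2 * Rabs (t - s) + eps / 2 * Rabs (t - s)) by field.
    apply Rplus_le_compat; assumption.
Qed.

Lemma is_derive_C_parts (g : R -> C) (s : R) (l : C) :
  is_derive_C g s l <->
  is_derive (fun t => fst (g t)) s (fst l) /\ is_derive (fun t => snd (g t)) s (snd l).
Proof. apply (is_derive_pair (V := R_NormedModule) (W := R_NormedModule)). Qed.

Lemma is_derive_C_eps (g : R -> C) (l : C) :
  is_derive_C g 0 l <->
  forall eps : posreal, locally 0 (fun t =>
    Cmod (g t - g 0 - RtoC t * l)%C <= eps * Rabs t).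
Proof.
  rewrite is_derive_eps; split; intros H eps; generalize (H eps); apply filter_imp;
    intros t; rewrite norm_Cmod, scal_RtoC, Rminus_0_r; exact (fun h => h).
Qed.

Lemma is_derive_C_unique (g : R -> C) (s : R) (l l' : C) :
  is_derive_C g s l -> is_derive_C g s l' ->
  l = l'.
Proof.
  intros H H'.
  apply is_derive_C_parts in H.
  apply is_derive_C_parts in H'.
  destruct H as [A B], H' as [A' B'].
  apply is_derive_unique in A; apply is_derive_unique in A'.
  apply is_derive_unique in B; apply is_derive_unique in B'.
  destruct l as [a b], l' as [a' b']; simpl in *; congruence.
Qed.

Lemma is_derive_ray (c : C) (s : R) :
  is_derive_C (fun t => RtoC t * c)%C s c.
Proof.
  apply (is_derive_ext (V := C_R_NormedModule) (fun t : R => scal t c)).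
  - intros r; apply scal_RtoC.
  - generalize (is_derive_scal_l (V := C_R_NormedModule) (fun t : R => t) s 1 c
      (is_derive_id (K := R_AbsRing) s)).
    replace (scal (V := C_R_NormedModule) 1 c) with c; [exact (fun h => h)|].
    symmetry; exact (scal_one (V := C_R_NormedModule) c).
Qed.

(** The mean value inequality; the factor 2 comes from the two components. *)
Lemma C_bounded_variation (h dh : R -> C) (D t : R) :
  (forall s, Rabs s <= Rabs t -> is_derive_C h s (dh s) /\
                                 Cmod (dh s) <= D) ->
  Cmod (h t - h 0)%C <= 2 * D * Rabs t.
Proof.
  intros H.
  assert (H1 : Rabs (fst (h t) - fst (h 0)) <= D * Rabs (t - 0)).
  { apply (bounded_variation (fun s => fst (h s)) (fun s => fst (dh s))); intros s.
    rewrite !Rminus_0_r; intros Hs; destruct (H s Hs) as [A B]; split.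
    - apply is_derive_C_parts in A; apply A.
    - eapply Rle_trans; [apply parts_le_Cmod|exact B]. }
  assert (H2 : Rabs (snd (h t) - snd (h 0)) <= D * Rabs (t - 0)).
  { apply (bounded_variation (fun s => snd (h s)) (fun s => snd (dh s))); intros s.
    rewrite !Rminus_0_r; intros Hs; destruct (H s Hs) as [A B]; split.
    - apply is_derive_C_parts in A; apply A.
    - eapply Rle_trans; [apply parts_le_Cmod|exact B]. }
  rewrite Rminus_0_r in H1, H2.
  eapply Rle_trans; [apply Cmod_le_parts|].
  change (Rabs (fst (h t) - fst (h 0)) + Rabs (snd (h t) - snd (h 0)) <= 2 * D * Rabs t).
  lra.
Qed.

(** ** Lines *)

Lemma ball_0_Rabs (d t : R) : ball 0 d t <-> Rabs t < d.
Proof.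
  change (Rabs (t - 0) < d <-> Rabs t < d); rewrite Rminus_0_r; tauto.
Qed.

Lemma line_0 {n : nat} (x v : Rn n) : plus x (scal 0 v) = x.
Proof. etransitivity; [|apply plus_zero_r]; f_equal; exact (scal_zero_l v). Qed.

Lemma line_line {n : nat} (x v : Rn n) (s t : R) :
  plus (plus x (scal s v)) (scal t v) = plus x (scal (s + t) v).
Proof.
  rewrite <- plus_assoc; f_equal; symmetry; exact (scal_distr_r s t v).
Qed.

Lemma line_continuous {n : nat} (x v : Rn n) (t : R) :
  continuous (fun t : R => plus x (scal t v)) t.
Proof.
  apply (continuous_plus (fun _ => x) (fun t : R => scal t v)); [apply continuous_const|].
  apply (continuous_scal_l (fun t : R => t) v), continuous_id.
Qed.

Lemma locally_line {n : nat} (x v : Rn n) (P : Rn n -> Prop) :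
  locally x P -> locally 0 (fun t : R => P (plus x (scal t v))).
Proof.
  intros H; apply (line_continuous x v 0).
  rewrite line_0; exact H.
Qed.

Notation Ck w m U f := (Ck_family (V := C_R_NormedModule) w m U f).
Notation smooth w U f := (smooth_family (V := C_R_NormedModule) w U f).
Notation derivative_along f x v l :=
  (directional_derivative (V := C_R_NormedModule) f x v l).

Definition continuous_at {I : Type} (w : nat -> I -> R) {n : nat}
    (f : Rn n -> I -> C) (x : Rn n) : Prop :=
  tame w (f x) /\
  forall N (eps : posreal),
    locally x (fun y => forall i, w N i * Cmod (f y i - f x i)%C <= eps).

Lemma continuous_atE {I : Type} (w : nat -> I -> R) {n : nat}
    (f : Rn n -> I -> C) (x : Rn n) :
  continuous_family_at (V := C_R_NormedModule) w f x <-> continuous_at w f x.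
Proof.
  split.
  - intros H; split.
    + intros N; destruct (H N) as [[M HM] _]; exists M; intros i; rewrite <- norm_Cmod; apply HM.
    + intros N eps; destruct (H N) as [_ H']; generalize (H' eps); apply filter_imp.
      intros y Hy i; generalize (Hy i); rewrite norm_Cmod; exact (fun h => h).
  - intros [H1 H2] N; split.
    + destruct (H1 N) as [M HM]; exists M; intros i; rewrite norm_Cmod; apply HM.
    + intros eps; generalize (H2 N eps); apply filter_imp.
      intros y Hy i; rewrite norm_Cmod; exact (Hy i).
Qed.

Lemma Ck_0 {I : Type} (w : nat -> I -> R) {n m : nat} (U : Rn n -> Prop)
    (f : Rn n -> I -> C) :
  Ck w m U f -> forall x, U x -> continuous_at w f x.
Proof. intros H x Hx; apply continuous_atE; destruct m; apply H, Hx. Qed.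

Lemma Ck_pred {I : Type} (w : nat -> I -> R) {n : nat} (U : Rn n -> Prop) :
  forall m (f : Rn n -> I -> C), Ck w (S m) U f -> Ck w m U f.
Proof.
  induction m as [|m IH]; intros f [H1 H2].
  - split; [exact H1|exact Logic.I].
  - split; [exact H1|]; intros v; destruct (H2 v) as [f' [A B]].
    exists f'; split; [exact A|apply IH, B].
Qed.

Lemma derivative_along_unique {I : Type} {n : nat} (f : Rn n -> I -> C) (x v : Rn n)
    (l l' : I -> C) :
  derivative_along f x v l -> derivative_along f x v l' -> forall i, l i = l' i.
Proof. intros H H' i; exact (is_derive_C_unique _ _ _ _ (H i) (H' i)). Qed.

(** Derivatives at 0 along the line through a displaced point are derivatives at
    the corresponding time along the original line. *)
Lemma derivative_along_line {I : Type} {n : nat} (f : Rn n -> I -> C) (x v : Rn n)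
    (s : R) (l : I -> C) :
  derivative_along f (plus x (scal s v)) v l ->
  forall i, is_derive_C (fun t : R => f (plus x (scal t v)) i) s (l i).
Proof.
  intros H i.
  assert (H0 : is_derive (K := R_AbsRing) (fun t : R => t - s) s 1).
  { apply is_derive_Reals; replace 1 with (1 - 0) by ring.
    apply derivable_pt_lim_minus; [apply derivable_pt_lim_id|apply derivable_pt_lim_const]. }
  assert (H1 : is_derive_C
            (fun t : R => f (plus (plus x (scal s v)) (scal (t - s) v)) i) s (scal 1 (l i))).
  { apply (is_derive_comp (V := C_R_NormedModule)
            (fun t : R => f (plus (plus x (scal s v)) (scal t v)) i) (fun t => t - s)).
    - rewrite (Rminus_diag s); apply H.
    - exact H0. }
  replace (l i) with (scal (V := C_R_NormedModule) 1 (l i))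
    by exact (scal_one (V := C_R_NormedModule) (l i)).
  eapply is_derive_ext; [|exact H1].
  intros t; simpl; rewrite line_line; replace (s + (t - s)) with (t : R); [reflexivity|].
  exact (eq_sym (Rplus_minus s t)).
Qed.

(** Derivatives are only asked index by index; as they are continuous for the
    seminorms, the difference quotients converge for the seminorms too. *)
Lemma uniform_derivative {I : Type} (w : nat -> I -> R) {n : nat} (U : Rn n -> Prop)
    (f f' : Rn n -> I -> C) (x v : Rn n) :
  (forall N i, 1 <= w N i) -> open U -> U x ->
  (forall y, U y -> derivative_along f y v (f' y)) ->
  continuous_at w f' x ->
  forall N (eps : posreal), locally 0 (fun t => forall i,
    w N i * Cmod (f (plus x (scal t v)) i - f x i - RtoC t * f' x i)%C <= eps * Rabs t).
Proof.
  intros Hw HU Hx Hd [_ Hc] N eps.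
  destruct (locally_line x v _ (filter_and _ _ (HU x Hx) (Hc N (pos_div_2 eps))))
    as [delta Hdelta].
  exists delta; intros t Ht i.
  assert (Ht' : Rabs t < delta) by (apply ball_0_Rabs, Ht).
  assert (Hwi := Hw N i).
  assert (H : Cmod (f (plus x (scal t v)) i - RtoC t * f' x i
                    - (f (plus x (scal 0 v)) i - RtoC 0 * f' x i))%C
              <= 2 * (eps / 2 / w N i) * Rabs t).
  { apply (C_bounded_variation (fun s => f (plus x (scal s v)) i - RtoC s * f' x i)%C
      (fun s => f' (plus x (scal s v)) i - f' x i)%C).
    intros s Hs.
    destruct (Hdelta s) as [HUs Hcs].
    { apply ball_0_Rabs; lra. }
    split.
    - apply (is_derive_minus (V := C_R_NormedModule)
        (fun s => f (plus x (scal s v)) i) (fun s => RtoC s * f' x i)%C).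
      + apply derivative_along_line, Hd, HUs.
      + apply is_derive_ray.
    - apply Rmult_le_reg_l with (w N i); [lra|].
      eapply Rle_trans; [apply Hcs|]; simpl; apply Req_le; field; lra. }
  rewrite line_0 in H.
  replace (f (plus x (scal t v)) i - f x i - RtoC t * f' x i)%C with
    (f (plus x (scal t v)) i - RtoC t * f' x i - (f x i - RtoC 0 * f' x i))%C by ring.
  eapply Rle_trans; [apply Rmult_le_compat_l; [lra|exact H]|].
  apply Req_le; field; lra.
Qed.

(** ** Extensionality, sums, constants *)

Lemma derivative_along_ext {I : Type} {n : nat} (U : Rn n -> Prop)
    (f g : Rn n -> I -> C) (x v : Rn n) (l : I -> C) :
  open U -> U x -> (forall y, U y -> forall i, f y i = g y i) ->
  derivative_along f x v l -> derivative_along g x v l.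
Proof.
  intros HU Hx H Hf i.
  eapply (is_derive_ext_loc (V := C_R_NormedModule)); [|apply Hf].
  generalize (locally_line x v U (HU x Hx)); apply filter_imp; intros t Ht; apply H, Ht.
Qed.

Lemma continuous_at_ext {I : Type} (w : nat -> I -> R) {n : nat} (U : Rn n -> Prop)
    (f g : Rn n -> I -> C) (x : Rn n) :
  open U -> U x -> (forall y, U y -> forall i, f y i = g y i) ->
  continuous_at w f x -> continuous_at w g x.
Proof.
  intros HU Hx H [H1 H2]; split.
  - apply (tame_ext w (f x)); [apply H, Hx|exact H1].
  - intros N eps; generalize (filter_and _ _ (HU x Hx) (H2 N eps)); apply filter_imp.
    intros y [Hy K] i; rewrite <- !H by assumption; apply K.
Qed.

Lemma Ck_ext {I : Type} (w : nat -> I -> R) {n m : nat} (U : Rn n -> Prop)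
    (f g : Rn n -> I -> C) :
  open U -> (forall x, U x -> forall i, f x i = g x i) -> Ck w m U f -> Ck w m U g.
Proof.
  intros HU H Hf; destruct m as [|m]; destruct Hf as [H1 H2]; split.
  1,3: intros x Hx; apply continuous_atE, (continuous_at_ext w U f); trivial;
       apply continuous_atE, H1, Hx.
  - exact Logic.I.
  - intros v; destruct (H2 v) as [f' [A B]]; exists f'; split; [|exact B].
    intros x Hx; apply (derivative_along_ext U f); trivial; apply A, Hx.
Qed.

Lemma Ck_restrict {I : Type} (w : nat -> I -> R) {n : nat} (U U' : Rn n -> Prop) :
  (forall x, U' x -> U x) ->
  forall m (f : Rn n -> I -> C), Ck w m U f -> Ck w m U' f.
Proof.
  intros H; induction m as [|m IH]; intros f [H1 H2]; (split; [intros x Hx; apply H1, H, Hx|]).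
  - exact Logic.I.
  - intros v; destruct (H2 v) as [f' [A B]]; exists f'; split; [|apply IH, B].
    intros x Hx; apply A, H, Hx.
Qed.

Lemma smooth_derivative {I : Type} (w : nat -> I -> R) {n : nat} (U : Rn n -> Prop)
    (f g : Rn n -> I -> C) (v : Rn n) :
  open U -> smooth w U f -> (forall x, U x -> derivative_along f x v (g x)) ->
  smooth w U g.
Proof.
  intros HU Hf Hg m; destruct (Hf (S m)) as [_ H]; destruct (H v) as [f' [A B]].
  apply (Ck_ext w U f'); trivial.
  intros x Hx; apply (derivative_along_unique f x v); [apply A|apply Hg]; exact Hx.
Qed.

Lemma smooth_derivative_ex {I : Type} (w : nat -> I -> R) {n : nat} (U : Rn n -> Prop)
    (f : Rn n -> I -> C) (v : Rn n) :
  open U -> smooth w U f -> exists g : Rn n -> I -> C, smooth w U g /\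
  forall x, U x -> derivative_along f x v (g x).
Proof.
  intros HU Hf; destruct (Hf 1%nat) as [_ H]; destruct (H v) as [f' [A _]].
  exists f'; split; [|exact A]; exact (smooth_derivative w U f f' v HU Hf A).
Qed.

Lemma smooth_tame {I : Type} (w : nat -> I -> R) {n : nat} (U : Rn n -> Prop)
    (f : Rn n -> I -> C) (x : Rn n) : smooth w U f -> U x -> tame w (f x).
Proof. intros Hf Hx; apply (Ck_0 w U f (Hf O) x Hx). Qed.

Lemma smooth_derivative_tame {I : Type} (w : nat -> I -> R) {n : nat} (U : Rn n -> Prop)
    (f : Rn n -> I -> C) (x v : Rn n) (f' : I -> C) :
  open U -> U x -> smooth w U f -> derivative_along f x v f' -> tame w f'.
Proof.
  intros HU Hx Hf D; destruct (smooth_derivative_ex w U f v HU Hf) as [g [Sg Dg]].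
  apply (tame_ext w (g x)); [|apply (smooth_tame w U g x Sg Hx)].
  apply (derivative_along_unique f x v); [apply Dg, Hx|exact D].
Qed.

Lemma derivative_along_plus {I : Type} {n : nat} (f g : Rn n -> I -> C) (x v : Rn n)
    (l l' : I -> C) :
  derivative_along f x v l -> derivative_along g x v l' ->
  derivative_along (fun y i => f y i + g y i)%C x v (fun i => l i + l' i)%C.
Proof.
  intros Hf Hg i; exact (is_derive_plus (V := C_R_NormedModule) _ _ _ _ _ (Hf i) (Hg i)).
Qed.

Lemma Ck_plus {I : Type} (w : nat -> I -> R) {n : nat} (U : Rn n -> Prop) :
  (forall N i, 1 <= w N i) ->
  forall m (f g : Rn n -> I -> C), Ck w m U f -> Ck w m U g ->
  Ck w m U (fun x i => f x i + g x i)%C.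
Proof.
  intros Hw; induction m as [|m IH]; intros f g Hf Hg;
    assert (Hc : forall x, U x -> continuous_family_at (V := C_R_NormedModule) w
                   (fun x i => f x i + g x i)%C x).
  1,3: intros x Hx; apply continuous_atE;
    destruct (Ck_0 w U f Hf x Hx) as [A1 A2], (Ck_0 w U g Hg x Hx) as [B1 B2];
    (split; [apply tame_plus; assumption|]); intros N eps;
    generalize (filter_and _ _ (A2 N (pos_div_2 eps)) (B2 N (pos_div_2 eps)));
    apply filter_imp; intros y [A B] i; specialize (A i); specialize (B i);
    simpl in A, B;
    replace (f y i + g y i - (f x i + g x i))%C with ((f y i - f x i) + (g y i - g x i))%C by ring;
    generalize (Cmod_triangle (f y i - f x i)%C (g y i - g x i)%C) (Hw N i);
    intros; apply Rle_trans with
      (w N i * (Cmod (f y i - f x i)%C + Cmod (g y i - g x i)%C));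
    [apply Rmult_le_compat_l; lra|lra].
  - split; [exact Hc|exact Logic.I].
  - split; [exact Hc|]; intros v.
    destruct Hf as [_ Hf], Hg as [_ Hg], (Hf v) as [f' [A B]], (Hg v) as [g' [A' B']].
    exists (fun x i => f' x i + g' x i)%C; split; [|apply IH; assumption].
    intros x Hx; apply derivative_along_plus; [apply A|apply A']; exact Hx.
Qed.

Lemma tame_zero {I : Type} (w : nat -> I -> R) : tame w (fun _ => 0%C).
Proof. intros N; exists 0; intros i; rewrite Cmod_0; lra. Qed.

Lemma derivative_along_const {I : Type} {n : nat} (f : I -> C) (x v : Rn n) :
  derivative_along (fun _ => f) x v (fun _ => RtoC 0).
Proof. intros i; exact (is_derive_const (V := C_R_NormedModule) (f i) 0). Qed.

Lemma Ck_const {I : Type} (w : nat -> I -> R) {n : nat} (U : Rn n -> Prop) :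
  forall m (f : I -> C), tame w f -> Ck w m U (fun _ : Rn n => f).
Proof.
  induction m as [|m IH]; intros f Hf;
    assert (Hc : forall x, U x -> continuous_family_at (V := C_R_NormedModule) w
                   (fun _ : Rn n => f) x).
  1,3: intros x Hx; apply continuous_atE; split; [exact Hf|]; intros N eps;
    apply filter_forall; intros y i;
    replace (f i - f i)%C with (RtoC 0) by ring; rewrite Cmod_0, Rmult_0_r;
    apply Rlt_le, cond_pos.
  - split; [exact Hc|exact Logic.I].
  - split; [exact Hc|]; intros v; exists (fun _ _ => RtoC 0); split.
    + intros x Hx; apply derivative_along_const.
    + apply IH, tame_zero.
Qed.

(** ** Bounded bilinear maps *)

(** The algebraic identities are only asked for tame families, since sums of
    arbitrary families are not additive. *)
Record bounded_bilinear {I1 I2 I : Type} (w1 : nat -> I1 -> R) (w2 : nat -> I2 -> R)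
    (w : nat -> I -> R) (B : (I1 -> C) -> (I2 -> C) -> I -> C) : Prop := {
  bilinear_plus_l : forall f f' g i, tame w1 f -> tame w1 f' -> tame w2 g ->
    B (fun j => f j + f' j)%C g i = (B f g i + B f' g i)%C;
  bilinear_plus_r : forall f g g' i, tame w1 f -> tame w2 g -> tame w2 g' ->
    B f (fun j => g j + g' j)%C i = (B f g i + B f g' i)%C;
  bilinear_scal_l : forall c f g i, tame w1 f -> tame w2 g ->
    B (fun j => c * f j)%C g i = (c * B f g i)%C;
  bilinear_scal_r : forall c f g i, tame w1 f -> tame w2 g ->
    B f (fun j => c * g j)%C i = (c * B f g i)%C;
  bilinear_bound : forall N, exists N1 N2 K, 0 <= K /\
    forall f g A A', tame w1 f -> tame w2 g -> 0 <= A -> 0 <= A' ->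
      (forall i, w1 N1 i * Cmod (f i) <= A) -> (forall i, w2 N2 i * Cmod (g i) <= A') ->
      forall i, w N i * Cmod (B f g i) <= K * A * A'
}.

Lemma tame_bound {I : Type} (w : nat -> I -> R) (f : I -> C) (N : nat) : tame w f ->
  exists M, 0 <= M /\ forall i, w N i * Cmod (f i) <= M.
Proof.
  intros H; destruct (H N) as [M HM]; exists (Rmax 0 M); split; [apply Rmax_l|].
  intros i; eapply Rle_trans; [apply HM|apply Rmax_r].
Qed.

Lemma tame_opp {I : Type} (w : nat -> I -> R) (f : I -> C) :
  tame w f -> tame w (fun i => - f i)%C.
Proof. intros H N; destruct (H N) as [M HM]; exists M; intros i; rewrite Cmod_opp; apply HM. Qed.

Lemma tame_minus {I : Type} (w : nat -> I -> R) (f g : I -> C) :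
  (forall N i, 1 <= w N i) ->
  tame w f -> tame w g -> tame w (fun i => f i - g i)%C.
Proof. intros Hw Hf Hg; apply (tame_plus w f (fun i => - g i)%C Hw Hf), tame_opp, Hg. Qed.

Lemma continuous_at_bound {I : Type} (w : nat -> I -> R) {n : nat} (f : Rn n -> I -> C)
    (x : Rn n) (N : nat) (M : R) :
  (forall N i, 1 <= w N i) ->
  (forall i, w N i * Cmod (f x i) <= M) -> continuous_at w f x ->
  locally x (fun y => forall i, w N i * Cmod (f y i) <= M + 1).
Proof.
  intros Hw HM [_ H]; generalize (H N (mkposreal 1 Rlt_0_1)); apply filter_imp.
  intros y Hy i; specialize (Hy i); specialize (HM i); simpl in Hy; generalize (Hw N i); intros Hwi.
  replace (f y i) with (f x i + (f y i - f x i))%C by ring.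
  apply Rle_trans with (w N i * (Cmod (f x i) + Cmod (f y i - f x i)%C)); [|lra].
  apply Rmult_le_compat_l; [lra|apply Cmod_triangle].
Qed.

Section Bilinear.
Context {I1 I2 I : Type} {w1 : nat -> I1 -> R} {w2 : nat -> I2 -> R} {w : nat -> I -> R}
  {B : (I1 -> C) -> (I2 -> C) -> I -> C}
  (Hw1 : forall N i, 1 <= w1 N i) (Hw2 : forall N i, 1 <= w2 N i)
  (Hw : forall N i, 1 <= w N i) (HB : bounded_bilinear w1 w2 w B).

Lemma bilinear_tame (f : I1 -> C) (g : I2 -> C) :
  tame w1 f -> tame w2 g -> tame w (B f g).
Proof.
  intros Hf Hg N; destruct (bilinear_bound _ _ _ _ HB N) as [N1 [N2 [K [HK H]]]].
  destruct (tame_bound w1 f N1 Hf) as [M [HM0 HM]], (tame_bound w2 g N2 Hg) as [M' [HM0' HM']].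
  exists (K * M * M'); intros i; apply H; assumption.
Qed.

Lemma bilinear_split (f f0 : I1 -> C) (g g0 : I2 -> C) (i : I) :
  tame w1 f -> tame w1 f0 -> tame w2 g -> tame w2 g0 ->
  (B f g i - B f0 g0 i = B (fun j => f j - f0 j) g i + B f0 (fun j => g j - g0 j) i)%C.
Proof.
  intros Hf Hf0 Hg Hg0.
  replace (B f g i) with (B (fun j => (f j - f0 j) + f0 j)%C g i)
    by (f_equal; apply functional_extensionality; intros j; ring).
  replace (B f0 (fun j => g j - g0 j) i)%C with (B f0 (fun j => g j + RtoC (-1) * g0 j)%C i)
    by (f_equal; apply functional_extensionality; intros j; ring).
  rewrite (bilinear_plus_l _ _ _ _ HB), (bilinear_plus_r _ _ _ _ HB),
    (bilinear_scal_r _ _ _ _ HB); trivial.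
  - ring.
  - apply tame_scal, Hg0.
  - apply tame_minus; assumption.
Qed.

Lemma bilinear_continuous {n : nat} (U : Rn n -> Prop) (f : Rn n -> I1 -> C)
    (g : Rn n -> I2 -> C) :
  open U -> (forall x, U x -> continuous_at w1 f x) ->
  (forall x, U x -> continuous_at w2 g x) ->
  forall x, U x -> continuous_at w (fun x => B (f x) (g x)) x.
Proof.
  intros HU Hf Hg x Hx; split.
  - apply bilinear_tame; [apply Hf|apply Hg]; exact Hx.
  - intros N eps; destruct (bilinear_bound _ _ _ _ HB N) as [N1 [N2 [K [HK H]]]].
    destruct (tame_bound w1 (f x) N1) as [M [HM0 HM]]; [apply Hf, Hx|].
    destruct (tame_bound w2 (g x) N2) as [M' [HM0' HM']]; [apply Hg, Hx|].
    assert (Hd : 0 < eps / (K * (M + M' + 1) + 1)).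
    { apply Rdiv_lt_0_compat; [apply cond_pos|].
      assert (0 <= K * (M + M' + 1)) by (apply Rmult_le_pos; lra); lra. }
    set (delta := mkposreal _ Hd).
    generalize (filter_and _ _ (HU x Hx)
      (filter_and _ _ (continuous_at_bound w2 g x N2 M' Hw2 HM' (Hg x Hx))
        (filter_and _ _ (proj2 (Hf x Hx) N1 delta) (proj2 (Hg x Hx) N2 delta)))).
    apply filter_imp; intros y [Hy [By [Fy Gy]]] i.
    destruct (Hf x Hx) as [Tfx _], (Hg x Hx) as [Tgx _], (Hf y Hy) as [Tfy _],
      (Hg y Hy) as [Tgy _].
    rewrite bilinear_split by assumption.
    apply Rle_trans with (K * delta * (M' + 1) + K * M * delta).
    + eapply Rle_trans; [apply Rmult_le_compat_l; [generalize (Hw N i); lra|apply Cmod_triangle]|].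
      rewrite Rmult_plus_distr_l; apply Rplus_le_compat.
      * apply (H (fun j => f y j - f x j)%C (g y)); trivial; try lra.
        -- apply tame_minus; assumption.
        -- apply Rlt_le, cond_pos.
      * apply (H (f x) (fun j => g y j - g x j)%C); trivial.
        -- apply tame_minus; assumption.
        -- apply Rlt_le, cond_pos.
    + replace (K * delta * (M' + 1) + K * M * delta) with (K * (M + M' + 1) * delta) by ring.
      unfold delta; simpl.
      assert (0 <= K * (M + M' + 1)) by (apply Rmult_le_pos; lra).
      apply Rmult_le_reg_r with (K * (M + M' + 1) + 1); [lra|].
      unfold Rdiv; rewrite !Rmult_assoc, Rinv_l, Rmult_1_r by lra.
      generalize (cond_pos eps); nra.
Qed.

Lemma bilinear_derivative {n : nat} (U : Rn n -> Prop) (f f' : Rn n -> I1 -> C)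
    (g g' : Rn n -> I2 -> C) (x v : Rn n) :
  open U -> U x -> (forall y, U y -> continuous_at w1 f y) ->
  (forall y, U y -> continuous_at w2 g y) ->
  (forall y, U y -> derivative_along f y v (f' y)) ->
  (forall y, U y -> derivative_along g y v (g' y)) ->
  continuous_at w1 f' x -> continuous_at w2 g' x ->
  derivative_along (fun y => B (f y) (g y)) x v (fun i => B (f' x) (g x) i + B (f x) (g' x) i)%C.
Proof.
  intros HU Hx Hf Hg Df Dg Cf' Cg' i; apply is_derive_C_eps; intros eps.
  destruct (bilinear_bound _ _ _ _ HB O) as [N1 [N2 [K [HK H]]]].
  destruct (tame_bound w1 (f x) N1) as [M [HM0 HM]]; [apply Hf, Hx|].
  destruct (tame_bound w1 (f' x) N1) as [M1 [HM10 HM1]]; [apply Cf'|].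
  destruct (tame_bound w2 (g x) N2) as [M' [HM0' HM']]; [apply Hg, Hx|].
  assert (Hd : 0 < eps / (K * (M + M1 + M' + 1) + 1)).
  { apply Rdiv_lt_0_compat; [apply cond_pos|].
    assert (0 <= K * (M + M1 + M' + 1)) by (apply Rmult_le_pos; lra); lra. }
  set (delta := mkposreal _ Hd).
  generalize (filter_and _ _ (filter_and _ _
      (uniform_derivative w1 U f f' x v Hw1 HU Hx Df Cf' N1 delta)
      (uniform_derivative w2 U g g' x v Hw2 HU Hx Dg Cg' N2 delta))
    (locally_line x v _ (filter_and _ _ (HU x Hx)
      (filter_and _ _ (continuous_at_bound w2 g x N2 M' Hw2 HM' (Hg x Hx))
        (proj2 (Hg x Hx) N2 delta))))).
  apply filter_imp; intros t [[Ft Gt] [Hy [By Ct]]].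
  rewrite line_0; set (y := plus x (scal t v)) in *.
  destruct (Hf x Hx) as [Tfx _], (Hg x Hx) as [Tgx _], (Hf y Hy) as [Tfy _],
    (Hg y Hy) as [Tgy _], Cf' as [Tf' _], Cg' as [Tg' _].
  assert (Hdelta := cond_pos delta).
  assert (Ht := Rabs_pos t).
  set (rf := fun j => (f y j - f x j - RtoC t * f' x j)%C) in *.
  set (rg := fun j => (g y j - g x j - RtoC t * g' x j)%C) in *.
  assert (Trf : tame w1 rf)
    by (apply tame_minus; [|apply tame_minus|apply tame_scal]; assumption).
  assert (Trg : tame w2 rg)
    by (apply tame_minus; [|apply tame_minus|apply tame_scal]; assumption).
  (* The error of the product rule, in terms of the errors [rf] and [rg] of the
     two factors. *)
  assert (E : (B (f y) (g y) i - B (f x) (g x) i - RtoC t * (B (f' x) (g x) i + B (f x) (g' x) i)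
    = B rf (g y) i + (B (f x) rg i + RtoC t * B (f' x) (fun j => g y j - g x j) i))%C).
  { rewrite bilinear_split by assumption.
    replace (fun j => f y j - f x j)%C with (fun j => rf j + RtoC t * f' x j)%C
      by (apply functional_extensionality; intros j; unfold rf; ring).
    replace (B (f x) (fun j => g y j - g x j)%C i) with (B (f x) (fun j => rg j + RtoC t * g' x j)%C i)
      by (f_equal; apply functional_extensionality; intros j; unfold rg; ring).
    rewrite (bilinear_plus_l _ _ _ _ HB), (bilinear_plus_r _ _ _ _ HB),
      (bilinear_scal_r _ _ _ _ HB), (bilinear_scal_l _ _ _ _ HB);
      try assumption; try (apply tame_scal; assumption).
    replace (B (f' x) (fun j => g y j - g x j)%C i)
      with (B (f' x) (fun j => g y j + RtoC (-1) * g x j)%C i)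
      by (f_equal; apply functional_extensionality; intros j; ring).
    rewrite (bilinear_plus_r _ _ _ _ HB), (bilinear_scal_r _ _ _ _ HB);
      try assumption; try (apply tame_scal; assumption).
    ring. }
  rewrite E; clear E.
  assert (Hwi : forall z c, w O i * Cmod z <= c -> Cmod z <= c).
  { intros z c Hz; generalize (Hw O i) (Cmod_ge_0 z); nra. }
  assert (E1 : Cmod (B rf (g y) i) <= K * (delta * Rabs t) * (M' + 1)).
  { apply Hwi, H; trivial; try lra; apply Rmult_le_pos; lra. }
  assert (E2 : Cmod (B (f x) rg i) <= K * M * (delta * Rabs t)).
  { apply Hwi, H; trivial; apply Rmult_le_pos; lra. }
  assert (E3 : Cmod (B (f' x) (fun j => g y j - g x j)%C i) <= K * M1 * delta).
  { apply Hwi, H; trivial; [apply tame_minus; assumption|lra]. }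
  apply Rle_trans with (K * (delta * Rabs t) * (M' + 1) + (K * M * (delta * Rabs t)
    + Rabs t * (K * M1 * delta))).
  - eapply Rle_trans; [apply Cmod_triangle|]; apply Rplus_le_compat; [exact E1|].
    eapply Rle_trans; [apply Cmod_triangle|]; apply Rplus_le_compat; [exact E2|].
    rewrite Cmod_mult, Cmod_R; apply Rmult_le_compat_l; assumption.
  - replace (_ + _) with (K * (M + M1 + M' + 1) * delta * Rabs t) by ring.
    apply Rmult_le_compat_r; [exact Ht|].
    unfold delta; simpl.
    assert (0 <= K * (M + M1 + M' + 1)) by (apply Rmult_le_pos; lra).
    apply Rmult_le_reg_r with (K * (M + M1 + M' + 1) + 1); [lra|].
    unfold Rdiv; rewrite !Rmult_assoc, Rinv_l, Rmult_1_r by lra.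
    generalize (cond_pos eps); nra.
Qed.

Lemma Ck_bilinear {n : nat} (U : Rn n -> Prop) : open U ->
  forall m (f : Rn n -> I1 -> C) (g : Rn n -> I2 -> C),
  Ck w1 m U f -> Ck w2 m U g -> Ck w m U (fun x => B (f x) (g x)).
Proof.
  intros HU; induction m as [|m IH]; intros f g Hf Hg;
    assert (Cf := Ck_0 w1 U f Hf); assert (Cg := Ck_0 w2 U g Hg); split.
  1,3: intros x Hx; apply continuous_atE, (bilinear_continuous U); assumption.
  - exact Logic.I.
  - intros v; assert (Pf := Ck_pred w1 U m f Hf); assert (Pg := Ck_pred w2 U m g Hg).
    destruct Hf as [_ Hf], Hg as [_ Hg], (Hf v) as [f' [Df Hf']], (Hg v) as [g' [Dg Hg']].
    exists (fun x i => B (f' x) (g x) i + B (f x) (g' x) i)%C; split.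
    + intros x Hx; apply (bilinear_derivative U); trivial.
      * exact (Ck_0 w1 U f' Hf' x Hx).
      * exact (Ck_0 w2 U g' Hg' x Hx).
    + apply Ck_plus; [exact Hw| |]; apply IH; assumption.
Qed.

Lemma smooth_bilinear {n : nat} (U : Rn n -> Prop) (f : Rn n -> I1 -> C) (g : Rn n -> I2 -> C) :
  open U -> smooth w1 U f -> smooth w2 U g -> smooth w U (fun x => B (f x) (g x)).
Proof. intros HU Hf Hg m; apply Ck_bilinear; [exact HU|apply Hf|apply Hg]. Qed.

Lemma smooth_bilinear_derivative {n : nat} (U : Rn n -> Prop) (f : Rn n -> I1 -> C)
    (g : Rn n -> I2 -> C) (x v : Rn n) (f' : I1 -> C) (g' : I2 -> C) :
  open U -> U x -> smooth w1 U f -> smooth w2 U g ->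
  derivative_along f x v f' -> derivative_along g x v g' ->
  derivative_along (fun y => B (f y) (g y)) x v (fun i => B f' (g x) i + B (f x) g' i)%C.
Proof.
  intros HU Hx Hf Hg Df Dg.
  destruct (smooth_derivative_ex w1 U f v HU Hf) as [df [Sf Ef]].
  destruct (smooth_derivative_ex w2 U g v HU Hg) as [dg [Sg Eg]].
  replace f' with (df x)
    by (apply functional_extensionality, (derivative_along_unique f x v); [apply Ef, Hx|exact Df]).
  replace g' with (dg x)
    by (apply functional_extensionality, (derivative_along_unique g x v); [apply Eg, Hx|exact Dg]).
  apply (bilinear_derivative U); trivial; intros.
  - exact (Ck_0 w1 U f (Hf O) y H).
  - exact (Ck_0 w2 U g (Hg O) y H).
  - exact (Ck_0 w1 U df (Sf O) x Hx).
  - exact (Ck_0 w2 U dg (Sg O) x Hx).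
Qed.

End Bilinear.

(** ** Products, shifts, tails *)

Lemma flat_ge_1 {I : Type} (N : nat) (i : I) : 1 <= flat N i.
Proof. apply Rle_refl. Qed.

Lemma bounded_product {I : Type} (w1 w2 w : nat -> I -> R) :
  (forall N i, 1 <= w1 N i) -> (forall N i, 1 <= w2 N i) ->
  (forall N i, w N i <= w1 N i * w2 N i) ->
  bounded_bilinear w1 w2 w (fun f g i => f i * g i)%C.
Proof.
  intros H1 H2 H; split; intros; try ring.
  exists N, N, 1; split; [lra|]; intros f g A A' _ _ HA HA' Hf Hg i.
  specialize (Hf i); specialize (Hg i).
  specialize (H N i); specialize (H1 N i); specialize (H2 N i).
  rewrite Cmod_mult, Rmult_1_l.
  generalize (Cmod_ge_0 (f i)) (Cmod_ge_0 (g i)); intros P1 P2.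
  apply Rle_trans with ((w1 N i * w2 N i) * (Cmod (f i) * Cmod (g i))).
  - apply Rmult_le_compat_r; [apply Rmult_le_pos|]; assumption.
  - replace (_ * _) with ((w1 N i * Cmod (f i)) * (w2 N i * Cmod (g i))) by ring.
    apply Rmult_le_compat; trivial; apply Rmult_le_pos; lra.
Qed.

Lemma bounded_scaling {I : Type} (w : nat -> I -> R) :
  (forall N i, 1 <= w N i) ->
  bounded_bilinear (flat (I := unit)) w w (fun c g i => c tt * g i)%C.
Proof.
  intros Hw; split; intros; try ring.
  exists N, N, 1; split; [lra|]; intros f g A A' _ _ HA HA' Hf Hg i.
  specialize (Hf tt); specialize (Hg i); specialize (Hw N i); unfold flat in Hf.
  rewrite Cmod_mult, Rmult_1_l.
  replace (w N i * _) with ((1 * Cmod (f tt)) * (w N i * Cmod (g i))) by ring.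
  apply Rmult_le_compat; trivial; apply Rmult_le_pos; try lra; apply Cmod_ge_0.
Qed.

Record bounded_linear {I1 I : Type} (w1 : nat -> I1 -> R) (w : nat -> I -> R)
    (T : (I1 -> C) -> I -> C) : Prop := {
  linear_plus : forall f g i, tame w1 f -> tame w1 g ->
    T (fun j => f j + g j)%C i = (T f i + T g i)%C;
  linear_scal : forall c f i, tame w1 f -> T (fun j => c * f j)%C i = (c * T f i)%C;
  linear_bound : forall N, exists N1 K, 0 <= K /\ forall f A, tame w1 f -> 0 <= A ->
    (forall i, w1 N1 i * Cmod (f i) <= A) -> forall i, w N i * Cmod (T f i) <= K * A
}.

(** A linear map is the value at the scalar 1 of a bilinear one, so that its
    calculus is a special case. *)
Lemma linear_bilinear {I1 I : Type} (w1 : nat -> I1 -> R) (w : nat -> I -> R)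
    (T : (I1 -> C) -> I -> C) :
  (forall N i, 1 <= w N i) -> bounded_linear w1 w T ->
  bounded_bilinear (flat (I := unit)) w1 w (fun c f i => c tt * T f i)%C.
Proof.
  intros Hw H; split; intros; try ring.
  - rewrite (linear_plus _ _ _ H) by assumption; ring.
  - rewrite (linear_scal _ _ _ H) by assumption; ring.
  - destruct (linear_bound _ _ _ H N) as [N1 [K [HK HT]]].
    exists O, N1, K; split; [exact HK|]; intros c f A A' _ Tf HA HA' Hc Hf i.
    specialize (Hc tt); unfold flat in Hc; rewrite Rmult_1_l in Hc.
    rewrite Cmod_mult; replace (w N i * _) with (Cmod (c tt) * (w N i * Cmod (T f i))) by ring.
    replace (K * A * A') with (A * (K * A')) by ring.
    apply Rmult_le_compat; trivial; [apply Cmod_ge_0| |apply HT; trivial].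
    apply Rmult_le_pos; [generalize (Hw N i); lra|apply Cmod_ge_0].
Qed.

Lemma smooth_const {I : Type} (w : nat -> I -> R) {n : nat} (U : Rn n -> Prop) (f : I -> C) :
  tame w f -> smooth w U (fun _ : Rn n => f).
Proof. intros Hf m; apply Ck_const, Hf. Qed.

Lemma tame_flat_scalar (c : C) : tame (flat (I := unit)) (fun _ => c).
Proof. intros N; exists (Cmod c); intros i; unfold flat; lra. Qed.

Lemma smooth_ext {I : Type} (w : nat -> I -> R) {n : nat} (U : Rn n -> Prop)
    (f g : Rn n -> I -> C) :
  open U -> (forall x, U x -> forall i, f x i = g x i) -> smooth w U f -> smooth w U g.
Proof. intros HU H Hf m; apply (Ck_ext w U f); trivial; apply Hf. Qed.

Section Linear.
Context {I1 I : Type} {w1 : nat -> I1 -> R} {w : nat -> I -> R} {T : (I1 -> C) -> I -> C}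
  (Hw1 : forall N i, 1 <= w1 N i) (Hw : forall N i, 1 <= w N i) (HT : bounded_linear w1 w T).

Lemma smooth_linear {n : nat} (U : Rn n -> Prop) (f : Rn n -> I1 -> C) :
  open U -> smooth w1 U f -> smooth w U (fun x => T (f x)).
Proof.
  intros HU Hf.
  apply (smooth_ext w U (fun x i => RtoC 1 * T (f x) i)%C _ HU); [intros; ring|].
  apply (smooth_bilinear flat_ge_1 Hw1 Hw (linear_bilinear _ _ _ Hw HT) U
           (fun _ _ => RtoC 1) f HU); [|exact Hf].
  apply smooth_const, tame_flat_scalar.
Qed.

Lemma smooth_linear_derivative {n : nat} (U : Rn n -> Prop) (f : Rn n -> I1 -> C)
    (x v : Rn n) (f' : I1 -> C) :
  open U -> U x -> smooth w1 U f -> derivative_along f x v f' ->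
  derivative_along (fun y => T (f y)) x v (T f').
Proof.
  intros HU Hx Hf Df.
  assert (H := smooth_bilinear_derivative flat_ge_1 Hw1 Hw (linear_bilinear _ _ _ Hw HT) U
           (fun _ _ => RtoC 1) f x v (fun _ => RtoC 0) f' HU Hx
           (smooth_const _ _ _ (tame_flat_scalar 1)) Hf (derivative_along_const _ x v) Df).
  intros i; specialize (H i).
  replace (T f' i) with (RtoC 0 * T (f x) i + RtoC 1 * T f' i)%C by ring.
  eapply is_derive_ext; [|exact H].
  intros t; cbv beta; apply Cmult_1_l.
Qed.
End Linear.

Lemma bounded_shift (m : Z) : bounded_linear weight weight (fun f k => f (k + m)%Z).
Proof.
  split; intros; trivial.
  exists N, (weight N m); generalize (weight_ge_1 N m); intros Hm; split; [lra|].
  intros f A _ HA Hf k.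
  apply Rle_trans with (weight N m * (weight N (k + m) * Cmod (f (k + m)%Z))).
  - rewrite <- Rmult_assoc; apply Rmult_le_compat_r; [apply Cmod_ge_0|].
    replace k with (k + m + - m)%Z at 1 by lia.
    eapply Rle_trans; [apply weight_add|]; rewrite weight_opp; lra.
  - apply Rmult_le_compat_l; [lra|apply Hf].
Qed.

Lemma bounded_sum_ge : bounded_linear weight flat (fun f k => sum_ge k f).
Proof.
  split; intros.
  - apply sum_ge_plus; assumption.
  - apply sum_ge_scal; assumption.
  - exists 2%nat, 8; split; [lra|]; intros f A _ HA Hf k.
    unfold flat; rewrite Rmult_1_l; apply (sum_ge_conv f A k Hf).
Qed.

Lemma bounded_sum_le : bounded_linear weight flat (fun f k => sum_le k f).
Proof.
  split; intros.
  - apply sum_le_plus; assumption.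
  - apply sum_le_scal; assumption.
  - exists 2%nat, 8; split; [lra|]; intros f A _ HA Hf k.
    unfold flat; rewrite Rmult_1_l; apply (sum_le_conv f A k Hf).
Qed.

Lemma bounded_sumZ : bounded_linear weight (flat (I := unit)) (fun f _ => sumZ f).
Proof.
  split; intros.
  - apply sumZ_plus; assumption.
  - apply sumZ_scal; assumption.
  - exists 2%nat, 16; split; [lra|]; intros f A _ HA Hf k.
    unfold flat; rewrite Rmult_1_l; unfold sumZ.
    eapply Rle_trans; [apply Cmod_triangle|].
    generalize (proj2 (sum_ge_conv f A 0 Hf)) (proj2 (sum_le_conv f A (-1) Hf)); lra.
Qed.

Lemma smooth_plus {I : Type} (w : nat -> I -> R) {n : nat} (U : Rn n -> Prop)
    (f g : Rn n -> I -> C) :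
  (forall N i, 1 <= w N i) -> smooth w U f -> smooth w U g ->
  smooth w U (fun x i => f x i + g x i)%C.
Proof. intros Hw Hf Hg m; apply Ck_plus; [exact Hw|apply Hf|apply Hg]. Qed.

(** ** Inverses *)

Definition bounded_below {I : Type} (d : I -> C) : Prop :=
  exists delta : posreal, forall i, delta <= Cmod (d i).

Lemma Cinv_diff (a b : C) : a <> 0%C -> b <> 0%C ->
  Cmod (/ a - / b)%C = Cmod (b - a)%C / (Cmod a * Cmod b).
Proof.
  intros Ha Hb.
  replace (/ a - / b)%C with ((b - a) * / (a * b))%C by (field; auto).
  rewrite Cmod_mult, Cmod_inv, Cmod_mult by (apply Cmult_neq_0; assumption).
  reflexivity.
Qed.

Lemma bounded_below_near {I : Type} {n : nat} (d : Rn n -> I -> C) (x : Rn n) (delta : R) :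
  0 < delta -> (forall i, delta <= Cmod (d x i)) -> continuous_at flat d x ->
  locally x (fun y => forall i, delta / 2 <= Cmod (d y i)).
Proof.
  intros Hdelta Hd [_ H].
  assert (H2 : 0 < delta / 2) by lra.
  generalize (H O (mkposreal _ H2)); apply filter_imp; intros y Hy i.
  specialize (Hy i); specialize (Hd i); unfold flat in Hy; simpl in Hy.
  generalize (Cmod_triangle (d y i) (- (d y i - d x i))%C); rewrite Cmod_opp.
  replace (d y i + - (d y i - d x i))%C with (d x i) by ring; lra.
Qed.

Lemma bounded_below_neq {I : Type} (d : I -> C) (delta : R) (i : I) :
  0 < delta -> delta <= Cmod (d i) -> d i <> 0%C.
Proof. intros H H' E; rewrite E, Cmod_0 in H'; lra. Qed.

Lemma inverse_continuous {I : Type} {n : nat} (d : Rn n -> I -> C) (x : Rn n) :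
  bounded_below (d x) -> continuous_at flat d x ->
  continuous_at flat (fun y i => / d y i)%C x.
Proof.
  intros [delta Hd] Hc; assert (Hdelta := cond_pos delta); split.
  - intros N; exists (/ delta); intros i; unfold flat; rewrite Rmult_1_l.
    rewrite Cmod_inv by (apply (bounded_below_neq _ delta); [lra|apply Hd]).
    apply Rinv_le_contravar; [lra|apply Hd].
  - intros N eps.
    assert (He : 0 < eps * (delta / 2 * delta))
      by (apply Rmult_lt_0_compat; [apply cond_pos|nra]).
    generalize (filter_and _ _ (bounded_below_near d x delta Hdelta Hd Hc)
      (proj2 Hc N (mkposreal _ He))).
    apply filter_imp; intros y [Hy Ey] i; specialize (Hy i); specialize (Ey i); specialize (Hd i).
    unfold flat in *; rewrite Rmult_1_l in *; simpl in Ey.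
    rewrite Cinv_diff; [|apply (bounded_below_neq _ (delta / 2)); lra
                        |apply (bounded_below_neq _ delta); lra].
    replace (d x i - d y i)%C with (- (d y i - d x i))%C by ring; rewrite Cmod_opp.
    assert (P : 0 < delta / 2 * delta) by nra.
    apply Rle_trans with (eps * (delta / 2 * delta) * / (delta / 2 * delta)).
    + unfold Rdiv; apply Rmult_le_compat; [apply Cmod_ge_0| |exact Ey|].
      * apply Rlt_le, Rinv_0_lt_compat; nra.
      * apply Rinv_le_contravar; [exact P|nra].
    + apply Req_le; field; lra.
Qed.

Lemma is_derive_Cinv (g : R -> C) (l : C) :
  g 0 <> 0%C -> is_derive_C g 0 l ->
  is_derive_C (fun t => / g t)%C 0 (- (l * (/ g 0 * / g 0)))%C.
Proof.
  intros H0 H; apply is_derive_C_parts in H.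
  destruct H as [H1 H2].
  set (a := fun t => fst (g t)) in *; set (b := fun t => snd (g t)) in *.
  assert (Hn : a 0 ^ 2 + b 0 ^ 2 <> 0).
  { intros E; apply H0; apply Cmod_eq_0; unfold Cmod; fold (a 0) (b 0); rewrite E; apply sqrt_0. }
  assert (Ea : Derive a 0 = fst l) by apply is_derive_unique, H1.
  assert (Eb : Derive b 0 = snd l) by apply is_derive_unique, H2.
  assert (Xa : ex_derive a 0) by (eexists; exact H1).
  assert (Xb : ex_derive b 0) by (eexists; exact H2).
  assert (E0 : g 0 = (a 0, b 0)) by apply surjective_pairing.
  assert (Hn' : a 0 * a 0 + b 0 * b 0 <> 0) by (intros E; apply Hn; simpl; lra).
  apply is_derive_C_parts; rewrite E0; split;
    [change (is_derive (fun t => a t / (a t ^ 2 + b t ^ 2)) 0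
      (fst (- (l * (/ (a 0, b 0) * / (a 0, b 0))))%C))
    |change (is_derive (fun t => - b t / (a t ^ 2 + b t ^ 2)) 0
      (snd (- (l * (/ (a 0, b 0) * / (a 0, b 0))))%C))];
    (auto_derive; [auto|]);
    change (Derive (fun t => a t) 0) with (Derive a 0);
    change (Derive (fun t => b t) 0) with (Derive b 0);
    rewrite Ea, Eb; simpl; field; exact Hn'.
Qed.

Lemma bounded_product_flat {I : Type} :
  bounded_bilinear (flat (I := I)) flat flat (fun f g i => f i * g i)%C.
Proof. apply bounded_product; try apply flat_ge_1; intros; unfold flat; lra. Qed.

Lemma Ck_opp {I : Type} (w : nat -> I -> R) {n m : nat} (U : Rn n -> Prop)
    (f : Rn n -> I -> C) :
  (forall N i, 1 <= w N i) -> open U -> Ck w m U f -> Ck w m U (fun x i => - f x i)%C.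
Proof.
  intros Hw HU Hf.
  apply (Ck_ext w U (fun x i => RtoC (-1) * f x i)%C); [exact HU|intros; ring|].
  apply (Ck_bilinear flat_ge_1 Hw Hw (bounded_scaling w Hw) U HU m (fun _ _ => RtoC (-1)) f);
    [|exact Hf].
  apply Ck_const, tame_flat_scalar.
Qed.

(** By induction on the order of differentiability, as the derivative is a
    product that contains the inverse itself. *)
Lemma smooth_inverse {I : Type} {n : nat} (U : Rn n -> Prop) (d : Rn n -> I -> C) :
  open U -> (forall x, U x -> bounded_below (d x)) -> smooth flat U d ->
  smooth flat U (fun x i => / d x i)%C.
Proof.
  intros HU Hb Hd m; induction m as [|m IH];
    assert (Hc : forall x, U x -> continuous_family_at (V := C_R_NormedModule) flat
                   (fun x i => / d x i)%C x)
    by (intros x Hx; apply continuous_atE, inverse_continuous;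
        [apply Hb, Hx|apply (Ck_0 flat U d (Hd O) x Hx)]).
  - split; [exact Hc|exact Logic.I].
  - split; [exact Hc|]; intros v.
    destruct (smooth_derivative_ex flat U d v HU Hd) as [d' [Sd Dd]].
    exists (fun x i => - (d' x i * (/ d x i * / d x i)))%C; split.
    + intros x Hx i; destruct (Hb x Hx) as [delta Hdelta].
      assert (H := is_derive_Cinv (fun t => d (plus x (scal t v)) i) (d' x i)).
      cbv beta in H; rewrite line_0 in H; apply H; [|apply Dd, Hx].
      apply (bounded_below_neq _ delta); [apply cond_pos|apply Hdelta].
    + apply Ck_opp; [apply flat_ge_1|exact HU|].
      apply (Ck_bilinear flat_ge_1 flat_ge_1 flat_ge_1 bounded_product_flat U HU m d'
        (fun x i => / d x i * / d x i)%C); [apply Sd|].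
      apply (Ck_bilinear flat_ge_1 flat_ge_1 flat_ge_1 bounded_product_flat U HU m
        (fun x i => / d x i)%C (fun x i => / d x i)%C); exact IH.
Qed.

(** ** Changes of parameter *)

Lemma Ck_affine {I : Type} (w : nat -> I -> R) {n n' : nat} (A A0 : Rn n -> Rn n')
    (U : Rn n' -> Prop) (U' : Rn n -> Prop) :
  (forall x v t, A (plus x (scal t v)) = plus (A x) (scal t (A0 v))) ->
  (forall x, continuous A x) -> (forall x, U' x -> U (A x)) ->
  forall m (f : Rn n' -> I -> C), Ck w m U f -> Ck w m U' (fun x => f (A x)).
Proof.
  intros HA Hc HU; induction m as [|m IH]; intros f Hf;
    assert (H0 : forall x, U' x -> continuous_family_at (V := C_R_NormedModule) w
                   (fun x => f (A x)) x).
  1,3: intros x Hx; apply continuous_atE;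
    destruct (Ck_0 w U f Hf (A x) (HU x Hx)) as [A1 A2]; (split; [exact A1|]);
    intros N eps; exact (Hc x _ (A2 N eps)).
  - split; [exact H0|exact Logic.I].
  - split; [exact H0|]; intros v; destruct Hf as [_ Hf], (Hf (A0 v)) as [f' [D S]].
    exists (fun x => f' (A x)); split; [|apply IH, S].
    intros x Hx i; eapply is_derive_ext; [|apply (D (A x) (HU x Hx) i)].
    intros t; simpl; rewrite HA; reflexivity.
Qed.

Definition coordinate {n : nat} (x : Rn (S n)) : R := fst (x : R * Rn n).

Lemma smooth_coordinate {n : nat} (U : Rn (S n) -> Prop) :
  smooth (flat (I := unit)) U (fun x _ => RtoC (coordinate x)).
Proof.
  assert (Hc : forall x, U x -> continuous_family_at (V := C_R_NormedModule) (flat (I := unit))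
      (fun (x : Rn (S n)) _ => RtoC (coordinate x)) x).
  { intros x Hx; apply continuous_atE; split; [apply tame_flat_scalar|]; intros N eps.
    exists eps; intros y [Hy _] i; unfold flat; rewrite Rmult_1_l, <- RtoC_minus, Cmod_R.
    apply Rlt_le, Hy. }
  intros [|m]; (split; [exact Hc|]); [exact Logic.I|].
  intros v; exists (fun _ _ => RtoC (coordinate v)); split; [|apply Ck_const, tame_flat_scalar].
  intros x Hx i.
  apply (is_derive_ext (V := C_R_NormedModule)
    (fun t : R => plus (RtoC (coordinate x)) (RtoC t * RtoC (coordinate v))%C)).
  - intros t; change (RtoC (coordinate x) + RtoC t * RtoC (coordinate v)
                      = RtoC (coordinate x + t * coordinate v))%C.
    rewrite RtoC_plus, RtoC_mult; reflexivity.
  - assert (H := is_derive_plus (V := C_R_NormedModule) _ _ 0 _ _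
      (is_derive_const (V := C_R_NormedModule) (RtoC (coordinate x)) 0)
      (is_derive_ray (RtoC (coordinate v)) 0)).
    rewrite plus_zero_l in H; exact H.
Qed.

(** ** Components of smooth bisequences *)

Lemma derivative_components {n : nat} (c : Rn n -> bisequence) (x v : Rn n) (h : bisequence) :
  bisequence_derivative c x v h <->
  derivative_along (fun y k => fst (c y k)) x v (fun k => fst (h k)) /\
  derivative_along (fun y k => snd (c y k)) x v (fun k => snd (h k)).
Proof.
  split.
  - intros H; split; intros k;
      apply (is_derive_pair (V := C_R_NormedModule) (W := C_R_NormedModule)
        (fun t => c (plus x (scal t v)) k) 0 (h k)), H.
  - intros [H1 H2] k.
    apply (is_derive_pair (V := C_R_NormedModule) (W := C_R_NormedModule)
        (fun t => c (plus x (scal t v)) k) 0 (h k)); split; [apply H1|apply H2].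
Qed.

Lemma norm_C2_between (z : C * C) :
  Cmod (fst z) <= norm (V := C2_NormedModule) z /\
  Cmod (snd z) <= norm (V := C2_NormedModule) z /\
  norm (V := C2_NormedModule) z <= Cmod (fst z) + Cmod (snd z).
Proof.
  destruct (prod_norm_between C_R_NormedModule C_R_NormedModule z) as [H1 [H2 H3]].
  rewrite norm_Cmod in H1, H3; rewrite norm_Cmod in H2, H3; auto.
Qed.

Lemma continuous_components {n : nat} (c : Rn n -> bisequence) (x : Rn n) :
  continuous_family_at (V := C2_NormedModule) weight c x <->
  continuous_at weight (fun y k => fst (c y k)) x /\
  continuous_at weight (fun y k => snd (c y k)) x.
Proof.
  assert (W : forall N k a b, a <= b -> weight N k * a <= weight N k * b).
  { intros N k a b; apply Rmult_le_compat_l; generalize (weight_ge_1 N k); lra. }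
  split.
  - intros H; split; split.
    + intros N; destruct (H N) as [[M HM] _]; exists M; intros k.
      eapply Rle_trans; [apply W, norm_C2_between|apply HM].
    + intros N eps; generalize (proj2 (H N) eps); apply filter_imp; intros y Hy k.
      eapply Rle_trans; [|apply (Hy k)]; apply W.
      apply (norm_C2_between (minus (c y k) (c x k) : C2_NormedModule)).
    + intros N; destruct (H N) as [[M HM] _]; exists M; intros k.
      eapply Rle_trans; [apply W, norm_C2_between|apply HM].
    + intros N eps; generalize (proj2 (H N) eps); apply filter_imp; intros y Hy k.
      eapply Rle_trans; [|apply (Hy k)]; apply W.
      apply (norm_C2_between (minus (c y k) (c x k) : C2_NormedModule)).
  - intros [[A1 A2] [B1 B2]] N; split.
    + destruct (A1 N) as [M HM], (B1 N) as [M' HM']; exists (M + M'); intros k.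
      eapply Rle_trans; [apply W, norm_C2_between|].
      rewrite Rmult_plus_distr_l; apply Rplus_le_compat; [apply HM|apply HM'].
    + intros eps.
      generalize (filter_and _ _ (A2 N (pos_div_2 eps)) (B2 N (pos_div_2 eps))).
      apply filter_imp; intros y [A B] k.
      eapply Rle_trans;
        [apply W, (norm_C2_between (minus (c y k) (c x k) : C2_NormedModule))|].
      rewrite Rmult_plus_distr_l.
      replace (pos eps) with (eps / 2 + eps / 2) by field.
      apply Rplus_le_compat; [apply A|apply B].
Qed.

Lemma Ck_components {n : nat} (U : Rn n -> Prop) : forall m (c : Rn n -> bisequence),
  Ck_family (V := C2_NormedModule) weight m U c <->
  Ck weight m U (fun y k => fst (c y k)) /\ Ck weight m U (fun y k => snd (c y k)).
Proof.
  induction m as [|m IH]; intros c; split.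
  - intros [H _]; split; (split; [|exact Logic.I]); intros x Hx; apply continuous_atE;
      apply continuous_components, H, Hx.
  - intros [[H1 _] [H2 _]]; split; [|exact Logic.I]; intros x Hx.
    apply continuous_components; split; apply continuous_atE; [apply H1|apply H2]; exact Hx.
  - intros [H H']; split; (split; [intros x Hx; apply continuous_atE;
      apply continuous_components, H, Hx|]); intros v; destruct (H' v) as [c' [D S]];
      apply IH in S; destruct S as [S1 S2].
    + exists (fun y k => fst (c' y k)); split; [|exact S1].
      intros x Hx; apply (derivative_components c x v (c' x)), D, Hx.
    + exists (fun y k => snd (c' y k)); split; [|exact S2].
      intros x Hx; apply (derivative_components c x v (c' x)), D, Hx.
  - intros [[H1 H1'] [H2 H2']]; split.
    + intros x Hx; apply continuous_components; split; apply continuous_atE;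
        [apply H1|apply H2]; exact Hx.
    + intros v; destruct (H1' v) as [f [D1 S1]], (H2' v) as [g [D2 S2]].
      exists (fun y k => (f y k, g y k)); split.
      * intros x Hx; apply derivative_components; split; [apply D1|apply D2]; exact Hx.
      * apply IH; split; assumption.
Qed.

Lemma smooth_components {n : nat} (U : Rn n -> Prop) (c : Rn n -> bisequence) :
  smooth_bisequence U c <->
  smooth weight U (fun y k => fst (c y k)) /\ smooth weight U (fun y k => snd (c y k)).
Proof.
  split.
  - intros H; split; intros m; apply (Ck_components U m c), H.
  - intros [H1 H2] m; apply Ck_components; split; [apply H1|apply H2].
Qed.

Lemma bounded_product_weight :
  bounded_bilinear weight weight weight (fun f g k => f k * g k)%C.
Proof.
  apply bounded_product; try apply weight_ge_1; intros N k.
  generalize (weight_ge_1 N k); nra.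
Qed.

(** * Plots *)

(** Decay takes care of all but finitely many indices. *)
Lemma bounded_below_one_minus (f : Z -> C) :
  rapid f -> (forall k, 1 - f k <> 0)%C -> bounded_below (fun k => 1 - f k)%C.
Proof.
  intros Hf Hn.
  assert (Hfin : forall K : nat, exists delta : posreal, forall k,
            (Z.abs k <= Z.of_nat K)%Z -> delta <= Cmod (1 - f k)%C).
  { induction K as [|K [delta Hd]].
    - exists (mkposreal _ (proj1 (Cmod_gt_0 _) (Hn 0%Z))); intros k Hk; simpl.
      replace k with 0%Z by lia; apply Rle_refl.
    - set (a := Cmod (1 - f (Z.of_nat (S K)))%C); set (b := Cmod (1 - f (- Z.of_nat (S K))%Z)%C).
      assert (Ha : 0 < a) by apply Cmod_gt_0, Hn.
      assert (Hb : 0 < b) by apply Cmod_gt_0, Hn.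
      assert (Hm : 0 < Rmin delta (Rmin a b))
        by (repeat apply Rmin_glb_lt; trivial; apply cond_pos).
      exists (mkposreal _ Hm); intros k Hk; simpl pos.
      destruct (Z_le_gt_dec (Z.abs k) (Z.of_nat K)) as [H|H].
      + eapply Rle_trans; [apply Rmin_l|apply Hd, H].
      + eapply Rle_trans; [apply Rmin_r|].
        assert (k = Z.of_nat (S K) \/ k = - Z.of_nat (S K))%Z as [->| ->] by lia;
          [apply Rmin_l|apply Rmin_r]. }
  destruct (Hf 1%nat) as [M HM].
  destruct (Hfin (Z.to_nat (up (2 * M)))) as [delta Hd].
  assert (Hm : 0 < Rmin delta (1 / 2)) by (apply Rmin_glb_lt; [apply cond_pos|lra]).
  exists (mkposreal _ Hm); intros k; simpl.
  destruct (Z_le_gt_dec (Z.abs k) (Z.of_nat (Z.to_nat (up (2 * M))))) as [H|H].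
  - eapply Rle_trans; [apply Rmin_l|apply Hd, H].
  - eapply Rle_trans; [apply Rmin_r|].
    assert (Hk : 2 * M < Rabs (IZR k)).
    { rewrite <- abs_IZR; apply Rlt_trans with (IZR (up (2 * M))); [apply archimed|].
      apply IZR_lt; lia. }
    specialize (HM k); unfold weight in HM; rewrite pow_1 in HM.
    assert (Hk' := Rabs_pos (IZR k)); assert (P := Cmod_ge_0 (f k)).
    assert (Cmod (f k) <= 1 / 2) by nra.
    generalize (Cmod_triangle (1 - f k)%C (f k)).
    replace (1 - f k + f k)%C with (RtoC 1) by ring; rewrite Cmod_1; lra.
Qed.

Definition denominator (p : bisequence) (k : Z) : C := (1 - snd (p k) * fst (p k))%C.

Lemma denominator_bounded_below (p : bisequence) : phase p -> bounded_below (denominator p).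
Proof.
  intros [[Hq Hr] Hn]; apply (bounded_below_one_minus (fun k => snd (p k) * fst (p k))%C);
    [|exact Hn].
  apply rapid_mult_flat; [exact Hr|apply rapid_flat, Hq].
Qed.

Lemma flat_weaken {n : nat} (U : Rn n -> Prop) : open U ->
  forall f : Rn n -> Z -> C, smooth weight U f -> smooth flat U f.
Proof.
  intros HU f Hf.
  apply (smooth_linear (T := fun f k => f k) weight_ge_1 flat_ge_1); trivial.
  split; intros; trivial.
  exists O, 1; split; [lra|]; intros g A _ HA Hg k.
  specialize (Hg k); unfold weight in Hg; simpl in Hg; unfold flat; lra.
Qed.

Lemma smooth_mult {n : nat} (U : Rn n -> Prop) (f g : Rn n -> Z -> C) :
  open U -> smooth weight U f -> smooth weight U g ->
  smooth weight U (fun x k => f x k * g x k)%C.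
Proof.
  intros HU; exact (smooth_bilinear weight_ge_1 weight_ge_1 weight_ge_1
    bounded_product_weight U f g HU).
Qed.

Lemma smooth_opp {I : Type} (w : nat -> I -> R) {n : nat} (U : Rn n -> Prop)
    (f : Rn n -> I -> C) :
  (forall N i, 1 <= w N i) -> open U -> smooth w U f -> smooth w U (fun x i => - f x i)%C.
Proof. intros Hw HU Hf m; apply Ck_opp; trivial; apply Hf. Qed.

Lemma tame_flat_const {I : Type} (c : C) : tame (flat (I := I)) (fun _ => c).
Proof. intros N; exists (Cmod c); intros i; unfold flat; lra. Qed.

Lemma smooth_denominator {n : nat} (U : Rn n -> Prop) (c : Rn n -> bisequence) :
  open U -> smooth_bisequence U c -> smooth flat U (fun x => denominator (c x)).
Proof.
  intros HU Hc; apply smooth_components in Hc; destruct Hc as [Hq Hr].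
  apply (smooth_plus flat U (fun _ _ => RtoC 1) (fun x k => - (snd (c x k) * fst (c x k)))%C);
    [apply flat_ge_1|apply smooth_const, tame_flat_const|].
  apply smooth_opp; [apply flat_ge_1|exact HU|].
  apply flat_weaken; [exact HU|]; apply smooth_mult; assumption.
Qed.

Definition tail {n : nat} (z : Rn (S n)) : Rn n := snd (z : R * Rn n).
Definition consR {n : nat} (s : R) (x : Rn n) : Rn (S n) := (s, x).

Definition translate (p : bisequence) (s : R) (w : bisequence) : bisequence :=
  fun k => (fst (p k) + RtoC s * fst (w k), snd (p k) + RtoC s * snd (w k))%C.

(** With the displacement along [X] as a new first parameter, the derivative of
    a field along [X] is a partial derivative of a family along a plot, hence
    smooth itself. *)
Definition perturb {n : nat} (c X : Rn n -> bisequence) (z : Rn (S n)) : bisequence :=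
  translate (c (tail z)) (coordinate z) (X (tail z)).

Lemma tail_line {n : nat} (z v : Rn (S n)) (t : R) :
  tail (plus z (scal t v)) = plus (tail z) (scal t (tail v)).
Proof. reflexivity. Qed.

Lemma tail_continuous {n : nat} (z : Rn (S n)) : continuous tail z.
Proof.
  intros P [eps H]; exists eps; intros y [_ Hy]; exact (H _ Hy).
Qed.

Lemma open_tail {n : nat} (U : Rn n -> Prop) : open U -> open (fun z : Rn (S n) => U (tail z)).
Proof. intros HU z Hz; exact (tail_continuous z U (HU _ Hz)). Qed.

Lemma smooth_affine {I : Type} (w : nat -> I -> R) {n n' : nat} (A A0 : Rn n -> Rn n')
    (U : Rn n' -> Prop) (U' : Rn n -> Prop) (f : Rn n' -> I -> C) :
  (forall x v t, A (plus x (scal t v)) = plus (A x) (scal t (A0 v))) ->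
  (forall x, continuous A x) -> (forall x, U' x -> U (A x)) ->
  smooth w U f -> smooth w U' (fun x => f (A x)).
Proof. intros H1 H2 H3 Hf m; apply (Ck_affine w A A0 U); trivial; apply Hf. Qed.

Lemma smooth_tail {I : Type} (w : nat -> I -> R) {n : nat} (U : Rn n -> Prop)
    (f : Rn n -> I -> C) :
  smooth w U f -> smooth w (fun z : Rn (S n) => U (tail z)) (fun z => f (tail z)).
Proof.
  apply (smooth_affine w tail tail); [intros; apply tail_line|apply tail_continuous|].
  intros z Hz; exact Hz.
Qed.

Lemma smooth_perturb {n : nat} (U : Rn n -> Prop) (c X : Rn n -> bisequence) :
  open U -> smooth_bisequence U c -> smooth_bisequence U X ->
  smooth_bisequence (fun z => U (tail z)) (perturb c X).
Proof.
  intros HU Hc HX; apply smooth_components in Hc; apply smooth_components in HX.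
  destruct Hc as [Hq Hr], HX as [Hu Hv]; apply smooth_components.
  assert (S : forall f g : Rn n -> Z -> C, smooth weight U f -> smooth weight U g ->
    smooth weight (fun z => U (tail z))
      (fun z k => f (tail z) k + RtoC (coordinate z) * g (tail z) k)%C).
  { intros f g Hf Hg.
    apply (smooth_plus weight _ (fun z k => f (tail z) k)
             (fun z k => RtoC (coordinate z) * g (tail z) k)%C).
    - apply weight_ge_1.
    - apply smooth_tail, Hf.
    - apply (smooth_bilinear flat_ge_1 weight_ge_1 weight_ge_1
        (bounded_scaling weight weight_ge_1) _ (fun z _ => RtoC (coordinate z))
        (fun z => g (tail z))).
      + apply open_tail, HU.
      + apply smooth_coordinate.
      + apply smooth_tail, Hg. }
  split; [apply (S _ _ Hq Hu)|apply (S _ _ Hr Hv)].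
Qed.

Lemma smooth_value_tangent {n : nat} (U : Rn n -> Prop) (c : Rn n -> bisequence) (x : Rn n) :
  smooth_bisequence U c -> U x -> tangent (c x).
Proof.
  intros Hc Hx; apply smooth_components in Hc; destruct Hc as [Hq Hr].
  split; [apply (Ck_0 weight U _ (Hq O) x Hx)|apply (Ck_0 weight U _ (Hr O) x Hx)].
Qed.

(** The phase space is open for the seminorms: near a point of it, the
    denominators keep half of their lower bound. *)
Lemma plot_perturb {n : nat} (U : Rn n -> Prop) (c X : Rn n -> bisequence) :
  plot U c -> smooth_bisequence U X ->
  plot (fun z => U (tail z) /\ phase (perturb c X z)) (perturb c X).
Proof.
  intros [HU [Hc Hp]] HX.
  assert (HU' := open_tail U HU).
  assert (Hs := smooth_perturb U c X HU Hc HX).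
  assert (HD := smooth_denominator _ _ HU' Hs).
  split; [|split].
  - intros z [Hz Pz]; destruct (denominator_bounded_below _ Pz) as [delta Hd].
    generalize (filter_and _ _ (HU' z Hz)
      (bounded_below_near (fun x => denominator (perturb c X x)) z delta
         (cond_pos delta) Hd (Ck_0 _ _ _ (HD O) z Hz))).
    apply filter_imp; intros y [Hy Dy]; split; [exact Hy|].
    split; [apply (smooth_value_tangent _ _ y Hs Hy)|].
    intros k; apply (bounded_below_neq (denominator (perturb c X y)) (delta / 2));
      [generalize (cond_pos delta); lra|apply Dy].
  - apply smooth_components in Hs; apply smooth_components.
    split; intros m; (apply (Ck_restrict weight (fun z => U (tail z)));
      [intros z [Hz _]; exact Hz|apply Hs]).
  - intros z [_ Hz]; exact Hz.
Qed.

Lemma plot_affine {n n' : nat} (A A0 : Rn n -> Rn n') (U : Rn n' -> Prop)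
    (c : Rn n' -> bisequence) :
  (forall x v t, A (plus x (scal t v)) = plus (A x) (scal t (A0 v))) ->
  (forall x, continuous A x) -> plot U c -> plot (fun x => U (A x)) (fun x => c (A x)).
Proof.
  intros H1 H2 [HU [Hc Hp]]; split; [|split].
  - intros x Hx; exact (H2 x U (HU _ Hx)).
  - apply smooth_components in Hc; apply smooth_components; destruct Hc as [Hq Hr].
    split; [apply (smooth_affine weight A A0 U _ (fun y k => fst (c y k)))
           |apply (smooth_affine weight A A0 U _ (fun y k => snd (c y k)))]; trivial.
  - intros x Hx; apply Hp, Hx.
Qed.

Lemma smooth_bisequence_const {n : nat} (U : Rn n -> Prop) (w : bisequence) :
  tangent w -> smooth_bisequence U (fun _ => w).
Proof.
  intros [H1 H2]; apply smooth_components; split;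
    [apply (smooth_const weight U (fun k => fst (w k)) H1)
    |apply (smooth_const weight U (fun k => snd (w k)) H2)].
Qed.

Lemma plot_const (p : bisequence) : phase p -> plot (n := 0) (fun _ => True) (fun _ => p).
Proof.
  intros Hp; split; [apply open_true|split].
  - apply smooth_bisequence_const, Hp.
  - intros _ _; exact Hp.
Qed.

Lemma perturb_consR {n : nat} (c X : Rn n -> bisequence) (s : R) (x : Rn n) :
  perturb c X (consR s x) = translate (c x) s (X x).
Proof. reflexivity. Qed.

Lemma translate_0 (p w : bisequence) : translate p 0 w = p.
Proof.
  apply functional_extensionality; intros k; unfold translate.
  rewrite (surjective_pairing (p k)) at 3; f_equal; ring.
Qed.

Lemma perturb_line {n : nat} (c X : Rn n -> bisequence) (z : Rn (S n)) (t : R) :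
  perturb c X (plus z (scal t (consR 1 zero)))
  = translate (c (tail z)) (coordinate z + t) (X (tail z)).
Proof.
  unfold perturb.
  assert (T : tail (plus z (scal t (consR 1 zero))) = tail z).
  { rewrite tail_line; change (tail (consR 1 zero)) with (zero : Rn n).
    etransitivity; [|apply plus_zero_r]; f_equal; exact (scal_zero_r t). }
  rewrite T; f_equal.
  change (coordinate z + t * 1 = coordinate z + t); ring.
Qed.

Lemma is_derive_translate (a b : C) (s : R) :
  is_derive_C (fun t => a + RtoC (s + t) * b)%C 0 b.
Proof.
  apply (is_derive_ext (V := C_R_NormedModule) (fun t : R =>
    plus (a + RtoC s * b)%C (RtoC t * b)%C)).
  - intros t; rewrite RtoC_plus.
    change (a + RtoC s * b + RtoC t * b = a + (RtoC s + RtoC t) * b)%C; ring.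
  - assert (H := is_derive_plus (V := C_R_NormedModule) _ _ 0 _ _
      (is_derive_const (V := C_R_NormedModule) (a + RtoC s * b)%C 0) (is_derive_ray b 0)).
    rewrite plus_zero_l in H; exact H.
Qed.

Lemma perturb_derivative {n : nat} (c X : Rn n -> bisequence) (z : Rn (S n)) :
  bisequence_derivative (perturb c X) z (consR 1 zero) (X (tail z)).
Proof.
  apply derivative_components; split; intros k.
  - apply (is_derive_ext (V := C_R_NormedModule)
      (fun t => fst (translate (c (tail z)) (coordinate z + t) (X (tail z)) k))).
    + intros t; rewrite perturb_line; reflexivity.
    + apply is_derive_translate.
  - apply (is_derive_ext (V := C_R_NormedModule)
      (fun t => snd (translate (c (tail z)) (coordinate z + t) (X (tail z)) k))).
    + intros t; rewrite perturb_line; reflexivity.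
    + apply is_derive_translate.
Qed.

(** * First and second variations *)

Definition duality (b h : bisequence) : C :=
  sumZ (fun k => fst (b k) * fst (h k) + snd (b k) * snd (h k))%C.

(** A property that can be verified for a candidate [b] without differentiating
    at single sites; [functional_derivative_eq] then identifies [b]. *)
Definition represents_variation (F : bisequence -> C) (b : bisequence -> bisequence) : Prop :=
  forall (n : nat) (U : Rn n -> Prop) (c : Rn n -> bisequence) (x v : Rn n) (h : bisequence),
    plot U c -> U x -> bisequence_derivative c x v h ->
    is_derive_C
      (fun t : R => F (c (plus x (scal t v)))) 0 (duality (b (c x)) h).

Lemma functional_represents (F : bisequence -> C) :
  functional F -> represents_variation F (functional_derivative F).
Proof. intros HF n U c x v h; apply (functional_variation F HF). Qed.

(** ** Functional derivatives as derivatives along lines *)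

Lemma variation_translate (F : bisequence -> C) (b : bisequence -> bisequence)
    (p w : bisequence) :
  represents_variation F b -> phase p -> tangent w ->
  is_derive_C
    (fun t : R => F (translate p t w)) 0 (duality (b p) w).
Proof.
  intros HF Hp Hw.
  assert (HP := plot_perturb _ _ (fun _ => w) (plot_const p Hp)
                  (smooth_bisequence_const _ w Hw)).
  assert (H := HF _ _ _ (consR 0 (0 : Rn 0)) (consR 1 zero) w HP).
  rewrite perturb_consR, translate_0 in H.
  eapply is_derive_ext; [|apply H; [split; [exact Logic.I|]|]].
  - intros t; cbv beta; rewrite perturb_line; do 2 f_equal.
    change (0 + t = t); ring.
  - rewrite perturb_consR, translate_0; exact Hp.
  - apply (perturb_derivative (fun _ => p) (fun _ => w)).
Qed.

(** [C_lim] approaches a point along the real axis, so that a derivative in the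
    real direction determines [C_derive]. *)
Lemma C_derive_of_real (g : C -> C) (l : C) :
  is_derive_C (fun t => g (RtoC t)) 0 l ->
  C_derive g 0%C = l.
Proof.
  intros H; assert (D := proj1 (is_derive_C_eps _ _) H).
  assert (K : forall pr : C -> R, (forall z, Rabs (pr z) <= Cmod z) ->
            (forall a b, pr (a - b)%C = pr a - pr b) ->
    Lim (fun x : R => pr ((g (x, 0) - g 0) / ((x, 0) - 0))%C) 0 = pr l).
  { intros pr Hpr Hm; apply is_lim_unique, is_lim_spec; intros eps.
    generalize (D (pos_div_2 eps)); intros [delta Hd]; exists delta; intros t Ht Hne.
    specialize (Hd t Ht); cbv beta in Hd; simpl pos in Hd.
    assert (Hr : RtoC t <> 0%C) by (intros E; apply Hne; injection E; trivial).
    change (t, 0) with (RtoC t).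
    rewrite <- Hm; eapply Rle_lt_trans; [apply Hpr|].
    replace ((g (RtoC t) - g 0) / (RtoC t - 0) - l)%C
      with ((g (RtoC t) - g 0 - RtoC t * l) / RtoC t)%C by (field; exact Hr).
    rewrite Cmod_div, Cmod_R by exact Hr.
    assert (P : 0 < Rabs t) by (apply Rabs_pos_lt, Hne).
    apply Rle_lt_trans with (eps / 2 * Rabs t / Rabs t).
    - apply Rmult_le_compat_r; [apply Rlt_le, Rinv_0_lt_compat, P|exact Hd].
    - replace (eps / 2 * Rabs t / Rabs t) with (eps / 2) by (field; lra).
      generalize (cond_pos eps); lra. }
  rewrite (surjective_pairing l).
  exact (f_equal2 pair
    (f_equal real (K fst (fun z => proj1 (parts_le_Cmod z)) (fun a b => eq_refl)))
    (f_equal real (K snd (fun z => proj2 (parts_le_Cmod z)) (fun a b => eq_refl)))).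
Qed.

Definition unit_q (k : Z) (z : C) : bisequence :=
  fun j => (if Z.eq_dec j k then z else 0%C, RtoC 0).
Definition unit_r (k : Z) (z : C) : bisequence :=
  fun j => (RtoC 0, if Z.eq_dec j k then z else 0%C).

Lemma unit_q_tangent (k : Z) (z : C) : tangent (unit_q k z).
Proof. split; [apply rapid_single|apply (tame_zero weight)]. Qed.

Lemma unit_r_tangent (k : Z) (z : C) : tangent (unit_r k z).
Proof. split; [apply (tame_zero weight)|apply rapid_single]. Qed.

Lemma duality_unit_q (b : bisequence) (k : Z) (z : C) :
  duality b (unit_q k z) = (fst (b k) * z)%C.
Proof.
  rewrite <- (sumZ_single k (fst (b k) * z)%C); apply sumZ_ext; intros j; simpl.
  destruct (Z.eq_dec j k) as [->|]; ring.
Qed.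

Lemma duality_unit_r (b : bisequence) (k : Z) (z : C) :
  duality b (unit_r k z) = (snd (b k) * z)%C.
Proof.
  rewrite <- (sumZ_single k (snd (b k) * z)%C); apply sumZ_ext; intros j; simpl.
  destruct (Z.eq_dec j k) as [->|]; ring.
Qed.

Lemma shift_q_translate (p : bisequence) (k : Z) (t : R) :
  shift_q p k (RtoC t) = translate p t (unit_q k 1).
Proof.
  apply functional_extensionality; intros j; unfold shift_q, translate, unit_q; simpl.
  destruct (Z.eq_dec j k); [f_equal; ring|].
  rewrite (surjective_pairing (p j)) at 1; f_equal; ring.
Qed.

Lemma shift_r_translate (p : bisequence) (k : Z) (t : R) :
  shift_r p k (RtoC t) = translate p t (unit_r k 1).
Proof.
  apply functional_extensionality; intros j; unfold shift_r, translate, unit_r; simpl.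
  destruct (Z.eq_dec j k); [f_equal; ring|].
  rewrite (surjective_pairing (p j)) at 1; f_equal; ring.
Qed.

(** Apply the first variation to the directions supported at one site. *)
Lemma functional_derivative_eq (F : bisequence -> C) (b : bisequence -> bisequence)
    (p : bisequence) :
  represents_variation F b -> phase p -> functional_derivative F p = b p.
Proof.
  intros HF Hp; apply functional_extensionality; intros k.
  unfold functional_derivative; rewrite (surjective_pairing (b p k)); f_equal;
    apply C_derive_of_real.
  - replace (fst (b p k)) with (duality (b p) (unit_q k 1))
      by (rewrite duality_unit_q; ring).
    eapply is_derive_ext; [|apply variation_translate; [exact HF|exact Hp|apply unit_q_tangent]].
    intros t; cbv beta; rewrite shift_q_translate; reflexivity.
  - replace (snd (b p k)) with (duality (b p) (unit_r k 1))
      by (rewrite duality_unit_r; ring).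
    eapply is_derive_ext; [|apply variation_translate; [exact HF|exact Hp|apply unit_r_tangent]].
    intros t; cbv beta; rewrite shift_r_translate; reflexivity.
Qed.

Lemma functional_derivative_tangent (F : bisequence -> C) (p : bisequence) :
  functional F -> phase p -> tangent (functional_derivative F p).
Proof.
  intros HF Hp.
  apply (smooth_value_tangent (n := 0) (fun _ => True) (fun _ => functional_derivative F p) 0);
    [|exact Logic.I].
  apply (functional_derivative_smooth F HF 0 _ (fun _ => p)), plot_const, Hp.
Qed.

(** ** Symmetry of second variations *)

Lemma schwarz_real (f f1 f2 f12 f21 : R -> R -> R) :
  locally_2d (fun a b =>
    is_derive (fun t : R => f t b) a (f1 a b) /\ is_derive (fun t : R => f a t) b (f2 a b) /\
    is_derive (fun t : R => f1 a t) b (f12 a b) /\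
    is_derive (fun t : R => f2 t b) a (f21 a b)) 0 0 ->
  continuity_2d_pt f12 0 0 -> continuity_2d_pt f21 0 0 -> f12 0 0 = f21 0 0.
Proof.
  intros [d H] C12 C21.
  assert (near : forall a : R, Rabs (a - 0) < d -> locally a (fun t : R => Rabs (t - 0) < d)).
  { intros a Ha; assert (P : 0 < d - Rabs (a - 0)) by lra.
    exists (mkposreal _ P); intros t Ht; change (Rabs (t - a) < d - Rabs (a - 0)) in Ht.
    replace (t - 0) with ((t - a) + (a - 0)) by ring.
    generalize (Rabs_triang (t - a) (a - 0)); lra. }
  assert (D2 : forall a b : R, Rabs (a - 0) < d -> Rabs (b - 0) < d ->
            is_derive (fun z : R => Derive (fun t : R => f z t) b) a (f21 a b)).
  { intros a b Ha Hb; eapply is_derive_ext_loc; [|apply (H a b Ha Hb)].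
    generalize (near a Ha); apply filter_imp; intros z Hz.
    symmetry; apply is_derive_unique, (H z b Hz Hb). }
  assert (D1 : forall a b : R, Rabs (a - 0) < d -> Rabs (b - 0) < d ->
            is_derive (fun z : R => Derive (fun t : R => f t z) a) b (f12 a b)).
  { intros a b Ha Hb; eapply is_derive_ext_loc; [|apply (H a b Ha Hb)].
    generalize (near b Hb); apply filter_imp; intros z Hz.
    symmetry; apply is_derive_unique, (H a z Ha Hz). }
  assert (H0 : Rabs (0 - 0) < d) by (rewrite Rminus_0_r, Rabs_R0; apply cond_pos).
  rewrite <- (is_derive_unique _ _ _ (D1 0 0 H0 H0)), <- (is_derive_unique _ _ _ (D2 0 0 H0 H0)).
  symmetry; apply Schwarz.
  - exists d; intros a b Ha Hb; destruct (H a b Ha Hb) as [E1 [E2 _]].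
    split; [|split; [|split]]; eexists; [exact E1|exact E2|apply D2|apply D1]; assumption.
  - eapply continuity_2d_pt_ext_loc; [|exact C21].
    exists d; intros a b Ha Hb; symmetry; apply is_derive_unique, D2; assumption.
  - eapply continuity_2d_pt_ext_loc; [|exact C12].
    exists d; intros a b Ha Hb; symmetry; apply is_derive_unique, D1; assumption.
Qed.

Definition point2 (a b : R) : Rn 1 := consR a (b : Rn 0).

Lemma point2_line_1 (a b t : R) :
  plus (point2 0 b) (scal t (point2 1 0)) = point2 t b.
Proof.
  change (point2 (0 + t * 1) (b + t * 0) = point2 t b); f_equal; ring.
Qed.

Lemma point2_line_2 (a b t : R) :
  plus (point2 a 0) (scal t (point2 0 1)) = point2 a t.
Proof.
  change (point2 (a + t * 0) (0 + t * 1) = point2 a t); f_equal; ring.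
Qed.

(** The index type is a point: the family is a single complex function of two
    real variables, to whose components the real theorem applies. *)
Lemma schwarz_family (U : Rn 1 -> Prop) (f f1 f2 f12 f21 : Rn 1 -> unit -> C) :
  open U -> U (point2 0 0) -> smooth flat U f ->
  (forall z, U z -> derivative_along f z (point2 1 0) (f1 z)) ->
  (forall z, U z -> derivative_along f z (point2 0 1) (f2 z)) ->
  derivative_along f1 (point2 0 0) (point2 0 1) (f12 (point2 0 0)) ->
  derivative_along f2 (point2 0 0) (point2 1 0) (f21 (point2 0 0)) ->
  f12 (point2 0 0) tt = f21 (point2 0 0) tt.
Proof.
  intros HU H0 Hf D1 D2 E12 E21.
  assert (S1 := smooth_derivative flat U f f1 _ HU Hf D1).
  assert (S2 := smooth_derivative flat U f f2 _ HU Hf D2).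
  destruct (smooth_derivative_ex flat U f1 (point2 0 1) HU S1) as [g12 [S12 D12]].
  destruct (smooth_derivative_ex flat U f2 (point2 1 0) HU S2) as [g21 [S21 D21]].
  rewrite (derivative_along_unique _ _ _ _ _ E12 (D12 _ H0)).
  rewrite (derivative_along_unique _ _ _ _ _ E21 (D21 _ H0)).
  assert (L : locally_2d (fun a b => U (point2 a b)) 0 0).
  { destruct (HU _ H0) as [d Hd]; exists d; intros a b Ha Hb; apply Hd; split; assumption. }
  assert (cont : forall (g : Rn 1 -> unit -> C) (pr : C -> R),
            (forall z, Rabs (pr z) <= Cmod z) -> (forall a b, pr (a - b)%C = pr a - pr b) ->
            smooth flat U g ->
            continuity_2d_pt (fun a b => pr (g (point2 a b) tt)) 0 0).
  { intros g pr Hpr Hm Hg eps; destruct (Ck_0 flat U g (Hg O) _ H0) as [_ H].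
    destruct (H O (pos_div_2 eps)) as [d Hd]; exists d; intros a b Ha Hb.
    specialize (Hd (point2 a b) (conj Ha Hb) tt); unfold flat in Hd; simpl pos in Hd.
    rewrite <- Hm; eapply Rle_lt_trans; [apply Hpr|].
    generalize (cond_pos eps); lra. }
  assert (line1 : forall g g' : Rn 1 -> unit -> C, (forall z, U z ->
            derivative_along g z (point2 1 0) (g' z)) -> forall a b, U (point2 a b) ->
            is_derive_C (fun t : R => g (point2 t b) tt) a
              (g' (point2 a b) tt)).
  { intros g g' D a b Hab.
    assert (H := derivative_along_line g (point2 0 b) (point2 1 0) a (g' (point2 a b))).
    rewrite point2_line_1 in H by exact 0.
    eapply is_derive_ext; [|apply H, D, Hab].
    intros t; cbv beta; rewrite point2_line_1 by exact 0; reflexivity. }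
  assert (line2 : forall g g' : Rn 1 -> unit -> C, (forall z, U z ->
            derivative_along g z (point2 0 1) (g' z)) -> forall a b, U (point2 a b) ->
            is_derive_C (fun t : R => g (point2 a t) tt) b
              (g' (point2 a b) tt)).
  { intros g g' D a b Hab.
    assert (H := derivative_along_line g (point2 a 0) (point2 0 1) b (g' (point2 a b))).
    rewrite point2_line_2 in H by exact 0.
    eapply is_derive_ext; [|apply H, D, Hab].
    intros t; cbv beta; rewrite point2_line_2 by exact 0; reflexivity. }
  assert (component : forall pr : C -> R,
    (forall z, Rabs (pr z) <= Cmod z) -> (forall a b, pr (a - b)%C = pr a - pr b) ->
    (forall g s l, is_derive_C g s l -> is_derive (fun t => pr (g t)) s (pr l)) ->
    pr (g12 (point2 0 0) tt) = pr (g21 (point2 0 0) tt)).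
  { intros pr Hpr Hm parts.
    apply (schwarz_real (fun a b => pr (f (point2 a b) tt)) (fun a b => pr (f1 (point2 a b) tt))
      (fun a b => pr (f2 (point2 a b) tt)) (fun a b => pr (g12 (point2 a b) tt))
      (fun a b => pr (g21 (point2 a b) tt))); [|apply cont; trivial..].
    destruct L as [d Hd]; exists d; intros a b Ha Hb; specialize (Hd a b Ha Hb).
    exact (conj (parts _ _ _ (line1 f f1 D1 a b Hd)) (conj (parts _ _ _ (line2 f f2 D2 a b Hd))
      (conj (parts _ _ _ (line2 f1 g12 D12 a b Hd)) (parts _ _ _ (line1 f2 g21 D21 a b Hd))))). }
  rewrite (surjective_pairing (g12 _ _)), (surjective_pairing (g21 _ _)); f_equal;
    apply component; trivial; try apply parts_le_Cmod;
    intros g s l H; apply is_derive_C_parts in H; apply H.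
Qed.

Lemma smooth_mult_derivative {n : nat} (U : Rn n -> Prop) (f g : Rn n -> Z -> C)
    (x v : Rn n) (f' g' : Z -> C) :
  open U -> U x -> smooth weight U f -> smooth weight U g ->
  derivative_along f x v f' -> derivative_along g x v g' ->
  derivative_along (fun y k => f y k * g y k)%C x v (fun k => f' k * g x k + f x k * g' k)%C.
Proof.
  exact (smooth_bilinear_derivative weight_ge_1 weight_ge_1 weight_ge_1
    bounded_product_weight U f g x v f' g').
Qed.

Lemma sumZ_derivative {n : nat} (U : Rn n -> Prop) (f : Rn n -> Z -> C)
    (x v : Rn n) (f' : Z -> C) :
  open U -> U x -> smooth weight U f -> derivative_along f x v f' ->
  derivative_along (fun y (_ : unit) => sumZ (f y)) x v (fun _ => sumZ f').
Proof.
  exact (smooth_linear_derivative weight_ge_1 flat_ge_1 bounded_sumZ U f x v f').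
Qed.

Lemma duality_derivative {n : nat} (U : Rn n -> Prop) (a b : Rn n -> bisequence)
    (x v : Rn n) (a' b' : bisequence) :
  open U -> U x -> smooth_bisequence U a -> smooth_bisequence U b ->
  bisequence_derivative a x v a' ->
  bisequence_derivative b x v b' ->
  derivative_along (fun y (_ : unit) => duality (a y) (b y)) x v
    (fun _ => duality a' (b x) + duality (a x) b')%C.
Proof.
  intros HU Hx Ha Hb Da Db.
  apply derivative_components in Da; apply derivative_components in Db.
  apply smooth_components in Ha; apply smooth_components in Hb.
  destruct Ha as [Ha1 Ha2], Hb as [Hb1 Hb2], Da as [Da1 Da2], Db as [Db1 Db2].
  assert (Ta1 := smooth_derivative_tame weight U _ x v _ HU Hx Ha1 Da1).
  assert (Ta2 := smooth_derivative_tame weight U _ x v _ HU Hx Ha2 Da2).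
  assert (Tb1 := smooth_derivative_tame weight U _ x v _ HU Hx Hb1 Db1).
  assert (Tb2 := smooth_derivative_tame weight U _ x v _ HU Hx Hb2 Db2).
  assert (Tax1 := smooth_tame weight U _ x Ha1 Hx).
  assert (Tax2 := smooth_tame weight U _ x Ha2 Hx).
  assert (Tbx1 := smooth_tame weight U _ x Hb1 Hx).
  assert (Tbx2 := smooth_tame weight U _ x Hb2 Hx).
  assert (H := sumZ_derivative U
    (fun y k => fst (a y k) * fst (b y k) + snd (a y k) * snd (b y k))%C x v _ HU Hx
    (smooth_plus weight U _ _ weight_ge_1 (smooth_mult U _ _ HU Ha1 Hb1)
                                          (smooth_mult U _ _ HU Ha2 Hb2))
    (derivative_along_plus _ _ x v _ _
      (smooth_mult_derivative U _ _ x v _ _ HU Hx Ha1 Hb1 Da1 Db1)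
      (smooth_mult_derivative U _ _ x v _ _ HU Hx Ha2 Hb2 Da2 Db2))).
  intros i; replace (duality a' (b x) + duality (a x) b')%C with
    (sumZ (fun i : Z => (fst (a' i) * fst (b x i) + fst (a x i) * fst (b' i) +
           (snd (a' i) * snd (b x i) + snd (a x i) * snd (b' i))))%C).
  - exact (H i).
  - unfold duality; rewrite <- sumZ_plus.
    + apply sumZ_ext; intros k; ring.
    + apply rapid_plus; apply rapid_mult; assumption.
    + apply rapid_plus; apply rapid_mult; assumption.
Qed.

(** Written with [Derive] to be a total function of the point and the direction;
    [hessian_smooth] shows that it is the derivative of the field of functional
    derivatives along [w]. *)
Definition hessian (F : bisequence -> C) (p w : bisequence) : bisequence := fun k =>
  ((Derive (fun t => fst (fst (functional_derivative F (translate p t w) k))) 0,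
    Derive (fun t => snd (fst (functional_derivative F (translate p t w) k))) 0),
   (Derive (fun t => fst (snd (functional_derivative F (translate p t w) k))) 0,
    Derive (fun t => snd (snd (functional_derivative F (translate p t w) k))) 0)).

Lemma is_derive_Derive (g : R -> C) (l : C) :
  is_derive_C g 0 l ->
  (Derive (fun t => fst (g t)) 0, Derive (fun t => snd (g t)) 0) = l.
Proof.
  intros H; apply is_derive_C_parts in H.
  destruct H as [H1 H2]; apply is_derive_unique in H1; apply is_derive_unique in H2.
  rewrite (surjective_pairing l); exact (f_equal2 pair H1 H2).
Qed.

Lemma consR_affine {n : nat} (x v : Rn n) (t : R) :
  consR 0 (plus x (scal t v)) = plus (consR 0 x) (scal t (consR 0 v)) :> Rn (S n).
Proof.
  change (consR 0 (plus x (scal t v)) = consR (0 + t * 0) (plus x (scal t v)) :> Rn (S n)).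
  f_equal; ring.
Qed.

Lemma consR_continuous {n : nat} (x : Rn n) : continuous (consR 0) x.
Proof.
  intros P [eps H]; exists eps; intros y Hy; apply H; split; [|exact Hy].
  change (Rabs (0 - 0) < eps); rewrite Rminus_0_r, Rabs_R0; apply cond_pos.
Qed.

(** Perturb the plot along [X] and restrict the partial derivative to the
    parameters where the displacement is 0. *)
Lemma hessian_smooth (F : bisequence -> C) {n : nat} (U : Rn n -> Prop)
    (c X : Rn n -> bisequence) :
  functional F -> plot U c -> smooth_bisequence U X ->
  smooth_bisequence U (fun x => hessian F (c x) (X x)) /\
  forall x, U x -> forall k,
    is_derive_C
      (fun t : R => fst (functional_derivative F (translate (c x) t (X x)) k)) 0
      (fst (hessian F (c x) (X x) k)) /\
    is_derive_C
      (fun t : R => snd (functional_derivative F (translate (c x) t (X x)) k)) 0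
      (snd (hessian F (c x) (X x) k)).
Proof.
  intros HF Hc HX.
  assert (HP := plot_perturb U c X Hc HX).
  assert (HS := functional_derivative_smooth F HF _ _ _ HP).
  set (U' := fun z => U (tail z) /\ phase (perturb c X z)) in *.
  assert (HU : open U) by apply Hc.
  assert (HU' : open U') by apply HP.
  assert (HA : forall x, U x -> U' (consR 0 x)).
  { intros x Hx; split; [exact Hx|]; rewrite perturb_consR, translate_0; apply Hc, Hx. }
  apply smooth_components in HS; destruct HS as [S1 S2].
  assert (key : forall pr : C * C -> C,
    smooth weight U' (fun z k => pr (functional_derivative F (perturb c X z) k)) ->
    exists g : Rn n -> Z -> C, smooth weight U g /\ forall x, U x -> forall k,
      is_derive_C
        (fun t : R => pr (functional_derivative F (translate (c x) t (X x)) k)) 0 (g x k)).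
  { intros pr Hpr.
    destruct (smooth_derivative_ex weight U' _ (consR 1 zero) HU' Hpr) as [g [Sg Dg]].
    exists (fun x => g (consR 0 x)); split.
    - apply (smooth_affine weight (consR 0) (consR 0) U'); trivial.
      + apply consR_affine.
      + apply consR_continuous.
    - intros x Hx k; eapply is_derive_ext; [|apply (Dg (consR 0 x) (HA x Hx) k)].
      intros t; cbv beta; rewrite perturb_line; do 4 f_equal.
      change (0 + t = t); ring. }
  destruct (key fst S1) as [g1 [Sg1 Dg1]], (key snd S2) as [g2 [Sg2 Dg2]].
  assert (E1 : forall x, U x -> forall k, g1 x k = fst (hessian F (c x) (X x) k)).
  { intros x Hx k; symmetry; apply is_derive_Derive, Dg1, Hx. }
  assert (E2 : forall x, U x -> forall k, g2 x k = snd (hessian F (c x) (X x) k)).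
  { intros x Hx k; symmetry; apply is_derive_Derive, Dg2, Hx. }
  split.
  - apply smooth_components; split;
      [apply (smooth_ext weight U g1)|apply (smooth_ext weight U g2)]; trivial.
  - intros x Hx k; rewrite <- E1, <- E2 by exact Hx; split; [apply Dg1|apply Dg2]; exact Hx.
Qed.

(** Schwarz for [F] along the two-parameter family [c (x + t v) + s w]. Its
    derivative in [s] is the pairing of the functional derivative with [w], and
    differentiating that in [t] gives the left-hand side; its derivative in [t]
    is the pairing with the velocity of the plot, which does not depend on [s].
    In particular the derivative of the functional derivative along a plot
    depends on the velocity [h] only, and linearly. *)
Lemma hessian_symmetric (F : bisequence -> C) {n : nat} (U : Rn n -> Prop)
    (c : Rn n -> bisequence) (x v : Rn n) (h w f' : bisequence) :
  functional F -> plot U c -> U x -> tangent w ->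
  bisequence_derivative c x v h ->
  bisequence_derivative (fun y => functional_derivative F (c y)) x v f' ->
  duality f' w = duality (hessian F (c x) w) h.
Proof.
  intros HF Hc Hx Hw Dh Df.
  set (c1 := fun t : Rn 0 => c (plus x (scal (t : R) v))).
  assert (P1 : plot (fun t : Rn 0 => U (plus x (scal (t : R) v))) c1).
  { apply (plot_affine (n := 0) (fun t : R => plus x (scal t v)) (fun t : R => scal t v)); trivial.
    - intros s r t.
      change (plus x (scal (s + t * r) v) = plus (plus x (scal s v)) (scal t (scal r v))).
      transitivity (plus (plus x (scal s v)) (scal (t * r) v)).
      + symmetry; apply line_line.
      + f_equal; symmetry; exact (scal_assoc t r v).
    - intros t; apply line_continuous. }
  set (U1 := fun t : Rn 0 => U (plus x (scal (t : R) v))) in *.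
  assert (HU1 : open U1) by apply P1.
  assert (Cx : c1 (0 : R) = c x) by (unfold c1; rewrite line_0; reflexivity).
  assert (HU10 : U1 (0 : R)) by (unfold U1; rewrite line_0; exact Hx).
  assert (Sw : smooth_bisequence U1 (fun _ : Rn 0 => w)) by apply smooth_bisequence_const, Hw.
  assert (P2 := plot_perturb U1 c1 (fun _ => w) P1 Sw).
  set (Q := perturb c1 (fun _ => w)) in *.
  set (U2 := fun z => U1 (tail z) /\ phase (Q z)) in *.
  assert (HU2 : open U2) by apply P2.
  assert (Q0 : Q (point2 0 0) = c x).
  { unfold Q; change (point2 0 0) with (consR 0 (0 : Rn 0)).
    rewrite perturb_consR, translate_0; exact Cx. }
  assert (HU20 : U2 (point2 0 0)).
  { split; [exact HU10|]; rewrite Q0; apply Hc, Hx. }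
  destruct (proj1 (smooth_components U1 c1) (proj1 (proj2 P1))) as [Sq Sr].
  destruct (smooth_derivative_ex weight U1 _ (1 : R) HU1 Sq) as [hq [Shq Dhq]].
  destruct (smooth_derivative_ex weight U1 _ (1 : R) HU1 Sr) as [hr [Shr Dhr]].
  set (h1 := fun t : Rn 0 => (fun k => (hq t k, hr t k)) : bisequence).
  assert (Dc1 : forall t, U1 t -> bisequence_derivative c1 t (1 : R) (h1 t)).
  { intros t Ht; apply derivative_components; split; [apply Dhq|apply Dhr]; exact Ht. }
  assert (H1 : h1 (0 : R) = h).
  { apply functional_extensionality; intros k.
    apply derivative_components in Dh; destruct Dh as [Dh1 Dh2].
    assert (L : forall t : R, plus (0 : Rn 0) (scal t (1 : Rn 0)) = t).
    { intros t; change (0 + t * 1 = t); ring. }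
    rewrite (surjective_pairing (h k)); unfold h1; f_equal.
    - apply (is_derive_C_unique (fun t : R => fst (c (plus x (scal t v)) k)) 0); [|apply Dh1].
      eapply is_derive_ext; [|apply (Dhq (0 : R) HU10 k)].
      intros t; cbv beta; rewrite L; reflexivity.
    - apply (is_derive_C_unique (fun t : R => snd (c (plus x (scal t v)) k)) 0); [|apply Dh2].
      eapply is_derive_ext; [|apply (Dhr (0 : R) HU10 k)].
      intros t; cbv beta; rewrite L; reflexivity. }
  assert (DQ1 : forall z, U2 z ->
    bisequence_derivative Q z (point2 1 0) w).
  { intros z Hz; apply (perturb_derivative c1 (fun _ => w)). }
  assert (L2 : forall (z : Rn 1) (t : R), Q (plus z (scal t (point2 0 1)))
    = translate (c1 (plus (tail z) (scal t (1 : Rn 0)))) (coordinate z) w).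
  { intros z t; unfold Q, perturb; f_equal; change (coordinate z + t * 0 = coordinate z); ring. }
  assert (DQ2 : forall z, U2 z ->
    bisequence_derivative Q z (point2 0 1) (h1 (tail z))).
  { intros z [Hz _].
    assert (K : forall (g : R -> C) (a l : C), is_derive_C g 0 l ->
              is_derive_C (fun t => g t + a)%C 0 l).
    { intros g a l Hg.
      assert (E := is_derive_plus (V := C_R_NormedModule) _ _ 0 _ _ Hg
        (is_derive_const (V := C_R_NormedModule) a 0)).
      rewrite plus_zero_r in E; exact E. }
    apply derivative_components; split; intros k.
    - apply (is_derive_ext (V := C_R_NormedModule) (fun t : R =>
        fst (c1 (plus (tail z) (scal t (1 : Rn 0))) k) + RtoC (coordinate z) * fst (w k))%C).
      + intros t; rewrite L2; reflexivity.
      + apply K, (Dhq (tail z) Hz k).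
    - apply (is_derive_ext (V := C_R_NormedModule) (fun t : R =>
        snd (c1 (plus (tail z) (scal t (1 : Rn 0))) k) + RtoC (coordinate z) * snd (w k))%C).
      + intros t; rewrite L2; reflexivity.
      + apply K, (Dhr (tail z) Hz k). }
  assert (SF := functional_derivative_smooth F HF _ _ _ P2).
  assert (E2 : bisequence_derivative
    (fun z => functional_derivative F (Q z)) (point2 0 0) (point2 0 1) f').
  { intros k; eapply is_derive_ext; [|apply (Df k)].
    intros t; cbv beta; rewrite L2; do 2 f_equal.
    change (coordinate (point2 0 0)) with 0; rewrite translate_0; unfold c1; do 3 f_equal.
    change ((t : R) = 0 + t * 1); exact (eq_sym (eq_trans (Rplus_0_l _) (Rmult_1_r t))). }
  destruct (hessian_smooth F U c (fun _ => w) HF Hc (smooth_bisequence_const U w Hw))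
    as [_ Dhess].
  assert (E1 : bisequence_derivative
    (fun z => functional_derivative F (Q z)) (point2 0 0) (point2 1 0) (hessian F (c x) w)).
  { assert (L : forall t : R, Q (plus (point2 0 0) (scal t (point2 1 0))) = translate (c x) t w).
    { intros t; unfold Q; rewrite <- Cx; change (point2 1 0) with (consR 1 (zero : Rn 0)).
      rewrite perturb_line; f_equal; change (0 + t = t); ring. }
    apply derivative_components; split; intros k;
      (eapply is_derive_ext; [|apply (Dhess x Hx k)]);
      intros t; cbv beta; rewrite L; reflexivity. }
  assert (SH1 : smooth_bisequence U2 (fun z => h1 (tail z))).
  { apply smooth_components; split; intros m;
      (apply (Ck_restrict weight (fun z => U1 (tail z))); [intros z [Hz _]; exact Hz|]).
    - apply (smooth_tail weight U1 hq), Shq.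
    - apply (smooth_tail weight U1 hr), Shr. }
  assert (Sw2 : smooth_bisequence U2 (fun _ => w)) by apply smooth_bisequence_const, Hw.
  assert (K0 : forall (n : nat) (z v : Rn n) (b : bisequence),
    bisequence_derivative (fun _ => b) z v (fun _ => (RtoC 0, RtoC 0))).
  { intros n0 z v0 b k; exact (is_derive_const (V := C2_NormedModule) (b k) 0). }
  assert (Dh1 : bisequence_derivative (fun z => h1 (tail z))
    (point2 0 0) (point2 1 0) (fun _ => (RtoC 0, RtoC 0))).
  { intros k; eapply is_derive_ext; [|apply (K0 1%nat (point2 0 0) (point2 1 0) (h1 (0 : R)) k)].
    intros t; cbv beta; f_equal; change (0 = 0 + t * 0);
    exact (eq_sym (eq_trans (Rplus_0_l _) (Rmult_0_r t))). }
  assert (M2 := duality_derivative U2 _ _ _ _ _ _ HU2 HU20 SF Sw2 E2 (K0 1%nat _ _ w)).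
  assert (M1 := duality_derivative U2 _ _ _ _ _ _ HU2 HU20 SF SH1 E1 Dh1).
  assert (Z0 : forall b, duality b (fun _ => (RtoC 0, RtoC 0)) = 0%C).
  { intros b; transitivity (sumZ (fun _ => 0%C)); [|exact sumZ_zero].
    apply sumZ_ext; intros k; cbn [fst snd]; ring. }
  assert (V := functional_represents F HF).
  assert (S := schwarz_family U2 (fun z _ => F (Q z))
    (fun z _ => duality (functional_derivative F (Q z)) w)
    (fun z _ => duality (functional_derivative F (Q z)) (h1 (tail z)))
    (fun _ _ => duality f' w + duality (functional_derivative F (Q (point2 0 0)))
                  (fun _ => (RtoC 0, RtoC 0)))%C
    (fun _ _ => duality (hessian F (c x) w) (h1 (tail (point2 0 0))) +
                duality (functional_derivative F (Q (point2 0 0)))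
                  (fun _ => (RtoC 0, RtoC 0)))%C
    HU2 HU20 (functional_smooth F HF _ _ _ P2)
    (fun z Hz _ => V _ _ _ z (point2 1 0) w P2 Hz (DQ1 z Hz))
    (fun z Hz _ => V _ _ _ z (point2 0 1) (h1 (tail z)) P2 Hz (DQ2 z Hz)) M2 M1).
  cbv beta in S; rewrite !Z0 in S.
  change (tail (point2 0 0)) with (0 : R) in S; rewrite H1 in S.
  transitivity (duality f' w + 0)%C; [ring|]; rewrite S; ring.
Qed.

(** * Fields of sequences with a transposable derivative *)

Definition smooth_field (a : nat -> Z -> R) (f : bisequence -> Z -> C) : Prop :=
  forall (n : nat) (U : Rn n -> Prop) (c : Rn n -> bisequence),
    plot U c -> smooth a U (fun x => f (c x)).

Definition smooth_covector (b : bisequence -> bisequence) : Prop :=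
  forall (n : nat) (U : Rn n -> Prop) (c : Rn n -> bisequence),
    plot U c -> smooth_bisequence U (fun x => b (c x)).

(** The weak form of the equation between [b] and the transposed derivative of
    [f] applied to [l]. *)
Definition transposed (f l : bisequence -> Z -> C) (b : bisequence -> bisequence) : Prop :=
  forall (n : nat) (U : Rn n -> Prop) (c : Rn n -> bisequence) (x v : Rn n)
    (h : bisequence) (f' : Z -> C),
    plot U c -> U x -> bisequence_derivative c x v h ->
    derivative_along (fun y => f (c y)) x v f' ->
    sumZ (fun k => l (c x) k * f' k)%C = duality (b (c x)) h.

(** The values have finite seminorms for the weights [a], and the test fields for
    the weights [t]. Membership gives the representation of first variations
    without a formula for the representing covectors. *)
Record transposable (a t : nat -> Z -> R) (f : bisequence -> Z -> C) : Prop := {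
  values_smooth : smooth_field a f;
  transpose_ex : forall l, smooth_field t l ->
    exists b, smooth_covector b /\ transposed f l b
}.

(** Local fields decay, like q, r and the functional derivatives. Coefficients,
    such as denominators and tails, are only bounded. Densities, such as products
    of two local fields, decay and can be tested with bounded sequences, hence
    with constants: their sums are functionals. *)
Notation local_field := (transposable weight weight).
Notation coefficient := (transposable flat weight).
Notation density := (transposable weight flat).

Definition admissible (w : nat -> Z -> R) : Prop :=
  forall N k, 1 <= w N k.

(** Derivatives of values and test sequences then have absolutely convergent
    pairings. *)
Definition summable_pair (a t : nat -> Z -> R) : Prop :=
  forall f g, tame a f -> tame t g -> rapid (fun k => f k * g k)%C.

Lemma summable_pair_weight_l (t : nat -> Z -> R) : admissible t -> summable_pair weight t.
Proof.
  intros Ht f g Hf Hg; apply rapid_mult_flat; [exact Hf|].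
  intros N; destruct (Hg O) as [M HM]; exists M; intros k; specialize (HM k).
  unfold flat; generalize (Ht O k) (Cmod_ge_0 (g k)); nra.
Qed.

Lemma summable_pair_sym (a t : nat -> Z -> R) : summable_pair a t -> summable_pair t a.
Proof.
  intros H f g Hf Hg; apply (rapid_ext (fun k => g k * f k)%C); [intros; ring|].
  apply H; assumption.
Qed.

Lemma derivative_ex {a : nat -> Z -> R} {f : bisequence -> Z -> C} {n : nat}
    {U : Rn n -> Prop} {c : Rn n -> bisequence} (x v : Rn n) :
  smooth_field a f -> plot U c -> U x ->
  exists f', tame a f' /\ derivative_along (fun y => f (c y)) x v f'.
Proof.
  intros Hf Hc Hx.
  destruct (smooth_derivative_ex a U _ v (proj1 Hc) (Hf n U c Hc)) as [g [Sg Dg]].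
  exists (g x); split; [apply (smooth_tame a U g x Sg Hx)|apply Dg, Hx].
Qed.

Lemma value_tame {a : nat -> Z -> R} {f : bisequence -> Z -> C} {n : nat}
    {U : Rn n -> Prop} {c : Rn n -> bisequence} (x : Rn n) :
  smooth_field a f -> plot U c -> U x -> tame a (f (c x)).
Proof. intros Hf Hc Hx; exact (smooth_tame a U _ x (Hf n U c Hc) Hx). Qed.

Lemma smooth_field_q : smooth_field weight (fun p k => fst (p k)).
Proof. intros n U c Hc; apply (proj1 (smooth_components U c)), Hc. Qed.

Lemma smooth_field_r : smooth_field weight (fun p k => snd (p k)).
Proof. intros n U c Hc; apply (proj1 (smooth_components U c)), Hc. Qed.

Lemma plot_derivative_tangent {n : nat} {U : Rn n -> Prop} {c : Rn n -> bisequence}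
    (x v : Rn n) (h : bisequence) :
  plot U c -> U x -> bisequence_derivative c x v h -> tangent h.
Proof.
  intros Hc Hx D; apply derivative_components in D; destruct D as [D1 D2].
  split; [exact (smooth_derivative_tame _ U _ x v _ (proj1 Hc) Hx (smooth_field_q n U c Hc) D1)
         |exact (smooth_derivative_tame _ U _ x v _ (proj1 Hc) Hx (smooth_field_r n U c Hc) D2)].
Qed.

Lemma covector_tangent {b : bisequence -> bisequence} {n : nat} {U : Rn n -> Prop}
    {c : Rn n -> bisequence} (x : Rn n) :
  smooth_covector b -> plot U c -> U x -> tangent (b (c x)).
Proof.
  intros Hb Hc Hx.
  apply (smooth_value_tangent U (fun x => b (c x))); [apply Hb, Hc|exact Hx].
Qed.

Lemma rapid_duality_term (b h : bisequence) : tangent b -> tangent h ->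
  rapid (fun k => fst (b k) * fst (h k) + snd (b k) * snd (h k))%C.
Proof. intros [] []; apply rapid_plus; apply rapid_mult; assumption. Qed.

Definition covector_plus (b b' : bisequence -> bisequence) (p : bisequence) : bisequence :=
  fun k => (fst (b p k) + fst (b' p k), snd (b p k) + snd (b' p k))%C.

Lemma covector_plus_smooth (b b' : bisequence -> bisequence) :
  smooth_covector b -> smooth_covector b' -> smooth_covector (covector_plus b b').
Proof.
  intros Hb Hb' n U c Hc.
  destruct (proj1 (smooth_components _ _) (Hb n U c Hc)) as [A1 A2].
  destruct (proj1 (smooth_components _ _) (Hb' n U c Hc)) as [B1 B2].
  apply smooth_components; split;
    [apply (smooth_plus weight U _ _ weight_ge_1 A1 B1)
    |apply (smooth_plus weight U _ _ weight_ge_1 A2 B2)].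
Qed.

Lemma duality_covector_plus (b b' : bisequence -> bisequence) (p h : bisequence) :
  tangent (b p) -> tangent (b' p) -> tangent h ->
  duality (covector_plus b b' p) h = (duality (b p) h + duality (b' p) h)%C.
Proof.
  intros H H' Hh; unfold duality; rewrite <- sumZ_plus by (apply rapid_duality_term; assumption).
  apply sumZ_ext; intros k; simpl; ring.
Qed.

(** ** Basic fields *)

Lemma smooth_field_tame_const (a : nat -> Z -> R) (f : Z -> C) :
  tame a f -> smooth_field a (fun _ => f).
Proof. intros Hf n U c _; apply smooth_const, Hf. Qed.

Lemma field_const (a t : nat -> Z -> R) (f : Z -> C) : tame a f -> transposable a t (fun _ => f).
Proof.
  intros Hf; split; [apply smooth_field_tame_const, Hf|].
  intros l _; exists (fun _ _ => (RtoC 0, RtoC 0)); split.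
  - intros n U c _; apply smooth_bisequence_const; split; apply (tame_zero weight).
  - intros n U c x v h f' _ _ _ D.
    assert (E := derivative_along_unique _ _ _ _ _ D (derivative_along_const f x v)).
    apply sumZ_ext; intros k; rewrite E; cbn [fst snd]; ring.
Qed.

Lemma local_field_q : local_field (fun p k => fst (p k)).
Proof.
  split; [exact smooth_field_q|]; intros l Hl.
  exists (fun p k => (l p k, RtoC 0)); split.
  - intros n U c Hc; apply smooth_components; split.
    + apply Hl, Hc.
    + apply (smooth_const weight U (fun _ => RtoC 0)), tame_zero.
  - intros n U c x v h f' _ _ D D'; apply derivative_components in D.
    assert (E := derivative_along_unique _ _ _ _ _ D' (proj1 D)).
    apply sumZ_ext; intros k; rewrite E; cbn [fst snd]; ring.
Qed.

Lemma local_field_r : local_field (fun p k => snd (p k)).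
Proof.
  split; [exact smooth_field_r|]; intros l Hl.
  exists (fun p k => (RtoC 0, l p k)); split.
  - intros n U c Hc; apply smooth_components; split.
    + apply (smooth_const weight U (fun _ => RtoC 0)), tame_zero.
    + apply Hl, Hc.
  - intros n U c x v h f' _ _ D D'; apply derivative_components in D.
    assert (E := derivative_along_unique _ _ _ _ _ D' (proj2 D)).
    apply sumZ_ext; intros k; rewrite E; cbn [fst snd]; ring.
Qed.

Lemma functional_derivative_transpose (F : bisequence -> C)
    (X : bisequence -> bisequence) :
  functional F -> smooth_covector X ->
  smooth_covector (fun p => hessian F p (X p)) /\
  forall (n : nat) (U : Rn n -> Prop) (c : Rn n -> bisequence) (x v : Rn n)
    (h f' : bisequence),
    plot U c -> U x -> bisequence_derivative c x v h ->
    bisequence_derivative (fun y => functional_derivative F (c y)) x v f' ->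
    duality f' (X (c x)) = duality (hessian F (c x) (X (c x))) h.
Proof.
  intros HF HX; split.
  - intros n U c Hc; apply (hessian_smooth F U c (fun x => X (c x)) HF Hc), HX, Hc.
  - intros n U c x v h f' Hc Hx D D'.
    apply (hessian_symmetric F U c x v); trivial.
    apply (covector_tangent x HX Hc Hx).
Qed.

(** The transpose of the derivative of the functional derivative is that
    derivative itself, by symmetry. *)
Lemma local_field_derivative (F : bisequence -> C) (b : bool) :
  functional F ->
  local_field (fun p k => (if b then fst else snd) (functional_derivative F p k)).
Proof.
  intros HF.
  assert (S : forall b : bool, smooth_field weight
    (fun p k => (if b then fst else snd) (functional_derivative F p k))).
  { intros b' n U c Hc.
    destruct (proj1 (smooth_components _ _) (functional_derivative_smooth F HF n U c Hc)).
    destruct b'; assumption. }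
  split; [exact (S b)|]; intros l Hl.
  assert (SX : smooth_covector (fun p k => if b then (l p k, RtoC 0) else (RtoC 0, l p k))).
  { assert (Z0 : forall (n : nat) (U : Rn n -> Prop), smooth weight U (fun _ _ => RtoC 0))
      by (intros; apply (smooth_const weight U (fun _ => RtoC 0)), tame_zero).
    intros n U c Hc; apply smooth_components; destruct b; split; trivial; apply Hl, Hc. }
  destruct (functional_derivative_transpose F _ HF SX) as [Sb Tb].
  eexists; split; [exact Sb|].
  intros n U c x v h f' Hc Hx D D'.
  destruct (derivative_ex x v (S true) Hc Hx) as [f1 [_ D1]].
  destruct (derivative_ex x v (S false) Hc Hx) as [f2 [_ D2]].
  rewrite <- (Tb n U c x v h (fun k => (f1 k, f2 k)) Hc Hx D
    (proj2 (derivative_components (fun y => functional_derivative F (c y)) x v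
      (fun k => (f1 k, f2 k))) (conj D1 D2))).
  apply sumZ_ext; intros k.
  destruct b; cbn [fst snd]; [rewrite (derivative_along_unique _ _ _ _ _ D' D1)
                             |rewrite (derivative_along_unique _ _ _ _ _ D' D2)]; ring.
Qed.

(** ** Closure properties *)

Lemma smooth_field_plus (a : nat -> Z -> R) (f g : bisequence -> Z -> C) : admissible a ->
  smooth_field a f -> smooth_field a g -> smooth_field a (fun p k => f p k + g p k)%C.
Proof.
  intros Ha Hf Hg n U c Hc.
  apply (smooth_plus a U _ _ Ha (Hf n U c Hc) (Hg n U c Hc)).
Qed.

Lemma field_plus (a t : nat -> Z -> R) (f g : bisequence -> Z -> C) :
  admissible a -> summable_pair t a -> transposable a t f -> transposable a t g ->
  transposable a t (fun p k => f p k + g p k)%C.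
Proof.
  intros Ha Hat [Sf Tf] [Sg Tg]; split; [apply smooth_field_plus; assumption|].
  intros l Hl; destruct (Tf l Hl) as [b [Sb Eb]], (Tg l Hl) as [b' [Sb' Eb']].
  exists (covector_plus b b'); split; [apply covector_plus_smooth; assumption|].
  intros n U c x v h f' Hc Hx D D'.
  destruct (derivative_ex x v Sf Hc Hx) as [df [Td Dd]].
  destruct (derivative_ex x v Sg Hc Hx) as [dg [Te De]].
  assert (E := derivative_along_unique _ _ _ _ _ D' (derivative_along_plus _ _ x v _ _ Dd De)).
  assert (Tl := value_tame x Hl Hc Hx).
  rewrite duality_covector_plus.
  - rewrite <- (Eb n U c x v h df Hc Hx D Dd), <- (Eb' n U c x v h dg Hc Hx D De).
    rewrite <- sumZ_plus by (apply Hat; assumption).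
    apply sumZ_ext; intros k; rewrite E; ring.
  - apply (covector_tangent x Sb Hc Hx).
  - apply (covector_tangent x Sb' Hc Hx).
  - apply (plot_derivative_tangent x v h Hc Hx D).
Qed.

(** Domination of weights under which pointwise products are continuous. *)
Definition dominated (w1 w2 w : nat -> Z -> R) : Prop :=
  forall N k, w N k <= w1 N k * w2 N k.

Lemma smooth_field_mult (w1 w2 w : nat -> Z -> R) (f g : bisequence -> Z -> C) :
  admissible w1 -> admissible w2 -> admissible w -> dominated w1 w2 w ->
  smooth_field w1 f -> smooth_field w2 g -> smooth_field w (fun p k => f p k * g p k)%C.
Proof.
  intros H1 H2 H Hd Hf Hg n U c Hc.
  apply (smooth_bilinear H1 H2 H (bounded_product w1 w2 w H1 H2 Hd) U _ _ (proj1 Hc)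
    (Hf n U c Hc) (Hg n U c Hc)).
Qed.

(** The transpose of a product: each factor multiplies the test field of the
    other, whence the conditions on the weights. *)
Lemma field_mult (a1 t1 a2 t2 a t : nat -> Z -> R) (f g : bisequence -> Z -> C) :
  admissible a1 -> admissible t1 -> admissible a2 -> admissible t2 ->
  admissible a -> admissible t ->
  dominated a1 a2 a -> dominated t a2 t1 -> dominated t a1 t2 ->
  summable_pair t1 a1 -> summable_pair t2 a2 ->
  transposable a1 t1 f -> transposable a2 t2 g -> transposable a t (fun p k => f p k * g p k)%C.
Proof.
  intros A1 T1 A2 T2 A T Ha Ht1 Ht2 P1 P2 [Sf Tf] [Sg Tg].
  split; [apply (smooth_field_mult a1 a2 a); assumption|].
  intros l Hl.
  assert (L1 := smooth_field_mult t a2 t1 _ _ T A2 T1 Ht1 Hl Sg).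
  assert (L2 := smooth_field_mult t a1 t2 _ _ T A1 T2 Ht2 Hl Sf).
  destruct (Tf _ L1) as [b [Sb Eb]], (Tg _ L2) as [b' [Sb' Eb']].
  exists (covector_plus b b'); split; [apply covector_plus_smooth; assumption|].
  intros n U c x v h f' Hc Hx D D'.
  destruct (derivative_ex x v Sf Hc Hx) as [df [Td Dd]].
  destruct (derivative_ex x v Sg Hc Hx) as [dg [Te De]].
  assert (E := derivative_along_unique _ _ _ _ _ D'
    (smooth_bilinear_derivative A1 A2 A (bounded_product a1 a2 a A1 A2 Ha) U _ _ x v _ _
      (proj1 Hc) Hx (Sf n U c Hc) (Sg n U c Hc) Dd De)).
  rewrite duality_covector_plus.
  - rewrite <- (Eb n U c x v h df Hc Hx D Dd), <- (Eb' n U c x v h dg Hc Hx D De).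
    rewrite <- sumZ_plus.
    + apply sumZ_ext; intros k; rewrite E; ring.
    + apply P1; [apply (value_tame x L1 Hc Hx)|exact Td].
    + apply P2; [apply (value_tame x L2 Hc Hx)|exact Te].
  - apply (covector_tangent x Sb Hc Hx).
  - apply (covector_tangent x Sb' Hc Hx).
  - apply (plot_derivative_tangent x v h Hc Hx D).
Qed.

Lemma admissible_weight : admissible weight.
Proof. exact weight_ge_1. Qed.

Lemma admissible_flat : admissible flat.
Proof. exact flat_ge_1. Qed.

Lemma dominated_l (w1 w2 : nat -> Z -> R) :
  admissible w1 -> admissible w2 -> dominated w1 w2 w1.
Proof. intros H1 H2 N k; generalize (H1 N k) (H2 N k); nra. Qed.

Lemma dominated_r (w1 w2 : nat -> Z -> R) :
  admissible w1 -> admissible w2 -> dominated w1 w2 w2.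
Proof. intros H1 H2 N k; generalize (H1 N k) (H2 N k); nra. Qed.

Ltac weights :=
  solve [ exact admissible_weight | exact admissible_flat
        | apply dominated_l; weights | apply dominated_r; weights
        | apply summable_pair_weight_l; weights
        | apply summable_pair_sym, summable_pair_weight_l; weights ].

Lemma local_mult_local (f g : bisequence -> Z -> C) :
  local_field f -> local_field g -> density (fun p k => f p k * g p k)%C.
Proof. apply field_mult; weights. Qed.

Lemma coefficient_mult_local (f g : bisequence -> Z -> C) :
  coefficient f -> local_field g -> local_field (fun p k => f p k * g p k)%C.
Proof. apply field_mult; weights. Qed.

Lemma coefficient_mult_density (f g : bisequence -> Z -> C) :
  coefficient f -> density g -> density (fun p k => f p k * g p k)%C.
Proof. apply field_mult; weights. Qed.

Lemma coefficient_mult (f g : bisequence -> Z -> C) :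
  coefficient f -> coefficient g -> coefficient (fun p k => f p k * g p k)%C.
Proof. apply field_mult; weights. Qed.

Lemma smooth_field_weaken (f : bisequence -> Z -> C) :
  smooth_field weight f -> smooth_field flat f.
Proof. intros Hf n U c Hc; apply (flat_weaken U (proj1 Hc)), Hf, Hc. Qed.

Lemma local_coefficient (f : bisequence -> Z -> C) : local_field f -> coefficient f.
Proof. intros [S T]; split; [apply smooth_field_weaken, S|exact T]. Qed.

Lemma field_ext (a t : nat -> Z -> R) (f g : bisequence -> Z -> C) :
  (forall p k, f p k = g p k) -> transposable a t f -> transposable a t g.
Proof.
  intros H; replace g with f; [exact (fun h => h)|].
  apply functional_extensionality; intros p; apply functional_extensionality, H.
Qed.

Lemma coefficient_const (c : C) : coefficient (fun _ _ => c).
Proof. apply field_const, tame_flat_const. Qed.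

Lemma local_plus (f g : bisequence -> Z -> C) :
  local_field f -> local_field g -> local_field (fun p k => f p k + g p k)%C.
Proof. apply field_plus; weights. Qed.

Lemma density_plus (f g : bisequence -> Z -> C) :
  density f -> density g -> density (fun p k => f p k + g p k)%C.
Proof. apply field_plus; weights. Qed.

Lemma coefficient_plus (f g : bisequence -> Z -> C) :
  coefficient f -> coefficient g -> coefficient (fun p k => f p k + g p k)%C.
Proof. apply field_plus; weights. Qed.

Lemma local_opp (f : bisequence -> Z -> C) :
  local_field f -> local_field (fun p k => - f p k)%C.
Proof.
  intros Hf; apply (field_ext _ _ (fun p k => RtoC (-1) * f p k)%C); [intros; ring|].
  apply (coefficient_mult_local (fun _ _ => RtoC (-1))); [apply coefficient_const|exact Hf].
Qed.

Lemma density_opp (f : bisequence -> Z -> C) :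
  density f -> density (fun p k => - f p k)%C.
Proof.
  intros Hf; apply (field_ext _ _ (fun p k => RtoC (-1) * f p k)%C); [intros; ring|].
  apply (coefficient_mult_density (fun _ _ => RtoC (-1))); [apply coefficient_const|exact Hf].
Qed.

Lemma coefficient_opp (f : bisequence -> Z -> C) :
  coefficient f -> coefficient (fun p k => - f p k)%C.
Proof.
  intros Hf; apply (field_ext _ _ (fun p k => RtoC (-1) * f p k)%C); [intros; ring|].
  apply (coefficient_mult (fun _ _ => RtoC (-1))); [apply coefficient_const|exact Hf].
Qed.

Lemma bounded_shift_flat (m : Z) : bounded_linear flat flat (fun f k => f (k + m)%Z).
Proof.
  split; intros; trivial.
  exists N, 1; split; [lra|]; intros f A _ HA Hf k; rewrite (Rmult_1_l A); exact (Hf (k + m)%Z).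
Qed.

Lemma field_shift (t : nat -> Z -> R) (m : Z) (f : bisequence -> Z -> C) :
  admissible t -> (forall m, bounded_linear t t (fun f k => f (k + m)%Z)) ->
  transposable weight t f -> transposable weight t (fun p k => f p (k + m)%Z).
Proof.
  intros Ht Hm [S T]; split.
  - intros n U c Hc; apply (smooth_linear weight_ge_1 weight_ge_1 (bounded_shift m) U
      (fun x => f (c x)) (proj1 Hc)), S, Hc.
  - intros l Hl.
    assert (Hl' : smooth_field t (fun p k => l p (k + - m)%Z)).
    { intros n U c Hc; apply (smooth_linear Ht Ht (Hm (- m)%Z) U
        (fun x => l (c x)) (proj1 Hc)), Hl, Hc. }
    destruct (T _ Hl') as [b [Sb Eb]]; exists b; split; [exact Sb|].
    intros n U c x v h f' Hc Hx D D'.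
    destruct (derivative_ex x v S Hc Hx) as [df [Td Dd]].
    assert (E := derivative_along_unique _ _ _ _ _ D'
      (smooth_linear_derivative weight_ge_1 weight_ge_1 (bounded_shift m) U _ x v _ (proj1 Hc)
        Hx (S n U c Hc) Dd)).
    rewrite <- (Eb n U c x v h df Hc Hx D Dd).
    rewrite <- (sumZ_shift m (fun k => l (c x) (k + - m)%Z * df k)%C).
    + apply sumZ_ext; intros k; rewrite E.
      replace (k + m + - m)%Z with k by lia; reflexivity.
    + apply (summable_pair_sym _ _ (summable_pair_weight_l t Ht));
        [apply (value_tame x Hl' Hc Hx)|exact Td].
Qed.

Lemma local_shift (m : Z) (f : bisequence -> Z -> C) :
  local_field f -> local_field (fun p k => f p (k + m)%Z).
Proof. apply field_shift; [weights|exact bounded_shift]. Qed.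

Lemma density_shift (m : Z) (f : bisequence -> Z -> C) :
  density f -> density (fun p k => f p (k + m)%Z).
Proof. apply field_shift; [weights|exact bounded_shift_flat]. Qed.

Lemma smooth_field_sum_ge (f : bisequence -> Z -> C) :
  smooth_field weight f -> smooth_field flat (fun p k => sum_ge k (f p)).
Proof.
  intros S n U c Hc; apply (smooth_linear weight_ge_1 flat_ge_1 bounded_sum_ge U
    (fun x => f (c x)) (proj1 Hc)), S, Hc.
Qed.

Lemma smooth_field_sum_le (f : bisequence -> Z -> C) :
  smooth_field weight f -> smooth_field flat (fun p k => sum_le k (f p)).
Proof.
  intros S n U c Hc; apply (smooth_linear weight_ge_1 flat_ge_1 bounded_sum_le U
    (fun x => f (c x)) (proj1 Hc)), S, Hc.
Qed.

(** The transpose of the derivative of a right tail is applied to the left tail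
    of the test field, which is only bounded: hence densities as summands. *)
Lemma coefficient_sum_ge (f : bisequence -> Z -> C) :
  density f -> coefficient (fun p k => sum_ge k (f p)).
Proof.
  intros [S T]; split; [apply smooth_field_sum_ge, S|].
  intros l Hl; destruct (T _ (smooth_field_sum_le l Hl)) as [b [Sb Eb]].
  exists b; split; [exact Sb|]; intros n U c x v h f' Hc Hx D D'.
  destruct (derivative_ex x v S Hc Hx) as [df [Td Dd]].
  assert (E := derivative_along_unique _ _ _ _ _ D'
    (smooth_linear_derivative weight_ge_1 flat_ge_1 bounded_sum_ge U _ x v _ (proj1 Hc)
      Hx (S n U c Hc) Dd)).
  rewrite <- (Eb n U c x v h df Hc Hx D Dd).
  rewrite <- sumZ_tail_transpose; [|apply (value_tame x Hl Hc Hx)|exact Td].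
  apply sumZ_ext; intros k; rewrite E; reflexivity.
Qed.

Lemma coefficient_sum_le (f : bisequence -> Z -> C) :
  density f -> coefficient (fun p k => sum_le k (f p)).
Proof.
  intros [S T]; split; [apply smooth_field_sum_le, S|].
  intros l Hl; destruct (T _ (smooth_field_sum_ge l Hl)) as [b [Sb Eb]].
  exists b; split; [exact Sb|]; intros n U c x v h f' Hc Hx D D'.
  destruct (derivative_ex x v S Hc Hx) as [df [Td Dd]].
  assert (E := derivative_along_unique _ _ _ _ _ D'
    (smooth_linear_derivative weight_ge_1 flat_ge_1 bounded_sum_le U _ x v _ (proj1 Hc)
      Hx (S n U c Hc) Dd)).
  rewrite <- (Eb n U c x v h df Hc Hx D Dd).
  transitivity (sumZ (fun k => df k * sum_ge k (l (c x)))%C);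
    [rewrite sumZ_tail_transpose; [|exact Td|apply (value_tame x Hl Hc Hx)]|];
    apply sumZ_ext; intros k; rewrite ?E; ring.
Qed.

Lemma coefficient_inverse (f : bisequence -> Z -> C) :
  (forall p, phase p -> bounded_below (f p)) -> coefficient f ->
  coefficient (fun p k => / f p k)%C.
Proof.
  intros Hb [S T].
  assert (SI : smooth_field flat (fun p k => / f p k)%C).
  { intros n U c Hc; apply (smooth_inverse U (fun x => f (c x)) (proj1 Hc));
      [intros x Hx; apply Hb, Hc, Hx|apply S, Hc]. }
  split; [exact SI|]; intros l Hl.
  assert (Hl' : smooth_field weight (fun p k => l p k * (RtoC (-1) * (/ f p k * / f p k)))%C).
  { apply (smooth_field_mult weight flat weight); [weights..|exact Hl|].
    apply (smooth_field_mult flat flat flat); [weights..| |].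
    - apply smooth_field_tame_const, tame_flat_const.
    - apply (smooth_field_mult flat flat flat); [weights..|exact SI|exact SI]. }
  destruct (T _ Hl') as [b [Sb Eb]]; exists b; split; [exact Sb|].
  intros n U c x v h f' Hc Hx D D'.
  destruct (derivative_ex x v S Hc Hx) as [df [Td Dd]].
  rewrite <- (Eb n U c x v h df Hc Hx D Dd).
  apply sumZ_ext; intros k.
  destruct (Hb (c x)) as [delta Hd]; [apply Hc, Hx|].
  assert (E := is_derive_Cinv (fun t => f (c (plus x (scal t v))) k) (df k)).
  cbv beta in E; rewrite line_0 in E.
  rewrite (is_derive_C_unique _ _ _ _ (D' k)
    (E (bounded_below_neq _ _ k (cond_pos delta) (Hd k)) (Dd k))).
  ring.
Qed.

Lemma coefficient_sum_ge_shift (m : Z) (f : bisequence -> Z -> C) :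
  density f -> coefficient (fun p k => sum_ge (k + m) (f p)).
Proof.
  intros Hf; apply (field_ext _ _ (fun p k => sum_ge k (fun j => f p (j + m)%Z))).
  - intros p k; apply Csum_ext; intros j; f_equal; lia.
  - apply (coefficient_sum_ge (fun p j => f p (j + m)%Z)), density_shift, Hf.
Qed.

Lemma coefficient_sum_le_shift (m : Z) (f : bisequence -> Z -> C) :
  density f -> coefficient (fun p k => sum_le (k + m) (f p)).
Proof.
  intros Hf; apply (field_ext _ _ (fun p k => sum_le k (fun j => f p (j + m)%Z))).
  - intros p k; apply Csum_ext; intros j; f_equal; lia.
  - apply (coefficient_sum_le (fun p j => f p (j + m)%Z)), density_shift, Hf.
Qed.

(** ** Functionals that are sums of densities *)

(** Use the constant 1 as test field. *)
Lemma density_variation (f : bisequence -> Z -> C) : density f ->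
  exists b, smooth_covector b /\ represents_variation (fun p => sumZ (f p)) b.
Proof.
  intros [S T].
  destruct (T (fun _ _ => RtoC 1)) as [b [Sb Eb]];
    [apply smooth_field_tame_const, tame_flat_const|].
  exists b; split; [exact Sb|]; intros n U c x v h Hc Hx D.
  destruct (derivative_ex x v S Hc Hx) as [df [Td Dd]].
  rewrite <- (Eb n U c x v h df Hc Hx D Dd).
  replace (sumZ (fun k => RtoC 1 * df k)%C) with (sumZ df) by (apply sumZ_ext; intros; ring).
  exact (sumZ_derivative U (fun x => f (c x)) x v df (proj1 Hc) Hx (S n U c Hc) Dd tt).
Qed.

Lemma density_functional (f : bisequence -> Z -> C) :
  density f -> (forall p, phase p -> reduced p -> Im (sumZ (f p)) = 0) ->
  functional (fun p => sumZ (f p)).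
Proof.
  intros Hf HR; destruct (density_variation f Hf) as [b [Sb Vb]].
  split.
  - intros n U c Hc; apply (smooth_linear weight_ge_1 flat_ge_1 bounded_sumZ U
      (fun x => f (c x)) (proj1 Hc)), Hf, Hc.
  - intros n U c x v h Hc Hx D; unfold first_variation.
    rewrite (functional_derivative_eq _ b (c x) Vb); [|apply Hc, Hx].
    apply (Vb n U c x v h Hc Hx D).
  - intros n U c Hc; assert (H := Sb n U c Hc); apply smooth_components in H.
    apply smooth_components; destruct H as [H1 H2].
    split; [eapply (smooth_ext weight U); [apply Hc| |exact H1]
           |eapply (smooth_ext weight U); [apply Hc| |exact H2]];
      intros x Hx k; cbv beta; rewrite (functional_derivative_eq _ b (c x) Vb);
      trivial; apply Hc, Hx.
  - exact HR.
Qed.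

(** * The recursion operator as a field *)

Lemma local_mult_coefficient (f g : bisequence -> Z -> C) :
  local_field f -> coefficient g -> local_field (fun p k => f p k * g p k)%C.
Proof. apply field_mult; weights. Qed.

Lemma density_mult_coefficient (f g : bisequence -> Z -> C) :
  density f -> coefficient g -> density (fun p k => f p k * g p k)%C.
Proof. apply field_mult; weights. Qed.

(** Decomposes a formula into fields, along its syntax; the atoms are taken
    from the hypotheses. *)
Ltac prove_local :=
  first
    [ assumption
    | apply local_plus; [prove_local | prove_local]
    | apply local_opp; prove_local
    | apply coefficient_mult_local; [prove_coefficient | prove_local]
    | apply local_mult_coefficient; [prove_local | prove_coefficient] ]
with prove_coefficient :=
  first
    [ assumption
    | apply coefficient_const
    | apply coefficient_plus; [prove_coefficient | prove_coefficient]
    | apply coefficient_opp; prove_coefficient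
    | apply coefficient_mult; [prove_coefficient | prove_coefficient]
    | apply local_coefficient; prove_local ].

Ltac prove_density :=
  first
    [ assumption
    | apply density_plus; [prove_density | prove_density]
    | apply density_opp; prove_density
    | apply local_mult_local; [prove_local | prove_local]
    | apply density_mult_coefficient; [prove_density | prove_coefficient] ].

Definition local_vector (X : bisequence -> bisequence) : Prop :=
  local_field (fun p k => fst (X p k)) /\ local_field (fun p k => snd (X p k)).

Lemma coefficient_inverse_denominator :
  coefficient (fun p k => / (1 + - (snd (p k) * fst (p k))))%C.
Proof.
  assert (Hq := local_field_q); assert (Hr := local_field_r).
  apply (coefficient_inverse (fun p k => 1 + - (snd (p k) * fst (p k)))%C).
  - intros p Hp; exact (denominator_bounded_below p Hp).
  - prove_coefficient.
Qed.

Lemma coefficient_inverse_denominator' :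
  coefficient (fun p k => / (1 + - (fst (p k) * snd (p k))))%C.
Proof.
  apply (field_ext _ _ (fun p k => / (1 + - (snd (p k) * fst (p k))))%C).
  - intros p k; f_equal; ring.
  - exact coefficient_inverse_denominator.
Qed.

Ltac vector_atoms X HX :=
  let Hu := fresh "Hu" in let Hv := fresh "Hv" in
  let Hq := fresh "Hq" in let Hr := fresh "Hr" in
  destruct HX as [Hu Hv];
  assert (Hq := local_field_q); assert (Hr := local_field_r);
  assert (Hu1 := local_shift 1 _ Hu); assert (Hv1 := local_shift 1 _ Hv);
  assert (Hu2 := local_shift (-1) _ Hu); assert (Hv2 := local_shift (-1) _ Hv);
  assert (Hq1 := local_shift 1 _ Hq); assert (Hr1 := local_shift 1 _ Hr);
  assert (Hq2 := local_shift (-1) _ Hq); assert (Hr2 := local_shift (-1) _ Hr);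
  assert (Hd := coefficient_inverse_denominator).

Lemma density_s_term (X : bisequence -> bisequence) :
  local_vector X -> density (fun p => s_term p (X p)).
Proof.
  intros HX; vector_atoms X HX; unfold s_term, Cdiv, Cminus; prove_density.
Qed.

Lemma density_a_term (X : bisequence -> bisequence) :
  local_vector X -> density (fun p => a_term p (X p)).
Proof.
  intros HX; vector_atoms X HX; unfold a_term, Cminus; prove_density.
Qed.

Lemma density_b_term (X : bisequence -> bisequence) :
  local_vector X -> density (fun p => b_term p (X p)).
Proof.
  intros HX; vector_atoms X HX; unfold b_term, Cminus; prove_density.
Qed.

Lemma density_t_term (X : bisequence -> bisequence) :
  local_vector X -> density (fun p => t_term p (X p)).
Proof.
  intros HX; vector_atoms X HX; unfold t_term, Cminus; prove_density.
Qed.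

Lemma local_Lplus (X : bisequence -> bisequence) :
  local_vector X -> local_vector (fun p => Lplus p (X p)).
Proof.
  intros HX.
  assert (Hs := coefficient_sum_ge _ (density_s_term X HX)).
  assert (Hs1 := coefficient_sum_ge_shift 1 _ (density_s_term X HX)).
  assert (Ha := coefficient_sum_ge _ (density_a_term X HX)).
  assert (Ha1 := coefficient_sum_ge_shift 1 _ (density_a_term X HX)).
  assert (Hb := coefficient_sum_ge _ (density_b_term X HX)).
  assert (Hb1 := coefficient_sum_ge_shift 1 _ (density_b_term X HX)).
  vector_atoms X HX.
  split; unfold Lplus, L, Linv, Cminus; cbn [fst snd]; prove_local.
Qed.

Lemma local_Lminus (X : bisequence -> bisequence) :
  local_vector X -> local_vector (fun p => Lminus p (X p)).
Proof.
  intros HX.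
  assert (Hs := coefficient_sum_le _ (density_s_term X HX)).
  assert (Hs1 := coefficient_sum_le_shift (-1) _ (density_s_term X HX)).
  assert (Ht := coefficient_sum_le _ (density_t_term X HX)).
  vector_atoms X HX.
  split; unfold Lminus, Cminus; cbn [fst snd]; prove_local.
Qed.

Lemma local_rot (X : bisequence -> bisequence) :
  local_vector X -> local_vector (fun p => rot (X p)).
Proof. intros [Hu Hv]; split; unfold rot; cbn [fst snd]; prove_local. Qed.

Lemma local_rot_inv (X : bisequence -> bisequence) :
  local_vector X -> local_vector (fun p => rot_inv (X p)).
Proof. intros [Hu Hv]; split; unfold rot_inv; cbn [fst snd]; prove_local. Qed.

Lemma local_J (X : bisequence -> bisequence) :
  local_vector X -> local_vector (fun p => J (X p)).
Proof. intros [Hu Hv]; split; unfold J; cbn [fst snd]; prove_local. Qed.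

Definition Lsum (p w : bisequence) : bisequence := fun k =>
  (fst (Lplus p w k) + fst (Lminus p w k), snd (Lplus p w k) + snd (Lminus p w k))%C.

Lemma local_Lsum (X : bisequence -> bisequence) :
  local_vector X -> local_vector (fun p => Lsum p (X p)).
Proof.
  intros HX; destruct (local_Lplus X HX) as [A1 A2], (local_Lminus X HX) as [B1 B2].
  split; unfold Lsum; cbn [fst snd]; prove_local.
Qed.

Lemma KopE (p w : bisequence) : Kop p w = rot (Lsum p (rot_inv (J w))).
Proof. reflexivity. Qed.

Lemma local_Kop (X : bisequence -> bisequence) :
  local_vector X -> local_vector (fun p => Kop p (X p)).
Proof.
  intros HX.
  exact (local_rot _ (local_Lsum _ (local_rot_inv _ (local_J X HX)))).
Qed.

Lemma local_gradient (F : bisequence -> C) :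
  functional F -> local_vector (gradient F).
Proof.
  intros HF; assert (Hq := local_field_q); assert (Hr := local_field_r).
  assert (Fq := local_field_derivative F true HF).
  assert (Fr := local_field_derivative F false HF).
  split; unfold gradient, Cminus; cbn zeta; cbn [fst snd]; prove_local.
Qed.

Lemma density_pairing (X Y : bisequence -> bisequence) :
  local_vector X -> local_vector Y -> density (fun p => pairing_term p (X p) (Y p)).
Proof.
  intros [X1 X2] [Y1 Y2]; assert (Hd := coefficient_inverse_denominator').
  unfold pairing_term, Cdiv, Cminus; prove_density.
Qed.

Lemma field_value_rapid (t : nat -> Z -> R) (f : bisequence -> Z -> C) (p : bisequence) :
  transposable weight t f -> phase p -> rapid (f p).
Proof.
  intros Hf Hp.
  exact (value_tame (0 : Rn 0) (values_smooth _ _ _ Hf) (plot_const p Hp) Logic.I).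
Qed.

(** Constant fields give the statements on single tangent vectors as instances of
    the closure properties. *)
Lemma local_vector_const (w : bisequence) : tangent w -> local_vector (fun _ => w).
Proof.
  intros [H1 H2]; split; [apply (field_const weight weight (fun k => fst (w k)) H1)
                         |apply (field_const weight weight (fun k => snd (w k)) H2)].
Qed.

Lemma local_vector_tangent (X : bisequence -> bisequence) (p : bisequence) :
  local_vector X -> phase p -> tangent (X p).
Proof.
  intros [H1 H2] Hp; split; [exact (field_value_rapid _ _ p H1 Hp)
                            |exact (field_value_rapid _ _ p H2 Hp)].
Qed.

(** * The adjoint of the recursion operator *)

Definition vanishing (T : Z -> C) : Prop := exists M, decay 1 T M.

Lemma vanishing_plus (f g : Z -> C) :
  vanishing f -> vanishing g -> vanishing (fun k => f k + g k)%C.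
Proof.
  intros [M HM] [M' HM']; exists (M + M'); intros k; specialize (HM k); specialize (HM' k).
  apply Rle_trans with (weight 1 k * (Cmod (f k) + Cmod (g k))); [|lra].
  apply Rmult_le_compat_l; [generalize (weight_ge_1 1 k); lra|apply Cmod_triangle].
Qed.

Lemma vanishing_opp (f : Z -> C) : vanishing f -> vanishing (fun k => - f k)%C.
Proof. intros [M HM]; exists M; intros k; rewrite Cmod_opp; apply HM. Qed.

Lemma rapid_vanishing (f : Z -> C) : rapid f -> vanishing f.
Proof. intros H; exact (H 1%nat). Qed.

Lemma vanishing_ext (f g : Z -> C) : (forall k, f k = g k) -> vanishing f -> vanishing g.
Proof. intros H [M HM]; exists M; intros k; rewrite <- H; apply HM. Qed.

Lemma tangent_sigma3 (w : bisequence) : tangent w -> tangent (sigma3 w).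
Proof. intros [H1 H2]; split; [exact H1|apply (rapid_opp _ H2)]. Qed.

Lemma rapid_terms (p w : bisequence) : phase p -> tangent w ->
  rapid (s_term p w) /\ rapid (a_term p w) /\ rapid (b_term p w) /\ rapid (t_term p w).
Proof.
  intros Hp Hw; assert (HX := local_vector_const w Hw).
  repeat split.
  - exact (field_value_rapid _ _ p (density_s_term _ HX) Hp).
  - exact (field_value_rapid _ _ p (density_a_term _ HX) Hp).
  - exact (field_value_rapid _ _ p (density_b_term _ HX) Hp).
  - exact (field_value_rapid _ _ p (density_t_term _ HX) Hp).
Qed.

Lemma rapid_pairing_term (p w w' : bisequence) :
  phase p -> tangent w -> tangent w' -> rapid (pairing_term p w w').
Proof.
  intros Hp Hw Hw'.
  exact (field_value_rapid _ _ p
    (density_pairing _ _ (local_vector_const w Hw) (local_vector_const w' Hw')) Hp).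
Qed.

Lemma Lplus_tangent (p w : bisequence) : phase p -> tangent w -> tangent (Lplus p w).
Proof.
  intros Hp Hw; exact (local_vector_tangent _ p (local_Lplus _ (local_vector_const w Hw)) Hp).
Qed.

Lemma Lminus_tangent (p w : bisequence) : phase p -> tangent w -> tangent (Lminus p w).
Proof.
  intros Hp Hw; exact (local_vector_tangent _ p (local_Lminus _ (local_vector_const w Hw)) Hp).
Qed.

(** The increment of this sequence is the difference of the summands of the two
    pairings. The products of two tails come from summation by parts; the other
    terms shift the remaining products until they agree site by site. *)
Definition adjoint_boundary (p w w' : bisequence) (k : Z) : C :=
  let q k := fst (p k) in let r k := snd (p k) in
  let u k := fst (w k) in let v k := snd (w k) in
  let a k := fst (w' k) in let b k := snd (w' k) in
  let s' := s_term p (sigma3 w') in let t' := t_term p (sigma3 w') in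
  ((sum_le k t' + (r k * b (k + 1)%Z - q k * a (k + 1)%Z
                   + r (k + 1)%Z * b k - q (k + 1)%Z * a k))
     * sum_ge (k + 1) (s_term p w)
   - sum_le k s' * (sum_ge (k + 1) (a_term p w) - sum_ge (k + 1) (b_term p w))
   + sum_le k s' * (q (k + 1)%Z * u k + r (k + 1)%Z * v k
                    + r k * v (k + 1)%Z + q k * u (k + 1)%Z)
   + (b k * u (k + 1)%Z + a k * v (k + 1)%Z
      - b (k + 1)%Z * u k - a (k + 1)%Z * v k))%C.

Lemma adjoint_boundary_vanishing (p w w' : bisequence) :
  phase p -> tangent w -> tangent w' -> vanishing (adjoint_boundary p w w').
Proof.
  intros Hp Hw Hw'.
  destruct (rapid_terms p w Hp Hw) as [Rs [Ra [Rb _]]].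
  destruct (rapid_terms p (sigma3 w') Hp (tangent_sigma3 w' Hw')) as [Rs' [_ [_ Rt']]].
  destruct Hp as [[Rq Rr] _], Hw as [Ru Rv], Hw' as [Rx Ry].
  assert (Rq1 := rapid_shift 1 _ Rq); assert (Rr1 := rapid_shift 1 _ Rr).
  assert (Ru1 := rapid_shift 1 _ Ru); assert (Rv1 := rapid_shift 1 _ Rv).
  assert (Rx1 := rapid_shift 1 _ Rx); assert (Ry1 := rapid_shift 1 _ Ry).
  assert (Fs : tame flat (fun k => sum_ge (k + 1) (s_term p w))).
  { apply (tame_ext flat (fun k => sum_ge k (fun j => s_term p w (j + 1)%Z))).
    - intros k; apply Csum_ext; intros n; f_equal; lia.
    - apply sum_ge_flat, (rapid_shift 1 _ Rs). }
  assert (Fs' := sum_le_flat _ Rs').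
  unfold adjoint_boundary; cbv zeta.
  apply (vanishing_ext (fun k =>
    (sum_le k (t_term p (sigma3 w')) * sum_ge (k + 1) (s_term p w)
     + (snd (p k) * snd (w' (k + 1)%Z) - fst (p k) * fst (w' (k + 1)%Z)
        + snd (p (k + 1)%Z) * snd (w' k) - fst (p (k + 1)%Z) * fst (w' k))
       * sum_ge (k + 1) (s_term p w)
     + - (sum_le k (s_term p (sigma3 w')) * sum_ge (k + 1) (a_term p w))
     + sum_le k (s_term p (sigma3 w')) * sum_ge (k + 1) (b_term p w)
     + sum_le k (s_term p (sigma3 w')) *
       (fst (p (k + 1)%Z) * fst (w k) + snd (p (k + 1)%Z) * snd (w k)
        + snd (p k) * snd (w (k + 1)%Z) + fst (p k) * fst (w (k + 1)%Z))
     + (snd (w' k) * fst (w (k + 1)%Z) + fst (w' k) * snd (w (k + 1)%Z)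
        - snd (w' (k + 1)%Z) * fst (w k) - fst (w' (k + 1)%Z) * snd (w k)))%C)).
  { intros k; ring. }
  apply vanishing_plus; [apply vanishing_plus; [apply vanishing_plus;
    [apply vanishing_plus; [apply vanishing_plus|]|]|]|].
  - apply tails_decay; assumption.
  - apply rapid_vanishing, rapid_mult_flat; [|exact Fs].
    apply rapid_minus; [apply rapid_plus; [apply rapid_minus|]|]; apply rapid_mult; assumption.
  - apply vanishing_opp, tails_decay; assumption.
  - apply tails_decay; assumption.
  - apply rapid_vanishing, flat_mult_rapid; [exact Fs'|].
    repeat apply rapid_plus; apply rapid_mult; assumption.
  - apply rapid_vanishing.
    apply rapid_minus; [apply rapid_minus; [apply rapid_plus|]|]; apply rapid_mult; assumption.
Qed.

Lemma Lplus_adjoint (p w w' : bisequence) : phase p -> tangent w -> tangent w' ->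
  pairing p (Lplus p w) w' = pairing p w (sigma3 (Lminus p (sigma3 w'))).
Proof.
  intros Hp Hw Hw'; unfold pairing; f_equal.
  apply sumZ_eq_telescoping with (adjoint_boundary p w w').
  - apply rapid_pairing_term; trivial; apply Lplus_tangent; assumption.
  - apply rapid_pairing_term; trivial.
    apply tangent_sigma3, Lminus_tangent, tangent_sigma3; assumption.
  - apply adjoint_boundary_vanishing; assumption.
  - intros k.
    destruct (rapid_terms p w Hp Hw) as [Rs [Ra [Rb _]]].
    destruct (rapid_terms p (sigma3 w') Hp (tangent_sigma3 w' Hw')) as [Rs' [_ [_ Rt']]].
    unfold adjoint_boundary; cbv zeta.
    unfold pairing_term, Lplus, L, Linv.
    cbn [fst snd sigma3].
    unfold Lminus; cbn [fst snd].
    replace (k - 1 + 1)%Z with k by lia.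
    rewrite (sum_ge_step k _ Rs), (sum_ge_step k _ Ra), (sum_ge_step k _ Rb).
    rewrite (sum_le_step k _ Rs'), (sum_le_step k _ Rt').
    set (S1 := sum_ge (k + 1) (s_term p w)).
    set (A1 := sum_ge (k + 1) (a_term p w)).
    set (B1 := sum_ge (k + 1) (b_term p w)).
    set (S0 := sum_le (k - 1) (s_term p (sigma3 w'))).
    set (T0 := sum_le (k - 1) (t_term p (sigma3 w'))).
    unfold s_term, a_term, b_term, t_term; cbn [fst snd sigma3].
    assert (Hn : (1 - snd (p k) * fst (p k))%C <> 0%C) by apply Hp.
    assert (Hn' : (1 - fst (p k) * snd (p k))%C <> 0%C)
      by (intros E; apply Hn; rewrite <- E; ring).
    generalize dependent (p k); intros [q0 r0] Hn Hn'; cbn [fst snd] in *.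
    field; auto.
Qed.

(** * Skew-symmetry *)

Definition vplus (w w' : bisequence) : bisequence := fun k =>
  (fst (w k) + fst (w' k), snd (w k) + snd (w' k))%C.
Definition vscal (c : C) (w : bisequence) : bisequence := fun k =>
  (c * fst (w k), c * snd (w k))%C.

Lemma bisequence_ext (w w' : bisequence) :
  (forall k, fst (w k) = fst (w' k)) -> (forall k, snd (w k) = snd (w' k)) -> w = w'.
Proof.
  intros H1 H2; apply functional_extensionality; intros k.
  rewrite (surjective_pairing (w k)), H1, H2; symmetry; apply surjective_pairing.
Qed.

Lemma vplus_tangent (w w' : bisequence) : tangent w -> tangent w' -> tangent (vplus w w').
Proof. intros [] []; split; apply rapid_plus; assumption. Qed.

Lemma vscal_tangent (c : C) (w : bisequence) : tangent w -> tangent (vscal c w).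
Proof. intros []; split; apply rapid_scal; assumption. Qed.

Lemma pairing_sym (p w w' : bisequence) : pairing p w w' = pairing p w' w.
Proof.
  unfold pairing; f_equal; apply sumZ_ext; intros k; unfold pairing_term; f_equal; ring.
Qed.

Lemma pairing_plus_l (p w w' z : bisequence) :
  phase p -> tangent w -> tangent w' -> tangent z ->
  pairing p (vplus w w') z = (pairing p w z + pairing p w' z)%C.
Proof.
  intros Hp Hw Hw' Hz; unfold pairing.
  replace (sumZ (pairing_term p (vplus w w') z))
    with (sumZ (fun k => pairing_term p w z k + pairing_term p w' z k)%C).
  - rewrite sumZ_plus by (apply rapid_pairing_term; assumption); ring.
  - apply sumZ_ext; intros k; unfold pairing_term, Cdiv, vplus; cbn [fst snd]; ring.
Qed.

Lemma pairing_scal_l (p : bisequence) (c : C) (w z : bisequence) :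
  phase p -> tangent w -> tangent z -> pairing p (vscal c w) z = (c * pairing p w z)%C.
Proof.
  intros Hp Hw Hz; unfold pairing.
  replace (sumZ (pairing_term p (vscal c w) z))
    with (sumZ (fun k => c * pairing_term p w z k)%C).
  - rewrite sumZ_scal by (apply rapid_pairing_term; assumption); ring.
  - apply sumZ_ext; intros k; unfold pairing_term, Cdiv, vscal; cbn [fst snd]; ring.
Qed.

Lemma pairing_opp_terms (p w w' z z' : bisequence) :
  phase p -> tangent z -> tangent z' ->
  (forall k, fst (w k) * snd (w' k) + snd (w k) * fst (w' k)
             = - (fst (z k) * snd (z' k) + snd (z k) * fst (z' k)))%C ->
  pairing p w w' = (- pairing p z z')%C.
Proof.
  intros Hp Hz Hz' H; unfold pairing.
  replace (sumZ (pairing_term p w w')) with (sumZ (fun k => RtoC (-1) * pairing_term p z z' k)%C).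
  - rewrite sumZ_scal by (apply rapid_pairing_term; assumption); ring.
  - apply sumZ_ext; intros k; unfold pairing_term, Cdiv; rewrite H; ring.
Qed.

Lemma pairing_sigma3 (p w w' : bisequence) : phase p -> tangent w -> tangent w' ->
  pairing p w (sigma3 w') = (- pairing p (sigma3 w) w')%C.
Proof.
  intros Hp Hw Hw'; apply pairing_opp_terms; [exact Hp|apply tangent_sigma3, Hw|exact Hw'|].
  intros k; unfold sigma3; cbn [fst snd]; ring.
Qed.

Lemma sigma3_involutive (w : bisequence) : sigma3 (sigma3 w) = w.
Proof. apply bisequence_ext; intros k; unfold sigma3; cbn [fst snd]; ring. Qed.

Lemma LsumE (p w : bisequence) : Lsum p w = vplus (Lplus p w) (Lminus p w).
Proof. reflexivity. Qed.

Lemma Lsum_tangent (p w : bisequence) : phase p -> tangent w -> tangent (Lsum p w).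
Proof.
  intros Hp Hw; rewrite LsumE; apply vplus_tangent; [apply Lplus_tangent|apply Lminus_tangent];
    assumption.
Qed.

(** Conjugating by [sigma3] exchanges [Lplus] and [Lminus] up to adjoints. The
    pairing changes sign when [sigma3] is moved across it, but this happens
    twice. *)
Lemma Lsum_adjoint (p w w' : bisequence) : phase p -> tangent w -> tangent w' ->
  pairing p w (Lsum p w') = pairing p (sigma3 (Lsum p (sigma3 w))) w'.
Proof.
  intros Hp Hw Hw'.
  assert (Tw := tangent_sigma3 w Hw); assert (Tw' := tangent_sigma3 w' Hw').
  assert (E1 : pairing p (Lplus p w') w = pairing p w' (sigma3 (Lminus p (sigma3 w))))
    by (apply Lplus_adjoint; assumption).
  assert (E2 : pairing p (sigma3 (Lplus p (sigma3 w))) w' = pairing p w (Lminus p w')).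
  { assert (E := Lplus_adjoint p (sigma3 w) (sigma3 w') Hp Tw Tw').
    rewrite sigma3_involutive in E.
    rewrite (pairing_sigma3 p (Lplus p (sigma3 w)) w') in E
      by (trivial; apply Lplus_tangent; assumption).
    rewrite (pairing_sigma3 p (sigma3 w) (Lminus p w')) in E
      by (trivial; apply Lminus_tangent; assumption).
    rewrite sigma3_involutive in E.
    transitivity (- (- pairing p (sigma3 (Lplus p (sigma3 w))) w'))%C; [ring|].
    rewrite E; ring. }
  rewrite pairing_sym, LsumE, pairing_plus_l;
    [|exact Hp|apply Lplus_tangent; assumption|apply Lminus_tangent; assumption|exact Hw].
  rewrite E1, (pairing_sym p (Lminus p w') w), <- E2.
  replace (sigma3 (Lsum p (sigma3 w)))
    with (vplus (sigma3 (Lplus p (sigma3 w))) (sigma3 (Lminus p (sigma3 w)))).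
  - rewrite pairing_plus_l; trivial.
    + rewrite (pairing_sym p w'); ring.
    + apply tangent_sigma3, Lplus_tangent; assumption.
    + apply tangent_sigma3, Lminus_tangent; assumption.
  - apply bisequence_ext; intros k; unfold vplus, sigma3, Lsum; cbn [fst snd]; ring.
Qed.

Lemma Lsum_scal (p : bisequence) (c : C) (w : bisequence) : phase p -> tangent w ->
  Lsum p (vscal c w) = vscal c (Lsum p w).
Proof.
  intros Hp Hw; destruct (rapid_terms p w Hp Hw) as [Rs [Ra [Rb Rt]]].
  assert (Es : forall k, (sum_ge k (s_term p (vscal c w)) = c * sum_ge k (s_term p w))%C).
  { intros k; rewrite <- sum_ge_scal by exact Rs; apply sum_ge_ext; intros j.
    unfold s_term, vscal, Cdiv; cbn [fst snd]; ring. }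
  assert (Ea : forall k, (sum_ge k (a_term p (vscal c w)) = c * sum_ge k (a_term p w))%C).
  { intros k; rewrite <- sum_ge_scal by exact Ra; apply sum_ge_ext; intros j.
    unfold a_term, vscal; cbn [fst snd]; ring. }
  assert (Eb : forall k, (sum_ge k (b_term p (vscal c w)) = c * sum_ge k (b_term p w))%C).
  { intros k; rewrite <- sum_ge_scal by exact Rb; apply sum_ge_ext; intros j.
    unfold b_term, vscal; cbn [fst snd]; ring. }
  assert (Es' : forall k, (sum_le k (s_term p (vscal c w)) = c * sum_le k (s_term p w))%C).
  { intros k; rewrite <- sum_le_scal by exact Rs; apply sum_le_ext; intros j.
    unfold s_term, vscal, Cdiv; cbn [fst snd]; ring. }
  assert (Et : forall k, (sum_le k (t_term p (vscal c w)) = c * sum_le k (t_term p w))%C).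
  { intros k; rewrite <- sum_le_scal by exact Rt; apply sum_le_ext; intros j.
    unfold t_term, vscal; cbn [fst snd]; ring. }
  apply bisequence_ext; intros k; unfold Lsum, Lplus, Lminus, L, Linv; cbn [fst snd];
    rewrite !Es, !Ea, !Eb, !Es', !Et; unfold vscal, Lsum, Lplus, Lminus, L, Linv;
    cbn [fst snd]; ring.
Qed.

(** Moving [rot] across the pairing gives [rot w], and [sigma3 (rot w)] is
    [rot_inv (J w)] times [Ci]: the argument of [Lsum] in [Kop p w], up to a
    scalar that commutes with [Lsum]. *)
Lemma Kop_skew (p w w' : bisequence) : phase p -> tangent w -> tangent w' ->
  pairing p w (Kop p w') = (- pairing p w' (Kop p w))%C.
Proof.
  intros Hp Hw Hw'; rewrite !KopE.
  set (y := rot_inv (J w)); set (y' := rot_inv (J w')).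
  assert (Trot : forall z, tangent z -> tangent (rot z))
    by (intros z [A B]; split; [exact B|apply rapid_opp, A]).
  assert (Ty : forall z, tangent z -> tangent (rot_inv (J z))).
  { intros z [A B]; split; unfold rot_inv, J; cbn [fst snd];
      [apply rapid_opp|]; apply rapid_scal; assumption. }
  assert (Hy : tangent y) by apply Ty, Hw.
  assert (Hy' : tangent y') by apply Ty, Hw'.
  assert (Hi : (Ci * Ci)%C = (- 1)%C) by (unfold Ci, Cmult, Copp, RtoC; simpl; f_equal; ring).
  transitivity (pairing p (rot w) (Lsum p y')).
  { unfold pairing; f_equal; apply sumZ_ext; intros k; unfold pairing_term, rot; cbn [fst snd].
    f_equal; ring. }
  rewrite Lsum_adjoint by (trivial; apply Trot, Hw).
  replace (sigma3 (rot w)) with (vscal Ci y).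
  2:{ apply bisequence_ext; intros k; unfold vscal, y, rot_inv, J, sigma3, rot; cbn [fst snd].
      - transitivity (- (Ci * Ci) * snd (w k))%C; [ring|rewrite Hi; ring].
      - transitivity (- (Ci * Ci) * fst (w k))%C; [ring|rewrite Hi; ring]. }
  rewrite Lsum_scal by assumption.
  apply pairing_opp_terms; [exact Hp|exact Hw'|apply Trot, Lsum_tangent; assumption|].
  intros k; unfold vscal, sigma3, rot, y', rot_inv, J; cbn [fst snd].
  set (a := fst (Lsum p y k)); set (b := snd (Lsum p y k)).
  transitivity (- (Ci * Ci) * (a * fst (w' k) - b * snd (w' k)))%C; [ring|rewrite Hi; ring].
Qed.

(** * Reality on the reduction *)

Lemma Im_real (z : C) : Cconj z = z -> Im z = 0.
Proof. destruct z as [a b]; unfold Cconj; simpl; intros H; injection H; lra. Qed.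

Lemma Cconj_RtoC (x : R) : Cconj (RtoC x) = RtoC x.
Proof. unfold Cconj, RtoC; simpl; f_equal; ring. Qed.

Lemma sumZ_conj (f : Z -> C) : sumZ (fun k => Cconj (f k)) = Cconj (sumZ f).
Proof.
  unfold sumZ; rewrite Cplus_conj; f_equal; apply Csum_conj.
Qed.

Lemma Cconj_reduced (p : bisequence) (k : Z) : reduced p ->
  Cconj (fst (p k)) = (- snd (p k))%C /\ Cconj (snd (p k)) = (- fst (p k))%C.
Proof.
  intros H; rewrite (H k), Copp_conj, Cconj_conj; split; [ring|reflexivity].
Qed.

(** The tangent vectors that [rot_inv] maps the reduced ones to. *)
Definition hermitian (w : bisequence) : Prop := forall k, snd (w k) = Cconj (fst (w k)).

Lemma Cconj_hermitian (w : bisequence) (k : Z) : hermitian w ->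
  Cconj (fst (w k)) = snd (w k) /\ Cconj (snd (w k)) = fst (w k).
Proof. intros H; rewrite (H k), Cconj_conj; split; reflexivity. Qed.

(** Conjugation fixes the sums of [s_term], exchanges those of [a_term] and
    [b_term] and changes the sign of those of [t_term]. *)
Section Reduction.
Context (p w : bisequence) (Hp : phase p) (Rp : reduced p) (Hw : hermitian w).

Let Hq k : Cconj (fst (p k)) = (- snd (p k))%C := proj1 (Cconj_reduced p k Rp).
Let Hr k : Cconj (snd (p k)) = (- fst (p k))%C := proj2 (Cconj_reduced p k Rp).
Let Hu k : Cconj (fst (w k)) = snd (w k) := proj1 (Cconj_hermitian w k Hw).
Let Hv k : Cconj (snd (w k)) = fst (w k) := proj2 (Cconj_hermitian w k Hw).

Lemma s_term_conj (k : Z) : Cconj (s_term p w k) = s_term p w k.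
Proof.
  unfold s_term.
  assert (Hn : (1 - snd (p k) * fst (p k))%C <> 0%C) by apply Hp.
  rewrite Cdiv_conj by exact Hn.
  rewrite !Cminus_conj, !Cmult_conj, Cconj_RtoC, Hq, Hr, Hu, Hv.
  replace (1 - - fst (p k) * - snd (p k))%C with (1 - snd (p k) * fst (p k))%C by ring.
  f_equal; ring.
Qed.

Lemma a_term_conj (k : Z) : Cconj (a_term p w k) = b_term p w k.
Proof.
  unfold a_term, b_term; rewrite Cminus_conj, !Cmult_conj, Hq, Hr, Hu, Hv; ring.
Qed.

Lemma b_term_conj (k : Z) : Cconj (b_term p w k) = a_term p w k.
Proof. rewrite <- a_term_conj; apply Cconj_conj. Qed.

Lemma t_term_conj (k : Z) : Cconj (t_term p w k) = (- t_term p w k)%C.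
Proof.
  unfold t_term; rewrite Cplus_conj, !Cmult_conj, !Cminus_conj, Hq, Hr, !Hu, !Hv; ring.
Qed.

Lemma sum_ge_conj (k : Z) (f g : Z -> C) : (forall j, Cconj (f j) = g j) ->
  Cconj (sum_ge k f) = sum_ge k g.
Proof.
  intros H; unfold sum_ge; rewrite <- Csum_conj; apply Csum_ext; intros n; apply H.
Qed.

Lemma sum_le_conj (k : Z) (f g : Z -> C) : (forall j, Cconj (f j) = g j) ->
  Cconj (sum_le k f) = sum_le k g.
Proof.
  intros H; unfold sum_le; rewrite <- Csum_conj; apply Csum_ext; intros n; apply H.
Qed.

Lemma sum_le_opp_total (k : Z) (f : Z -> C) :
  sum_le k (fun j => - f j)%C = (- sum_le k f)%C.
Proof.
  unfold sum_le, Csum, Copp; simpl; f_equal; apply Series_opp.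
Qed.

Lemma Lsum_hermitian : hermitian (Lsum p w).
Proof.
  intros k; unfold Lsum, Lplus, Lminus, L, Linv; cbn [fst snd].
  repeat first [rewrite Cplus_conj | rewrite Cminus_conj | rewrite Cmult_conj];
    rewrite !Cconj_RtoC.
  rewrite (sum_ge_conj k _ _ s_term_conj), (sum_ge_conj (k + 1) _ _ s_term_conj),
    (sum_ge_conj k _ _ a_term_conj), (sum_ge_conj (k + 1) _ _ b_term_conj),
    (sum_le_conj k _ _ s_term_conj), (sum_le_conj (k - 1) _ _ s_term_conj),
    (sum_le_conj k _ _ t_term_conj), sum_le_opp_total, !Hq, !Hr, !Hu, !Hv.
  ring.
Qed.
End Reduction.

Lemma Kop_reduced (p w : bisequence) :
  phase p -> reduced p -> reduced w -> reduced (Kop p w).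
Proof.
  intros Hp Rp Rw.
  assert (Hi : Cconj Ci = (- Ci)%C) by (unfold Ci, Cconj, Copp; simpl; f_equal; ring).
  assert (H : hermitian (rot_inv (J w))).
  { intros k; destruct (Cconj_reduced w k Rw) as [A B].
    unfold rot_inv, J; cbn [fst snd].
    rewrite Copp_conj, Cmult_conj, Hi, B; ring. }
  intros k; rewrite KopE; unfold rot; cbn [fst snd].
  rewrite (proj2 (Cconj_hermitian _ k (Lsum_hermitian p _ Hp Rp H))); reflexivity.
Qed.

(** The variations of q by [z] and of r by [- Cconj z] at one site are tangent to
    the reduction, so that the derivative of [F] along them is real; [z = 1] and
    [z = Ci] give the two components of the equation. *)
Lemma functional_derivative_reduced (F : bisequence -> C) (p : bisequence) (k : Z) :
  functional F -> phase p -> reduced p ->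
  snd (functional_derivative F p k) = (- Cconj (fst (functional_derivative F p k)))%C.
Proof.
  intros HF Hp Rp.
  assert (key : forall z : C, snd (fst (functional_derivative F p k) * z
                - snd (functional_derivative F p k) * Cconj z)%C = 0).
  { intros z; set (w := vplus (unit_q k z) (unit_r k (- Cconj z)%C)).
    assert (Hw : tangent w) by (apply vplus_tangent; [apply unit_q_tangent|apply unit_r_tangent]).
    assert (D := variation_translate F _ p w (functional_represents F HF) Hp Hw).
    replace (duality (functional_derivative F p) w) with
      (fst (functional_derivative F p k) * z - snd (functional_derivative F p k) * Cconj z)%C in D.
    2:{ assert (T := functional_derivative_tangent F p HF Hp).
        transitivity (duality (functional_derivative F p) (unit_q k z)
                      + duality (functional_derivative F p) (unit_r k (- Cconj z)%C))%C.
        - rewrite duality_unit_q, duality_unit_r; ring.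
        - unfold duality; rewrite <- sumZ_plus
            by (apply rapid_duality_term; trivial; [apply unit_q_tangent || apply unit_r_tangent]).
          apply sumZ_ext; intros j; unfold w, vplus; cbn [fst snd]; ring. }
    apply is_derive_C_parts in D.
    destruct D as [_ D]; apply is_derive_unique in D.
    refine (eq_trans (eq_sym D) _); apply is_derive_unique.
    apply (is_derive_ext_loc (fun _ => 0)); [|apply (is_derive_const (V := R_NormedModule))].
    assert (HP := plot_perturb _ _ (fun _ => w) (plot_const p Hp)
                    (smooth_bisequence_const _ w Hw)).
    assert (H0 : True /\ phase (perturb (fun _ : Rn 0 => p) (fun _ => w) (consR 0 (0 : Rn 0)))).
    { rewrite perturb_consR, translate_0; split; [exact Logic.I|exact Hp]. }
    generalize (locally_line (consR 0 (0 : Rn 0)) (consR 1 zero) _ (proj1 HP _ H0)).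
    apply filter_imp; intros t [_ Ht]; rewrite perturb_line in Ht.
    change (coordinate (consR 0 (0 : Rn 0)) + t) with (0 + t) in Ht; rewrite Rplus_0_l in Ht.
    symmetry; apply (functional_real F HF _ Ht).
    intros j; unfold translate, w, vplus, unit_q, unit_r; cbn [fst snd].
    rewrite (Rp j), Cplus_conj, Cmult_conj, Cconj_RtoC, Cplus_conj, Cconj_RtoC.
    destruct (Z.eq_dec j k); [|rewrite Cconj_RtoC]; ring. }
  assert (K1 := key (RtoC 1)); assert (K2 := key Ci).
  destruct (functional_derivative F p k) as [[a b] [c d]].
  unfold Cconj, Ci, RtoC, Cmult, Cminus, Cplus, Copp in *; simpl in *.
  f_equal; lra.
Qed.

Lemma gradient_reduced (F : bisequence -> C) (p : bisequence) :
  functional F -> phase p -> reduced p -> reduced (gradient F p).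
Proof.
  intros HF Hp Rp k; unfold gradient; cbn [fst snd].
  destruct (Cconj_reduced p k Rp) as [A B].
  rewrite (functional_derivative_reduced F p k HF Hp Rp).
  rewrite Cmult_conj, !Copp_conj, Cminus_conj, Cmult_conj, Cconj_RtoC, A, B, Cconj_conj; ring.
Qed.

Lemma pairing_real (p w w' : bisequence) :
  phase p -> reduced p -> reduced w -> reduced w' -> Im (pairing p w w') = 0.
Proof.
  intros Hp Rp Rw Rw'; apply Im_real; unfold pairing.
  rewrite Copp_conj, <- sumZ_conj; f_equal; apply sumZ_ext; intros k.
  destruct (Cconj_reduced p k Rp) as [A B], (Cconj_reduced w k Rw) as [A' B'],
    (Cconj_reduced w' k Rw') as [A'' B''].
  unfold pairing_term.
  rewrite Cdiv_conj.
  - rewrite Cplus_conj, !Cmult_conj, Cminus_conj, Cmult_conj, Cconj_RtoC, A, B, A', B', A'', B''.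
    replace (1 - - snd (p k) * - fst (p k))%C with (1 - fst (p k) * snd (p k))%C by ring.
    f_equal; ring.
  - intros E; apply (proj2 Hp k); rewrite <- E; ring.
Qed.

(** * The bracket *)

Lemma gradient_tangent (F : bisequence -> C) (p : bisequence) :
  functional F -> phase p -> tangent (gradient F p).
Proof. intros HF; exact (local_vector_tangent _ p (local_gradient F HF)). Qed.

Lemma Kop_tangent_vector (p w : bisequence) : phase p -> tangent w -> tangent (Kop p w).
Proof.
  intros Hp Hw; exact (local_vector_tangent _ p (local_Kop _ (local_vector_const w Hw)) Hp).
Qed.

Lemma sumZ_opp_total (f : Z -> C) : sumZ (fun k => - f k)%C = (- sumZ f)%C.
Proof.
  assert (H : forall a, Csum (fun n => - a n)%C = (- Csum a)%C)
    by (intros a; unfold Csum, Copp; simpl; f_equal; apply Series_opp).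
  unfold sumZ, sum_ge, sum_le; rewrite !H; ring.
Qed.

Lemma bracket_functional (F G : bisequence -> C) :
  functional F -> functional G -> functional (bracket_K F G).
Proof.
  intros HF HG.
  assert (E : bracket_K F G = fun p => sumZ (fun k =>
            - pairing_term p (gradient F p) (Kop p (gradient G p)) k)%C).
  { apply functional_extensionality; intros p; symmetry; apply sumZ_opp_total. }
  rewrite E; apply density_functional.
  - apply (density_opp (fun p => pairing_term p (gradient F p) (Kop p (gradient G p)))).
    apply density_pairing; [apply local_gradient, HF|].
    apply local_Kop, local_gradient, HG.
  - intros p Hp Rp; rewrite sumZ_opp_total.
    apply (pairing_real p (gradient F p) (Kop p (gradient G p)) Hp Rp).
    + apply gradient_reduced; assumption.
    + apply Kop_reduced, gradient_reduced; assumption.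
Qed.

Lemma is_derive_C_scal (a : R) (g : R -> C) (s : R) (l : C) :
  is_derive_C g s l ->
  is_derive_C (fun t => RtoC a * g t)%C s (RtoC a * l)%C.
Proof.
  intros H; apply is_derive_C_parts in H.
  rewrite <- scal_RtoC.
  apply (is_derive_ext (V := C_R_NormedModule) (fun t => scal a (g t : C_R_NormedModule)));
    [intros t; apply scal_RtoC|].
  apply is_derive_C_parts; split;
    [apply (is_derive_scal (fun t => fst (g t)))|apply (is_derive_scal (fun t => snd (g t)))];
    apply H.
Qed.

(** The common part of linearity and of the product rule: whatever the derivatives
    of [E] along plots express in terms of those of [F] and [G] holds for the
    functional derivatives. *)
Lemma functional_derivative_combination (E F G : bisequence -> C) (a b : bisequence -> C)
    (p : bisequence) :
  functional F -> functional G -> phase p ->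
  (forall (n : nat) (U : Rn n -> Prop) (c : Rn n -> bisequence) (x v : Rn n) (f' g' : C),
    plot U c -> U x ->
    is_derive_C (fun t : R => F (c (plus x (scal t v)))) 0 f' ->
    is_derive_C (fun t : R => G (c (plus x (scal t v)))) 0 g' ->
    is_derive_C (fun t : R => E (c (plus x (scal t v)))) 0 (a (c x) * f' + b (c x) * g')%C) ->
  functional_derivative E p
  = vplus (vscal (a p) (functional_derivative F p)) (vscal (b p) (functional_derivative G p)).
Proof.
  intros HF HG Hp HE.
  apply (functional_derivative_eq _ (fun p =>
    vplus (vscal (a p) (functional_derivative F p)) (vscal (b p) (functional_derivative G p))));
    trivial.
  intros n U c x v h Hc Hx D.
  assert (Pc : phase (c x)) by apply Hc, Hx.
  assert (Hh := plot_derivative_tangent x v h Hc Hx D).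
  assert (TF := functional_derivative_tangent F _ HF Pc).
  assert (TG := functional_derivative_tangent G _ HG Pc).
  assert (DE := HE n U c x v _ _ Hc Hx (functional_represents F HF n U c x v h Hc Hx D)
    (functional_represents G HG n U c x v h Hc Hx D)).
  replace (duality (vplus _ _) h) with
    (a (c x) * duality (functional_derivative F (c x)) h
     + b (c x) * duality (functional_derivative G (c x)) h)%C; [exact DE|].
  unfold duality; rewrite <- !sumZ_scal by (apply rapid_duality_term; assumption).
  rewrite <- sumZ_plus by (apply rapid_scal, rapid_duality_term; assumption).
  apply sumZ_ext; intros k; unfold vplus, vscal; cbn [fst snd]; ring.
Qed.

Lemma functional_derivative_linear (a b : R) (F G : bisequence -> C) (p : bisequence) :
  functional F -> functional G -> phase p ->
  functional_derivative (fun y => RtoC a * F y + RtoC b * G y)%C p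
  = vplus (vscal a (functional_derivative F p)) (vscal b (functional_derivative G p)).
Proof.
  intros HF HG Hp.
  apply (functional_derivative_combination _ F G (fun _ => RtoC a) (fun _ => RtoC b)); trivial.
  intros n U c x v f' g' _ _ DF DG.
  exact (is_derive_plus (V := C_R_NormedModule) _ _ 0 _ _
    (is_derive_C_scal a _ 0 _ DF) (is_derive_C_scal b _ 0 _ DG)).
Qed.

Lemma functional_derivative_mult (F G : bisequence -> C) (p : bisequence) :
  functional F -> functional G -> phase p ->
  functional_derivative (fun y => F y * G y)%C p
  = vplus (vscal (F p) (functional_derivative G p)) (vscal (G p) (functional_derivative F p)).
Proof.
  intros HF HG Hp.
  apply (functional_derivative_combination _ G F F G); trivial.
  intros n U c x v g' f' Hc Hx DG DF.
  assert (H := smooth_bilinear_derivative flat_ge_1 flat_ge_1 flat_ge_1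
    (bounded_product_flat (I := unit)) U (fun x _ => F (c x)) (fun x _ => G (c x)) x v
    (fun _ => f') (fun _ => g') (proj1 Hc) Hx
    (functional_smooth F HF n U c Hc) (functional_smooth G HG n U c Hc)
    (fun _ => DF) (fun _ => DG) tt).
  cbv beta in H.
  replace (F (c x) * g' + G (c x) * f')%C with (f' * G (c x) + F (c x) * g')%C by ring.
  exact H.
Qed.

Lemma gradient_combination (c c' : C) (E F G : bisequence -> C) (p : bisequence) :
  functional_derivative E p
  = vplus (vscal c (functional_derivative F p)) (vscal c' (functional_derivative G p)) ->
  gradient E p = vplus (vscal c (gradient F p)) (vscal c' (gradient G p)).
Proof.
  intros H; apply bisequence_ext; intros k; unfold gradient; rewrite H;
    unfold vplus, vscal; cbn [fst snd]; ring.
Qed.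

Lemma bracket_combination_l (c c' : C) (E F G H : bisequence -> C) (p : bisequence) :
  functional F -> functional G -> functional H -> phase p ->
  functional_derivative E p
  = vplus (vscal c (functional_derivative F p)) (vscal c' (functional_derivative G p)) ->
  bracket_K E H p = (c * bracket_K F H p + c' * bracket_K G H p)%C.
Proof.
  intros HF HG HH Hp HE; unfold bracket_K.
  rewrite (gradient_combination c c' E F G p HE).
  assert (TF := gradient_tangent F p HF Hp); assert (TG := gradient_tangent G p HG Hp).
  assert (TH := Kop_tangent_vector p _ Hp (gradient_tangent H p HH Hp)).
  rewrite pairing_plus_l, !pairing_scal_l; trivial; apply vscal_tangent; assumption.
Qed.

Lemma bracket_combination_r (c c' : C) (E F G H : bisequence -> C) (p : bisequence) :
  functional F -> functional G -> functional H -> phase p ->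
  functional_derivative E p
  = vplus (vscal c (functional_derivative F p)) (vscal c' (functional_derivative G p)) ->
  bracket_K H E p = (c * bracket_K H F p + c' * bracket_K H G p)%C.
Proof.
  intros HF HG HH Hp HE.
  assert (HT := gradient_tangent H p HH Hp).
  assert (TF := gradient_tangent F p HF Hp); assert (TG := gradient_tangent G p HG Hp).
  assert (TE : tangent (gradient E p)).
  { rewrite (gradient_combination c c' E F G p HE).
    apply vplus_tangent; apply vscal_tangent; assumption. }
  assert (C := bracket_combination_l c c' E F G H p HF HG HH Hp HE).
  unfold bracket_K in *.
  rewrite (Kop_skew p (gradient H p)), (Kop_skew p (gradient H p) (gradient F p)),
    (Kop_skew p (gradient H p) (gradient G p)), C by assumption; ring.
Qed.

Theorem corollary2 :
  (forall p : bisequence, phase p -> Kop_well_defined p) /\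
  (forall (F G : bisequence -> C) (p : bisequence),
     functional F -> functional G -> phase p ->
     abs_summable (pairing_term p (gradient F p) (Kop p (gradient G p)))) /\
  almost_poisson phase functional bracket_K.
Proof.
  split; [|split].
  - intros p Hp; split.
    + intros w Hw; destruct (rapid_terms p w Hp Hw) as [Rs [Ra [Rb Rt]]].
      repeat split; apply rapid_abs_summable; assumption.
    + intros w Hw; apply Kop_tangent_vector; assumption.
    + intros w w' Hw Hw'; apply Lplus_adjoint; assumption.
  - intros F G p HF HG Hp; apply rapid_abs_summable, rapid_pairing_term; trivial.
    + apply gradient_tangent; assumption.
    + apply Kop_tangent_vector, gradient_tangent; assumption.
  - split.
    + exact bracket_functional.
    + intros a b F G H p HF HG HH Hp; apply bracket_combination_l; trivial.
      apply functional_derivative_linear; assumption.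
    + intros a b F G H p HF HG HH Hp; apply bracket_combination_r; trivial.
      apply functional_derivative_linear; assumption.
    + intros F G p HF HG Hp; apply Kop_skew; trivial; apply gradient_tangent; assumption.
    + intros F G H p HF HG HH Hp; apply bracket_combination_l; trivial.
      apply functional_derivative_mult; assumption.
Qed.
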